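(* Let $\alpha\in(0,1)$. For any $n\in\mathbb{N}$, there exists a continuous function $\delta_n:(0,+\infty)\to\mathbb{R}$ such that $$\mathcal{I}_n(z)=\left(\frac1z\right)^{n+1}f_\alpha\left(\frac1z\right)e^{-n}\sqrt{\frac{2\pi}{n}}\,\bigl[1+\delta_n(z)\bigr]$$ and $|\delta_n(z)|\le\Delta(z)/n$ for any $z>0$, where $\Delta:(0,+\infty)\to(0,+\infty)$ is a suitable continuous function which is independent of $n$. Moreover, $\Delta$ can be chosen in such a way that $\Delta(z)=O(1)$ as $z\to0$, and $\Delta(z)f_\alpha(1/z)=O(z^{-\infty})$ as $z\to+\infty$.
   Context: $\mathbb{N}=\{1,2,\ldots\}$. The positive $\alpha$-stable density is $$f_\alpha(y)=\frac1\pi\sum_{j\ge1}\frac{(-1)^{j+1}}{j!}\sin(\pi\alpha j)\frac{\Gamma(\alpha j+1)}{y^{\alpha j+1}},\quad y>0.$$ For $z>0$ and $n\in\mathbb{N}$, $$\mathcal{I}_n(z):=\int_0^{+\infty}e^{-n\phi_z(y)}f_\alpha(y)\,dy,\qquad \phi_z(y):=zy-\log y.$$ $O(z^{-\infty})$ as $z\to+\infty$ means $O(z^{-p})$ as $z\to+\infty$ for every $p>0$. *)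

(* Defs.v *)
From HB Require Import structures.
From mathcomp Require Import all_boot all_order all_algebra.
From mathcomp Require Import all_classical all_reals all_analysis.

Set Implicit Arguments.
Unset Strict Implicit.
Unset Printing Implicit Defensive.

Import Order.TTheory GRing.Theory Num.Theory.
Import numFieldNormedType.Exports.

Local Open Scope classical_set_scope.
Local Open Scope ring_scope.

(* Euler's integral; only used for s > 1, where it converges. *)
Definition Gamma (R : realType) (s : R) : R :=
  \int[@lebesgue_measure R]_(t in `]0, +oo[) (t `^ (s - 1) * expR (- t)).

(* For 0 < alpha < 1 and y > 0 the series converges absolutely; the values at
   y <= 0 are irrelevant. *)
Definition stable_density (R : realType) (alpha y : R) : R :=
  pi^-1 * limn (fun N : nat => \sum_(1 <= j < N)
    ((-1) ^+ j.+1 / j`!%:R * sin (pi * alpha * j%:R) *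
     (Gamma (alpha * j%:R + 1) / y `^ (alpha * j%:R + 1)))).

Definition phi (R : realType) (z y : R) : R := z * y - ln y.

(* Valued in \bar R, so that equating it with a real number also asserts that
   the integral is finite. *)
Definition stable_integral (R : realType) (alpha : R) (n : nat) (z : R) :
    \bar R :=
  (\int[@lebesgue_measure R]_(y in `]0%R, +oo[)
     (expR (- n%:R * phi z y) * stable_density alpha y)%:E)%E.

(* The Landau notation f =O_F g needs F to be a canonical filter_on. *)
Canonical pinfty_nbhs_filter_on (R : numFieldType) :=
  FilterType (pinfty_nbhs R) _.

Canonical at_right_filter_on (R : numFieldType) (x : R) :=
  FilterType (at_right x) _.

(* g(z) = O(z^{-oo}) as z -> +oo *)
Definition bigO_zpow_ninfty (R : realType) (g : R -> R) : Prop :=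
  forall p : R, 0 < p -> g =O_ +oo (fun z : R => z `^ (- p)).

(* Main.v *)
(* Around y = 1/z, where the weight y^n e^{-nzy} concentrates, f = f_alpha is
   replaced by its affine approximation. The constant term integrates to
   f(1/z) n!/(nz)^{n+1}, in which Stirling's formula exhibits the leading factor;
   the linear and quadratic terms are smaller by a factor 1/n. Hence everything
   rests on the bound
     |f(y) - f(m) - (y - m) d| <= K ((y - m)/m)^2 (f(y) + H(m)),  f(y) <= K H(y),
   with H(y) = y^{-1-alpha} exp(-c y^{-alpha/(1-alpha)}), valid for all y, m > 0.
   It is read off Zolotarev's positive integral representation of f, in which the
   kernel v e^{-v}/y, v = Z(t) y^{-alpha/(1-alpha)}, is expanded in y for each t.
   To reach that representation, the series is summed into Pollard's integral
   pi f(y) = Im int_0^oo -e^{-yu} exp(-e^{i pi alpha} u^alpha) du, whose contour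
   is then turned to the curve where y s - s^alpha is real.
   The outcome is Delta(z) = const M(z)/f(1/z) with
   M(z) = z^{1+alpha} exp(-c' z^alpha); it is bounded near 0 because the first
   term of the series gives f(1/z) >= k z^{1+alpha} there. *)
Require Import Defs.
From HB Require Import structures.
From mathcomp Require Import all_boot all_order all_algebra.
From mathcomp Require Import all_classical all_reals all_analysis.
From mathcomp Require Import measurable_realfun ring lra.

Set Implicit Arguments.
Unset Strict Implicit.
Unset Printing Implicit Defensive.

Import Order.TTheory GRing.Theory Num.Theory.
Import numFieldNormedType.Exports.

Local Open Scope classical_set_scope.
Local Open Scope ring_scope.

(** * Calculus *)

(** The series alternates, so neither the sign of f nor its decay at 0 can be read off it; the
    positive representation supplies both. All errors must be uniform in z and in every n >= 1, and
    two features shape the estimate. Away from m = 1/z, f(y) is not comparable with H(m), so f(y)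
    itself stays on the right of the key bound. It is handled afterwards by H(y) <= (z y)^(-1-alpha)
    exp(z y/2) M(z), which moves the decay to the point z at the price of half a unit of exponential
    rate: n z becomes (n - 1/2) z, harmless even for n = 1. The singularity at y = 0 is tolerable
    for n = 1 because y^n lowers it to an integrable power. The derivatives of the kernel are
    bounded by multiples of v e^(-theta v) with 0 < theta < 1, and a change of scale in y identifies
    the integrals of these with f at another point, so that one upper bound of f serves for all. The
    contour is turned in real variables only: the integral over a segment from 0 to the curve is
    differentiated in the angle, and closedness of the form leaves just the endpoint
    contribution. *)

Section calculus.
Context {R : realType}.
Implicit Types (f g : R -> R) (x a b p : R).

(* An alias of [is_derive _ 1] hiding it from type class resolution. *)
Definition has_derive f x a := is_derive x 1 f a.

Lemma has_derive_eq f x a b : has_derive f x a -> a = b -> has_derive f x b.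
Proof. by move=> fa <-. Qed.

Lemma has_derive_const (k : R) x : has_derive (fun=> k) x 0.
Proof. exact: is_derive_cst. Qed.

Lemma has_derive_id x : has_derive (fun t => t) x 1.
Proof. exact: is_derive_id. Qed.

Lemma has_derive_add f g x a b :
  has_derive f x a -> has_derive g x b -> has_derive (fun t => f t + g t) x (a + b).
Proof. by move=> fa gb; exact: is_deriveD. Qed.

Lemma has_derive_opp f x a : has_derive f x a -> has_derive (fun t => - f t) x (- a).
Proof. by move=> fa; exact: is_deriveN. Qed.

Lemma has_derive_mul f g x a b : has_derive f x a -> has_derive g x b ->
  has_derive (fun t => f t * g t) x (a * g x + f x * b).
Proof.
move=> fa gb; apply: (is_derive_eq (is_deriveM fa gb)).
by rewrite addrC mulrC.
Qed.

Lemma has_derive_inv f x a : f x != 0 -> has_derive f x a ->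
  has_derive (fun t => (f t)^-1) x (- a / f x ^+ 2).
Proof.
move=> fx fa; apply: (is_derive_eq (is_deriveV fx fa)).
by rewrite /GRing.scale /= mulrC mulrN mulNr.
Qed.

Lemma has_derive_exp f x a : has_derive f x a ->
  has_derive (fun t => expR (f t)) x (expR (f x) * a).
Proof. by move=> fa; exact: (is_derive1_comp (f:=expR)). Qed.

Lemma has_derive_sin f x a : has_derive f x a ->
  has_derive (fun t => sin (f t)) x (cos (f x) * a).
Proof. by move=> fa; exact: (is_derive1_comp (f:=sin)). Qed.

Lemma has_derive_cos f x a : has_derive f x a ->
  has_derive (fun t => cos (f t)) x (- sin (f x) * a).
Proof. by move=> fa; exact: (is_derive1_comp (f:=cos)). Qed.

Lemma has_derive_ln f x a : 0 < f x -> has_derive f x a ->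
  has_derive (fun t => ln (f t)) x (a / f x).
Proof.
move=> fx fa; have h := is_derive1_ln fx.
by apply: (is_derive_eq (is_derive1_comp h fa)); rewrite mulrC.
Qed.

Lemma has_derive_powR f x a p : 0 < f x -> has_derive f x a ->
  has_derive (fun t => f t `^ p) x (p * f x `^ (p - 1) * a).
Proof.
move=> fx fa; have h := is_derive1_powR p fx.
exact: (is_derive1_comp h fa).
Qed.

Lemma has_derive_exprn f x a n : has_derive f x a ->
  has_derive (fun t => f t ^+ n) x (n%:R * f x ^+ n.-1 * a).
Proof.
case: n => [|n] fa.
  by rewrite mul0r mul0r; apply: has_derive_const.
have := is_deriveX n.+1 fa; rewrite exprfctE => h; apply: (is_derive_eq h).
by rewrite /GRing.scale /=.
Qed.

Lemma has_derive_continuous f x a : has_derive f x a -> {for x, continuous f}.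
Proof.
by move=> [df _]; apply/differentiable_continuous/derivable1_diffP.
Qed.

Lemma has_derive_MVT f (f' : R -> R) a b : a <= b ->
  (forall x, a <= x <= b -> has_derive f x (f' x)) ->
  exists2 c : R, a <= c <= b & f b - f a = f' c * (b - a).
Proof.
move=> ab df.
have df' x : x \in `]a, b[ -> is_derive x 1 f (f' x).
  by rewrite in_itv => /= /andP[/ltW ax /ltW xb]; apply: df; rewrite ax.
have cf : {within `[a, b], continuous f}.
  apply: derivable_within_continuous => x; rewrite in_itv => /= xab.
  by have [] := df x xab.
by have [c cab E] := MVT_segment ab df' cf; exists c => //; move: cab; rewrite in_itv.
Qed.

Lemma has_derive_ge0_le f (f' : R -> R) a b : a <= b ->
  (forall x, a <= x <= b -> has_derive f x (f' x)) ->
  (forall x, a <= x <= b -> 0 <= f' x) -> f a <= f b.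
Proof.
move=> ab df f'0; have [c cab E] := has_derive_MVT ab df.
by rewrite -subr_ge0 E mulr_ge0 ?subr_ge0// f'0.
Qed.

(** Two applications of the mean value theorem write the remainder as [f2 d * (c - m) * (y - m)]
    with c no farther from m than y; hence K rather than K / 2, and points y on either side of m are
    covered. *)
Lemma taylor2 (f f1 f2 : R -> R) (a b m K : R) :
  (forall x, x \in `[a, b] -> has_derive f x (f1 x)) ->
  (forall x, x \in `[a, b] -> has_derive f1 x (f2 x)) ->
  (forall x, x \in `[a, b] -> `|f2 x| <= K) ->
  m \in `[a, b] ->
  forall y, y \in `[a, b] -> `|f y - f m - (y - m) * f1 m| <= K * (y - m) ^+ 2.
Proof.
move=> df df1 f2K mab y yab.
have sub (u v : R) : u \in `[a, b] -> v \in `[a, b] ->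
    forall t, t \in `[u, v] -> t \in `[a, b].
  move=> /[!in_itv]/= /andP[au _] /andP[_ vb] t /[!in_itv]/= /andP[ut tv].
  by rewrite (le_trans au ut) (le_trans tv vb).
have mvt (g g' : R -> R) (u v : R) : (forall x : R, x \in `[a, b] -> has_derive g x (g' x)) ->
    u \in `[a, b] -> v \in `[a, b] -> u <= v ->
    exists2 c : R, c \in `[u, v] & g v - g u = g' c * (v - u).
  move=> dg uab vab uv.
  have dg' x : u <= x <= v -> has_derive g x (g' x).
    by move=> xuv; apply: dg; apply: (sub u v) => //; rewrite in_itv.
  by have [c cuv E] := has_derive_MVT uv dg'; exists c; rewrite ?in_itv.
have mvt' (g g' : R -> R) (u v : R) : (forall x : R, x \in `[a, b] -> has_derive g x (g' x)) ->
    u \in `[a, b] -> v \in `[a, b] ->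
    exists c : R, [/\ c \in `[a, b], `|c - u| <= `|v - u| & g v - g u = g' c * (v - u)].
  move=> dg uab vab; have [uv|/ltW vu] := leP u v.
    have [c cuv E] := mvt _ _ _ _ dg uab vab uv.
    exists c; split => //; first exact: (sub u v).
    move: cuv; rewrite in_itv/= => /andP[uc cv].
    by rewrite !ger0_norm ?subr_ge0// lerB.
  have [c cuv E] := mvt _ _ _ _ dg vab uab vu.
  exists c; split => //; first exact: (sub v u).
    move: cuv; rewrite in_itv/= => /andP[uc cv].
    by rewrite !ler0_norm ?subr_le0// lerN2 lerB.
  by rewrite -opprB E -mulrN opprB.
have [c [cab cy E]] := mvt' _ _ _ _ df mab yab.
have [d [dab _ E']] := mvt' _ _ _ _ df1 mab cab.
have -> : f y - f m - (y - m) * f1 m = f2 d * (c - m) * (y - m).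
  by rewrite E -E'; ring.
rewrite !normrM -[(y - m) ^+ 2]ger0_norm ?sqr_ge0// normrX expr2 mulrA.
apply: ler_wpM2r => //; apply: ler_pM => //; exact: f2K.
Qed.

End calculus.

Ltac derive_side := solve [ assumption | lra | apply: lt0r_neq0; solve [assumption | lra] ].
(** The shape of the function body selects the rule and the value of the derivative is left to
    unification, so that [derive] leaves only the identity between the computed derivative and the
    claimed one. Hypotheses are tried first: a function whose derivative is already known is not
    taken apart. *)
Ltac derive_step := lazymatch goal with
  | H : has_derive ?f ?x _ |- has_derive ?f ?x _ => exact: H
  | |- has_derive (fun _ => ?c) _ _ => exact: has_derive_const
  | |- has_derive (fun t => t) _ _ => exact: has_derive_id
  | |- has_derive (fun t => @?f t + @?g t) _ _ => apply: (@has_derive_add _ f g)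
  | |- has_derive (fun t => - @?f t) _ _ => apply: (@has_derive_opp _ f)
  | |- has_derive (fun t => @?f t * @?g t) _ _ => apply: (@has_derive_mul _ f g)
  | |- has_derive (fun t => (@?f t)^-1) _ _ => apply: (@has_derive_inv _ f)
  | |- has_derive (fun t => @?f t ^+ ?n) _ _ => apply: (@has_derive_exprn _ f)
  | |- has_derive (fun t => @?f t `^ ?p) _ _ => apply: (@has_derive_powR _ f)
  | |- has_derive (fun t => expR (@?f t)) _ _ => apply: (@has_derive_exp _ f)
  | |- has_derive (fun t => ln (@?f t)) _ _ => apply: (@has_derive_ln _ f)
  | |- has_derive (fun t => sin (@?f t)) _ _ => apply: (@has_derive_sin _ f)
  | |- has_derive (fun t => cos (@?f t)) _ _ => apply: (@has_derive_cos _ f)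
  | |- is_true _ => derive_side
  end.
Ltac derive := apply: has_derive_eq; [solve [repeat derive_step] | rewrite /=].

(** * Continuity on a set *)

Section within_continuity.
Context {R : realType} (A : set R).
Implicit Types f g : R -> R.

Lemma within_continuous_const (k : R) : {within A, continuous (fun=> k)}.
Proof. by move=> x; exact: cvg_cst. Qed.

Lemma within_continuous_id : {within A, continuous (fun x : R => x)}.
Proof. by apply: continuous_subspaceT => x; exact: cvg_id. Qed.

Lemma within_continuous_add f g : {within A, continuous f} ->
  {within A, continuous g} -> {within A, continuous (fun x => f x + g x)}.
Proof. by move=> cf cg x; apply: cvgD; [exact: cf|exact: cg]. Qed.

Lemma within_continuous_opp f : {within A, continuous f} ->
  {within A, continuous (fun x => - f x)}.
Proof. by move=> cf x; apply: cvgN; exact: cf. Qed.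

Lemma within_continuous_mul f g : {within A, continuous f} ->
  {within A, continuous g} -> {within A, continuous (fun x => f x * g x)}.
Proof. by move=> cf cg x; apply: cvgM; [exact: cf|exact: cg]. Qed.

Lemma within_continuous_comp f g : continuous g -> {within A, continuous f} ->
  {within A, continuous (fun x => g (f x))}.
Proof. by move=> cg cf x; apply: (@cvg_comp _ _ _ f g _ _ _ (cf x)); exact: cg. Qed.

End within_continuity.

Ltac wcont_step := lazymatch goal with
  | H : {within ?A, continuous ?f} |- {within ?A, continuous ?f} => exact: H
  | |- {within _, continuous (fun _ => ?c)} => exact: within_continuous_const
  | |- {within _, continuous (fun x => x)} => exact: within_continuous_id
  | |- {within _, continuous (fun x => @?f x + @?g x)} => apply: (@within_continuous_add _ _ f g)
  | |- {within _, continuous (fun x => - @?f x)} => apply: (@within_continuous_opp _ _ f)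
  | |- {within _, continuous (fun x => @?f x * @?g x)} => apply: (@within_continuous_mul _ _ f g)
  | |- {within _, continuous (fun x => expR (@?f x))} =>
      apply: (@within_continuous_comp _ _ f expR (@continuous_expR _))
  | |- {within _, continuous (fun x => sin (@?f x))} =>
      apply: (@within_continuous_comp _ _ f sin (@continuous_sin _))
  | |- {within _, continuous (fun x => cos (@?f x))} =>
      apply: (@within_continuous_comp _ _ f cos (@continuous_cos _))
  end.

(** * Integrals of real-valued functions *)

Section real_integrals.
Context d (T : measurableType d) {R : realType} (mu : {measure set T -> \bar R}).
Implicit Types (f g : T -> R) (A D : set T) (r : R).

(** For f >= 0 the norm disappears from the definition of integrability, so a finite value in
    [\bar R] already gives it. Explicit integrals computed by the fundamental theorem thus come with
    integrability. *)
Lemma integral_EFin_integrable D f r : measurable_fun D f -> measurable D ->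
  (forall x, D x -> 0 <= f x) -> (\int[mu]_(x in D) (f x)%:E = r%:E)%E ->
  mu.-integrable D (EFin \o f) /\ \int[mu]_(x in D) f x = r.
Proof.
move=> mf mD f0 fr; split; last by rewrite /Rintegral fr.
apply/integrableP; split; first exact/measurable_EFinP.
under eq_integral => x /[!inE] Dx do rewrite /= ger0_norm ?f0//.
by rewrite fr ltry.
Qed.

Lemma integrable_EFin_Rintegral D f : measurable D -> mu.-integrable D (EFin \o f) ->
  (\int[mu]_(x in D) (f x)%:E = (\int[mu]_(x in D) f x)%:E)%E.
Proof. by move=> mD fi; rewrite /Rintegral fineK//; exact: integrable_fin_num. Qed.

Lemma le_integrable_EFin D f g : measurable D -> measurable_fun D f ->
  (forall x, D x -> `|f x| <= g x) -> mu.-integrable D (EFin \o g) ->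
  mu.-integrable D (EFin \o f).
Proof.
move=> mD mf fg; apply: le_integrable => //; first exact/measurable_EFinP.
by move=> x Dx; rewrite lee_fin (le_trans (fg _ Dx))// ler_norm.
Qed.

Lemma integrableZl_EFin D f (c : R) : measurable D -> mu.-integrable D (EFin \o f) ->
  mu.-integrable D (EFin \o (fun x => c * f x)).
Proof. by move=> mD fi; exact: (integrableZl mD c fi). Qed.

Lemma integrableD_EFin D f g : measurable D -> mu.-integrable D (EFin \o f) ->
  mu.-integrable D (EFin \o g) -> mu.-integrable D (EFin \o (fun x => f x + g x)).
Proof. by move=> mD fi gi; exact: (integrableD mD fi gi). Qed.

Lemma integrableB_EFin D f g : measurable D -> mu.-integrable D (EFin \o f) ->
  mu.-integrable D (EFin \o g) -> mu.-integrable D (EFin \o (fun x => f x - g x)).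
Proof. by move=> mD fi gi; exact: (integrableB mD fi gi). Qed.

Lemma integrable_patch_EFin A D f : measurable A -> measurable D ->
  mu.-integrable D (EFin \o f) -> mu.-integrable A (EFin \o (f \_ D)).
Proof.
move=> mA mD fi; rewrite -restrict_EFin.
apply: (@integrableS _ _ _ mu setT) => //.
exact/(integrable_mkcond _ mD).1.
Qed.

End real_integrals.

Section integrals.
Context {R : realType}.
Notation mu := (@lebesgue_measure R).
Implicit Types (f g : R -> R) (D : set R) (x : R).

Lemma continuous_measurable_fun0y f :
  (forall x, 0 < x -> {for x, continuous f}) -> measurable_fun `](0 : R), +oo[ f.
Proof.
move=> cf; apply: open_continuous_measurable_fun => //.
by move=> x /[!inE]/=; rewrite in_itv/= andbT; exact: cf.
Qed.

Lemma Rintegral0y_FTC f (F : R -> R) (l : R) : (forall x, 0 <= x -> 0 <= f x) ->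
  (forall x, {for x, continuous f}) ->
  (forall x, has_derive F x (f x)) -> F x @[x --> +oo] --> l ->
  mu.-integrable `](0 : R), +oo[ (EFin \o f) /\ \int[mu]_(x in `]0, +oo[) f x = l - F 0.
Proof.
move=> f0 cf dF Fl.
have mf : measurable_fun `](0 : R), +oo[ f by exact: continuous_measurable_fun0y.
apply: integral_EFin_integrable => //.
  by move=> x /=; rewrite in_itv/= andbT => /ltW; exact: f0.
rewrite integral_itv_obnd_cbnd; last exact/measurable_EFinP.
apply: (@ge0_continuous_FTC2y _ f F) => //.
- apply/continuous_within_itvcyP; split; first by move=> x _; exact: cf.
  by apply: cvg_at_right_filter; exact: cf.
- by move=> x _; have [] := dF x.
- by apply: cvg_at_right_filter; exact: has_derive_continuous (dF 0).
- by move=> x _; rewrite derive1E; have [] := dF x.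
Qed.

(** The term of degree k + 1 in the series of exp(s x) bounds the expression by (k+1)! / (s^(k+1)
    x). *)
Lemma cvg_exprn_expR k (s : R) : 0 < s ->
  x ^+ k * expR (- s * x) @[x --> +oo] --> (0 : R).
Proof.
move=> s0.
have C0 : 0 < (k.+1)`!%:R / s ^+ k.+1 :> R by rewrite divr_gt0 ?exprn_gt0.
apply: (@squeeze_cvgr _ _ _ _ (cst 0) (fun x => (k.+1)`!%:R / s ^+ k.+1 * x^-1)).
- near=> x; have x0 : 0 < x by near: x; exact: nbhs_pinfty_gt.
  rewrite /= mulr_ge0 ?expR_ge0 ?exprn_ge0 ?(ltW x0)//=.
  rewrite mulNr expRN ler_pdivrMr ?expR_gt0//.
  have := @expR_ge1Dxn R (s * x) k (ltW (mulr_gt0 s0 x0)).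
  move=> h; have {}h : (s * x) ^+ k.+1 / (k.+1)`!%:R <= expR (s * x).
    by apply: le_trans h; rewrite lerDr.
  apply: le_trans (ler_wpM2l _ h); last by rewrite mulr_ge0 ?invr_ge0 ?(ltW x0)// ltW.
  rewrite exprMn exprSr le_eqVlt; apply/orP; left; apply/eqP.
  rewrite [x ^+ k.+1]exprSr; field.
  by rewrite !gt_eqF ?exprn_gt0// ltr0n fact_gt0.
- exact: cvg_cst.
- rewrite -(mulr0 ((k.+1)`!%:R / s ^+ k.+1)); apply: cvgM; first exact: cvg_cst.
  apply/gtr0_cvgV0 => //; first by near=> x; near: x; exact: nbhs_pinfty_gt.
Unshelve. all: by end_near. Qed.

(** Integration by parts is carried out on the primitives: each is built from the previous one, and
    all are normalised to vanish at +oo, so that the moment integral is [- F 0]. *)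
Lemma exprn_expR_primitive k (s : R) : 0 < s -> exists F : R -> R,
  [/\ forall x, has_derive F x (x ^+ k * expR (- s * x)),
      F x @[x --> +oo] --> (0 : R) & F 0 = - (k`!%:R / s ^+ k.+1)].
Proof.
move=> s0; elim: k => [|k [F [dF F0 F00]]].
  exists (fun x => - s^-1 * (x ^+ 0 * expR (- s * x))); split.
  - move=> x; derive.
    by rewrite !expr0; field; rewrite gt_eqF.
  - rewrite -[X in _ --> X](mulr0 (- s^-1)); apply: cvgM; [exact: cvg_cst|exact: cvg_exprn_expR].
  - by rewrite !mulr0 expR0 expr0 mulr1 mulr1 fact0 expr1 mul1r.
exists (fun x => - s^-1 * (x ^+ k.+1 * expR (- s * x)) + k.+1%:R / s * F x); split.
- move=> x; have dFx := dF x; derive.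
  by rewrite exprSr; field; rewrite gt_eqF.
- rewrite -[X in _ --> X](addr0 0); apply: cvgD.
    rewrite -[X in _ --> X](mulr0 (- s^-1)); apply: cvgM; [exact: cvg_cst|exact: cvg_exprn_expR].
  by rewrite -[X in _ --> X](mulr0 (k.+1%:R / s)); apply: cvgM; [exact: cvg_cst|].
- rewrite F00 expr0n/= mul0r mulr0 add0r factS natrM [s ^+ k.+2]exprS.
  by field; rewrite !gt_eqF ?exprn_gt0.
Qed.

Lemma Rintegral_exprn_expR k (s : R) : 0 < s ->
  mu.-integrable `](0 : R), +oo[ (EFin \o (fun x => x ^+ k * expR (- s * x))) /\
  \int[mu]_(x in `]0, +oo[) (x ^+ k * expR (- s * x)) = k`!%:R / s ^+ k.+1.
Proof.
move=> s0; have [F [dF F0 F00]] := exprn_expR_primitive k s0.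
have -> : k`!%:R / s ^+ k.+1 = 0 - F 0 by rewrite F00 opprK add0r.
apply: Rintegral0y_FTC => //.
  by move=> x x0; rewrite mulr_ge0 ?expR_ge0 ?exprn_ge0.
move=> x; apply: cvgM; first exact: exprn_continuous.
by apply: continuous_comp; [apply: cvgM; [exact: cvg_cst|exact: cvg_id]|exact: continuous_expR].
Qed.

Lemma Rintegral0y_scale g (c : R) : 0 < c -> {within `[0, +oo[, continuous g} ->
  (forall x, 0 <= x -> 0 <= g x) -> mu.-integrable `](0 : R), +oo[ (EFin \o g) ->
  mu.-integrable `](0 : R), +oo[ (EFin \o (fun x => g (c * x))) /\
  \int[mu]_(x in `]0, +oo[) g (c * x) = c^-1 * \int[mu]_(x in `]0, +oo[) g x.
Proof.
move=> c0 cg g0 gi.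
have d x : has_derive (fun t => c * t) x c.
  derive.
  by ring.
have dE : (fun t => c * t)^`()%classic = cst c.
  by apply/funext => x; rewrite derive1E; have [_ ->] := d x.
have mgc : measurable_fun `](0 : R), +oo[ (fun x => g (c * x)).
  move/continuous_within_itvcyP : cg => [cg _].
  apply: continuous_measurable_fun0y => x x0.
  apply: (@continuous_comp _ _ _ (fun t => c * t) g); first exact: has_derive_continuous (d x).
  by apply: cg; rewrite in_itv/= andbT mulr_gt0.
have mg : measurable_fun `](0 : R), +oo[ g by move/integrableP : gi => [/measurable_EFinP].
have H : (\int[mu]_(x in `]0%R, +oo[) (g x)%:E =
      c%:E * \int[mu]_(x in `]0%R, +oo[) (g (c * x)%R)%:E)%E.
  rewrite integral_itv_obnd_cbnd; last exact/measurable_EFinP.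
  rewrite [in RHS]integral_itv_obnd_cbnd; last exact/measurable_EFinP.
  have -> : `[(0 : R), +oo[%classic = `[c * 0, +oo[%classic by rewrite mulr0.
  rewrite (@increasing_ge0_integration_by_substitutiony _ (fun t => c * t) g 0).
  - rewrite mulr0 -ge0_integralZl//; last first.
    + by rewrite lee_fin ltW.
    + by move=> x/=; rewrite in_itv/= andbT => x0; rewrite lee_fin g0// mulr_ge0// ltW.
    + by apply/measurable_EFinP/measurable_fun_itv_obnd_cbndP.
    by apply: eq_integral => x _; rewrite dE fctE muleC.
  - by move=> x y _ _ xy; rewrite ltr_pM2l.
  - by rewrite dE => x _; exact: cvg_cst.
  - by rewrite dE; exact: is_cvg_cst.
  - by rewrite dE; exact: is_cvg_cst.
  - split; first by move=> x _; have [] := d x.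
    by apply: cvg_at_right_filter; exact: has_derive_continuous (d 0).
  - exact: gt0_cvgMry.
  - by rewrite mulr0.
  - by rewrite mulr0 => x; rewrite in_itv/= andbT => /ltW; exact: g0.
apply: integral_EFin_integrable => //.
  by move=> x/=; rewrite in_itv/= andbT => x0; rewrite g0// mulr_ge0// ltW.
rewrite integrable_EFin_Rintegral// in H.
rewrite EFinM H muleA -EFinM mulVf ?mul1e// gt_eqF//.
Qed.

End integrals.

Section segment_integrals.
Context {R : realType}.
Notation mu := (@lebesgue_measure R).
Implicit Types (f F : R -> R) (a b x : R).

Lemma segment_integrable f a b : {within `[a, b], continuous f} ->
  mu.-integrable `[a, b] (EFin \o f).
Proof. by move=> cf; apply: continuous_compact_integrable => //; exact: segment_compact. Qed.

Lemma Rintegral_segment_FTC f F a b : a < b -> {within `[a, b], continuous f} ->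
  {within `[a, b], continuous F} ->
  (forall x, a < x < b -> has_derive F x (f x)) ->
  \int[mu]_(x in `[a, b]) f x = F b - F a.
Proof.
move=> ab cf /(continuous_within_itvP _ ab)[_ Fa Fb] dF.
rewrite /Rintegral (@continuous_FTC2 _ f F)//.
  by split => // x; rewrite in_itv => /dF[].
by move=> x; rewrite in_itv => /dF[df <-]; rewrite derive1E.
Qed.

Lemma continuous_within f (A : set R) : (forall x, {for x, continuous f}) ->
  {within A, continuous f}.
Proof. by move=> cf; apply: continuous_subspaceT => x; exact: cf. Qed.

End segment_integrals.

Section interval_integrals.
Context {R : realType}.
Notation mu := (@lebesgue_measure R).
Implicit Types (f g : R -> R) (i : interval R) (c : R).

Lemma integrableZl_itv i f c : mu.-integrable [set` i] (EFin \o f) ->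
  mu.-integrable [set` i] (EFin \o (fun x => c * f x)).
Proof. by move=> fi; apply: integrableZl_EFin. Qed.

Lemma integrableD_itv i f g : mu.-integrable [set` i] (EFin \o f) ->
  mu.-integrable [set` i] (EFin \o g) ->
  mu.-integrable [set` i] (EFin \o (fun x => f x + g x)).
Proof. by move=> fi gi; apply: integrableD_EFin. Qed.

Lemma integrableB_itv i f g : mu.-integrable [set` i] (EFin \o f) ->
  mu.-integrable [set` i] (EFin \o g) ->
  mu.-integrable [set` i] (EFin \o (fun x => f x - g x)).
Proof. by move=> fi gi; apply: integrableB_EFin. Qed.

Lemma le_normr_Rintegral_itv i f g : mu.-integrable [set` i] (EFin \o f) ->
  mu.-integrable [set` i] (EFin \o g) ->
  (forall x, x \in i -> `|f x| <= g x) ->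
  `|\int[mu]_(x in [set` i]) f x| <= \int[mu]_(x in [set` i]) g x.
Proof.
move=> fi gi fg; apply: (le_trans (le_normr_Rintegral _ fi)) => //.
by apply: le_Rintegral => //; exact: integrable_norm.
Qed.

Lemma has_derive_Rintegral_itv i (f f' : R -> R -> R) (G : R -> R) (a u v : R) :
  u < a < v ->
  (forall x, u < x < v -> mu.-integrable [set` i] (EFin \o f x)) ->
  (forall x y : R, u < x < v -> y \in i -> has_derive (f ^~ y) x (f' x y)) ->
  (forall y, 0 <= G y) -> mu.-integrable [set` i] (EFin \o G) ->
  (forall x y : R, u < x < v -> y \in i -> `|f' x y| <= G y) ->
  has_derive (fun x => \int[mu]_(y in [set` i]) f x y) a (\int[mu]_(y in [set` i]) f' a y).
Proof.
move=> auv fi df G0 Gi f'G.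
have Ia : `]u, v[%classic a by rewrite /= in_itv.
have pE x y : `]u, v[%classic x -> [set` i] y -> partial1of2 f x y = f' x y.
  by move=> xuv yi; rewrite /partial1of2 derive1E; have [_ ->] := df x y xuv yi.
have df' x y : `]u, v[%classic x -> [set` i] y -> derivable (f ^~ y) x 1.
  by move=> xuv yi; have [] := df x y xuv yi.
have fG x y : `]u, v[%classic x -> [set` i] y -> `|partial1of2 f x y| <= G y.
  by move=> xuv yi; rewrite pE//; exact: f'G.
split.
  by apply: (@derivable_under_integral _ _ _ mu f _ _ a u v Ia fi df' G G0 Gi fG).
rewrite -derive1E (@differentiation_under_integral _ _ _ mu f _ _ a u v Ia fi df' G G0 Gi fG)//.
by apply: eq_Rintegral => y; rewrite inE => yi; rewrite pE.
Qed.

End interval_integrals.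

(** * Stirling's formula *)

Section wallis.
Context {R : realType}.
Notation mu := (@lebesgue_measure R).

Let W k : R := \int[mu]_(x in `[0, pi / 2]) (sin x ^+ k).
Let pi20 : 0 < pi / 2 :> R.
Proof. by rewrite divr_gt0// pi_gt0. Qed.

Let csin k x : {for x, continuous (fun x : R => sin x ^+ k)}.
Proof.
by apply: has_derive_continuous; repeat derive_step.
Qed.

Let isin k : mu.-integrable `[0, pi / 2] (EFin \o (fun x : R => sin x ^+ k)).
Proof. by apply: segment_integrable; apply: continuous_within => x; exact: csin. Qed.

(** The difference of the two integrands is the derivative of -cos x sin^(k+1) x, which vanishes at
    0 and at pi/2. *)
Let wallis_rec k : k.+2%:R * W k.+2 = k.+1%:R * W k.
Proof.
apply/eqP; rewrite -subr_eq0; apply/eqP.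
rewrite -!RintegralZl// -RintegralB//; last 2 first.
- by apply: segment_integrable; apply: continuous_within => x; apply: cvgM; [exact: cvg_cst|exact: csin].
- by apply: segment_integrable; apply: continuous_within => x; apply: cvgM; [exact: cvg_cst|exact: csin].
have dF (x : R) : 0 < x < pi / 2 -> has_derive (fun x : R => - cos x * sin x ^+ k.+1) x
    (k.+2%:R * sin x ^+ k.+2 - k.+1%:R * sin x ^+ k).
  move=> _; derive.
  rewrite !exprS; have := cos2Dsin2 x => /(canRL (addrK _)); rewrite expr2 => e.
  transitivity (sin x * (sin x * sin x ^+ k) - k.+1%:R * sin x ^+ k * (cos x * cos x)); first by ring.
  by rewrite e expr2 -[k.+2%:R]natr1; ring.
rewrite (Rintegral_segment_FTC pi20 _ _ dF).
- by rewrite cos_pihalf sin0 [0 ^+ _]exprS; ring.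
- apply: continuous_within => x; apply: cvgB; apply: cvgM; (exact: cvg_cst || exact: csin).
- apply: continuous_within => x; apply: cvgM; last exact: csin.
  by apply: cvgN; exact: continuous_cos.
Qed.

Let W0 : W 0 = pi / 2.
Proof.
have dF (x : R) : 0 < x < pi / 2 -> has_derive id x (sin x ^+ 0).
  by move=> _; rewrite expr0; exact: has_derive_id.
rewrite /W (Rintegral_segment_FTC pi20 _ _ dF); first by rewrite subr0.
- by apply: continuous_within => x; exact: csin.
- by apply: continuous_within => x; exact: cvg_id.
Qed.

Let W1 : W 1 = 1.
Proof.
have dF (x : R) : 0 < x < pi / 2 -> has_derive (fun x : R => - cos x) x (sin x ^+ 1).
  by move=> _; derive; ring.
rewrite /W (Rintegral_segment_FTC pi20 _ _ dF).
- by rewrite cos_pihalf cos0 oppr0 opprK add0r.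
- by apply: continuous_within => x; exact: csin.
- by apply: continuous_within => x; apply: cvgN; exact: continuous_cos.
Qed.

Let W_decr k : W k.+1 <= W k.
Proof.
apply: le_Rintegral => // x; rewrite /= in_itv/= => /andP[x0 xpi].
rewrite exprS ler_piMl ?exprn_ge0 ?sin_le1//.
  by apply: sin_ge0_pi; rewrite x0 (le_trans xpi)// ler_pdivrMr// ler_peMr ?pi_ge0// ler1n.
Qed.

(** The reciprocal of binom(2n, n) / 4^n, a form of the Wallis product; both parities of [W] become
    explicit through it. *)
Let p n : R := 4 ^+ n * n`!%:R ^+ 2 / (n.*2)`!%:R.

Let fact_neq0 n : n`!%:R != 0 :> R.
Proof. by rewrite pnatr_eq0 -lt0n fact_gt0. Qed.

Let pS n : p n.+1 = p n * (n.*2.+2%:R / n.*2.+1%:R).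
Proof.
rewrite /p doubleS !factS !natrM [4 ^+ _.+1]exprS.
have -> : n.*2.+2%:R = 2 * n.+1%:R :> R by rewrite -doubleS -mul2n natrM.
have := fact_neq0 n.*2; have : n.*2.+1%:R != 0 :> R by rewrite pnatr_eq0.
have : n.+1%:R != 0 :> R by rewrite pnatr_eq0.
move: (n.+1%:R : R) (n.*2.+1%:R : R) ((n.*2)`!%:R : R) (n`!%:R : R) => a b c d a0 b0 c0.
by field; rewrite a0 b0 c0.
Qed.

Let p_gt0 n : 0 < p n.
Proof. by rewrite /p divr_gt0 ?mulr_gt0 ?exprn_gt0// ?ltr0n ?fact_gt0. Qed.

Let W_even n : W n.*2 = pi / 2 / p n.
Proof.
elim: n => [|n IH]; first by rewrite W0 /p expr0 fact0 mul1r divr1 expr1n divr1.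
have := wallis_rec n.*2; rewrite IH -doubleS => /(canRL (mulKf _)) ->; last by rewrite pnatr_eq0.
rewrite pS doubleS; have := lt0r_neq0 (p_gt0 n).
have : n.*2.+1%:R != 0 :> R by rewrite pnatr_eq0.
have : n.*2.+2%:R != 0 :> R by rewrite pnatr_eq0.
move: (n.*2.+2%:R : R) (n.*2.+1%:R : R) (p n) (pi : R) => a b c d a0 b0 c0.
by field; rewrite a0 b0 c0.
Qed.

Let W_odd n : W n.*2.+1 = p n / n.*2.+1%:R.
Proof.
elim: n => [|n IH]; first by rewrite W1 /p expr0 fact0 mul1r expr1n !divr1.
have := wallis_rec n.*2.+1; rewrite IH -doubleS => /(canRL (mulKf _)) ->; last by rewrite pnatr_eq0.
rewrite pS doubleS; have : n.*2.+1%:R != 0 :> R by rewrite pnatr_eq0.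
have : n.*2.+3%:R != 0 :> R by rewrite pnatr_eq0.
move: (n.*2.+2%:R : R) (n.*2.+1%:R : R) (n.*2.+3%:R : R) (p n) => a b c d c0 b0.
by field; rewrite c0 b0.
Qed.

(** Monotonicity of [W] gives W(2n+2) <= W(2n+1) <= W(2n). The left inequality reads pi (2n+1)^2 <=
    4 (n+1) p^2 and suffices because (2n+1)^2 >= 4 n (n+1); the right one reads p^2 <= pi (2n+1) /
    2. *)
Lemma wallis_bounds n : (0 < n)%N ->
  @pi R <= (4 ^+ n * n`!%:R ^+ 2 / (n.*2)`!%:R) ^+ 2 / n%:R <=
    @pi R * (1 + (2 * n%:R)^-1).
Proof.
move=> n0; rewrite -/(p n).
have nR : 0 < n%:R :> R by rewrite ltr0n.
have n1 : n.*2.+1%:R = 2 * n%:R + 1 :> R by rewrite -natr1 -mul2n natrM.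
have := W_decr n.*2; have := W_decr n.*2.+1.
rewrite -doubleS !W_even W_odd pS -[n.*2.+2%:R]natr1 n1.
have := p_gt0 n; move: (p n) => q q0; have := @pi_gt0 R; move: pi => P P0.
have q2 : 0 < q ^+ 2 by rewrite exprn_gt0.
move=> h1 h2; apply/andP; split.
  rewrite ler_pdivlMr//.
  have {}h1 : P * (2 * n%:R + 1) ^+ 2 <= q ^+ 2 * (2 * (2 * n%:R + 2)).
    move: h1; rewrite -[X in X <= _ -> _](_ : P * (2 * n%:R + 1) / (q * (2 * (2 * n%:R + 1 + 1))) = _); last first.
      by field; rewrite !gt_eqF//; lra.
    rewrite ler_pdivrMr; last by rewrite mulr_gt0//; lra.
    rewrite mulrAC ler_pdivlMr; last by lra.
    by move=> h; nra.
  rewrite -(@ler_pM2r _ (2 * (2 * n%:R + 2))); last by lra.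
  apply: le_trans h1; rewrite -mulrA ler_pM2l//; nra.
have {}h2 : q ^+ 2 <= P / 2 * (2 * n%:R + 1).
  move: h2; rewrite ler_pdivlMr// mulrAC ler_pdivrMr; last by lra.
  by rewrite expr2.
rewrite ler_pdivrMr//; apply: (le_trans h2); rewrite le_eqVlt; apply/orP; left; apply/eqP.
by field; rewrite gt_eqF.
Qed.

End wallis.

(** * From Wallis's bounds to Stirling's formula with an error of order 1/n *)

Section stirling.
Context {R : realType}.
Implicit Types (x y t L : R).

(** The differences vanish at 0 and have the derivatives t^2 / ((1+t) (2+t)^2) and t^3 / (1+t). The
    lower bound is the one that gives (n + 1/2) ln(1 + 1/n) >= 1 without loss. *)
Lemma ln1p_bounds (x : R) : 0 <= x ->
  2 * x / (2 + x) <= ln (1 + x) <= x - x ^+ 2 / 2 + x ^+ 3 / 3.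
Proof.
have mono (f f' : R -> R) (y : R) : (forall t, 0 <= t -> has_derive f t (f' t)) ->
    (forall t, 0 <= t -> 0 <= f' t) -> 0 <= y -> f 0 <= f y.
  move=> df f'0 y0; apply: (has_derive_ge0_le y0 (f' := f')) => t /andP[t0 _].
    exact: df.
  exact: f'0.
move=> x0; apply/andP; split.
  have := mono (fun t => ln (1 + t) - 2 * t / (2 + t)) (fun t => t ^+ 2 / ((1 + t) * (2 + t) ^+ 2)) x.
  rewrite addr0 ln1 mulr0 mul0r subrr subr_ge0; apply => //.
    move=> t t0; have t1 : 0 < 1 + t by lra.
    have t2 : 0 < 2 + t by lra.
    by derive; field; rewrite !gt_eqF.
  by move=> t t0; rewrite divr_ge0 ?sqr_ge0// mulr_ge0 ?sqr_ge0//; lra.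
have := mono (fun t => t - t ^+ 2 / 2 + t ^+ 3 / 3 - ln (1 + t)) (fun t => t ^+ 3 / (1 + t)) x.
rewrite addr0 ln1 (_ : 0 - 0 ^+ 2 / 2 + 0 ^+ 3 / 3 - 0 = 0); last by ring.
move=> H; rewrite -subr_ge0; apply: H; last exact: x0.
  move=> t t0; have t1 : 0 < 1 + t by lra.
  by derive; field; rewrite !gt_eqF.
by move=> t t0; rewrite divr_ge0 ?exprn_ge0//; lra.
Qed.

(** The logarithm of n! e^n / n^(n+1/2); its limit L turns out to satisfy exp L = sqrt(2 pi). *)
Let a n : R := ln n`!%:R - (n%:R + 2^-1) * ln n%:R + n%:R.

(** The upper bound telescopes, so that summation yields not only convergence but the rate
    1/(2n). *)
Let a_step n : (0 < n)%N -> 0 <= a n - a n.+1 <= (2 * n%:R)^-1 - (2 * n.+1%:R)^-1.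
Proof.
move=> n0; have n1 : 1 <= n%:R :> R by rewrite ler1n.
have nR : 0 < n%:R :> R by lra.
have f0 : 0 < n`!%:R :> R by rewrite ltr0n fact_gt0.
have -> : a n - a n.+1 = (n%:R + 2^-1) * ln (1 + n%:R^-1) - 1.
  rewrite /a factS natrM lnM ?posrE ?ltr0n ?fact_gt0//.
  have -> : 1 + n%:R^-1 = n.+1%:R / n%:R :> R by rewrite -[n.+1%:R]natr1; field; rewrite gt_eqF.
  by rewrite ln_div ?posrE ?ltr0n// -[n.+1%:R]natr1; ring.
have /ln1p_bounds/andP[l1 l2] : 0 <= n%:R^-1 :> R by rewrite invr_ge0 ltW.
apply/andP; split.
  rewrite subr_ge0; apply: le_trans (ler_wpM2l _ l1); last by lra.
  by rewrite le_eqVlt; apply/orP; left; apply/eqP; field; rewrite !gt_eqF//; lra.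
rewrite lerBlDr; apply: (le_trans (ler_wpM2l _ l2)); first by lra.
rewrite -[n.+1%:R]natr1; move: (n%:R : R) n1 nR => N n1 nR {l1 l2 n0 f0}.
rewrite -subr_ge0.
have -> : (2 * N)^-1 - (2 * (N + 1))^-1 + 1 - (N + 2^-1) * (N^-1 - N^-1 ^+ 2 / 2 + N^-1 ^+ 3 / 3)
    = (5 * N ^+ 2 - 3 * N - 2) / (12 * N ^+ 3 * (N + 1)).
  by field; rewrite !gt_eqF//; lra.
rewrite divr_ge0//; first by nra.
by rewrite mulr_ge0 ?mulr_ge0 ?exprn_ge0//; lra.
Qed.

Let a_le n m : (0 < n <= m)%N -> a m <= a n <= a m + (2 * n%:R)^-1 - (2 * m%:R)^-1.
Proof.
move=> /andP[n0]; elim: m => [|m IH]; first by rewrite leqn0 => /eqP n00; rewrite n00 in n0.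
rewrite leq_eqVlt => /predU1P[<-|]; first by rewrite lexx/= addrK.
rewrite ltnS => nm; have /andP[h1 h2] := a_step (leq_trans n0 nm).
have /andP[h3 h4] := IH nm; move: h1 h2 h3 h4.
move: (a m) (a n) (a m.+1) (2 * n%:R)^-1 (2 * m%:R)^-1 (2 * m.+1%:R)^-1 => *.
by apply/andP; split; lra.
Qed.

Let a_lim : exists L, a n @[n --> \oo] --> L /\
  forall n, (0 < n)%N -> L <= a n <= L + (2 * n%:R)^-1.
Proof.
pose L := limn (fun n => a n.+1).
have cL : cvgn (fun n => a n.+1).
  apply: nonincreasing_is_cvgn.
    by apply/nonincreasing_seqP => n; have /andP[] := @a_le n.+1 n.+2 (leqnSn _).
  exists (a 1 - 2^-1) => _ [n _ <-].
  have /andP[_] := @a_le 1%N n.+1 isT; rewrite mulr1.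
  have : 0 <= (2 * n.+1%:R)^-1 :> R by rewrite invr_ge0.
  by move: (2 * n.+1%:R)^-1 (a n.+1) (a 1%N) => *; lra.
have aL : a n @[n --> \oo] --> L by rewrite -cvg_shiftS.
exists L; split=> // n n0; apply/andP; split.
  apply: (limr_le cL); near=> m.
  have /a_le/andP[] // : (0 < n <= m.+1)%N.
  by rewrite n0/= ltnW// ltnS; near: m; exact: nbhs_infty_ge.
rewrite -lerBlDr; apply: (limr_ge cL); near=> m.
have /andP[_] : a m.+1 <= a n <= a m.+1 + (2 * n%:R)^-1 - (2 * m.+1%:R)^-1.
  by apply: a_le; rewrite n0/= ltnW// ltnS; near: m; exact: nbhs_infty_ge.
have : 0 <= (2 * m.+1%:R)^-1 :> R by rewrite invr_ge0.
by move: (2 * m.+1%:R)^-1 (2 * n%:R)^-1 (a n) (a m.+1) => *; lra.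
Unshelve. all: by end_near. Qed.

(** In the combination 2 a(n) - a(2n) the factors n^n and e^n cancel and the Wallis quotient
    remains. As the combination tends to 2L - L = L, the bounds on that quotient determine L. *)
Let a_wallis n : (0 < n)%N ->
  expR (2 * (2 * a n - a n.*2)) / 2 = (4 ^+ n * n`!%:R ^+ 2 / (n.*2)`!%:R) ^+ 2 / n%:R.
Proof.
move=> n0; have nR : 0 < n%:R :> R by rewrite ltr0n.
have f1 : 0 < n`!%:R :> R by rewrite ltr0n fact_gt0.
have f2 : 0 < (n.*2)`!%:R :> R by rewrite ltr0n fact_gt0.
apply: ln_inj; rewrite ?posrE.
- by rewrite divr_gt0 ?expR_gt0.
- by rewrite divr_gt0// exprn_gt0// divr_gt0// mulr_gt0// exprn_gt0.
rewrite ln_div ?posrE ?expR_gt0// expRK.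
have q0 : 0 < 4 ^+ n * n`!%:R ^+ 2 :> R by rewrite mulr_gt0 ?exprn_gt0.
have q1 : 0 < 4 ^+ n * n`!%:R ^+ 2 / (n.*2)`!%:R :> R by rewrite divr_gt0.
rewrite ln_div ?posrE ?exprn_gt0// lnXn// ln_div ?posrE//.
rewrite lnM ?posrE ?exprn_gt0// !lnXn// /a.
have -> : n.*2%:R = 2 * n%:R :> R by rewrite -mul2n natrM.
rewrite lnM ?posrE//.
have -> : 4 = 2 * 2 :> R by ring.
rewrite lnM ?posrE// -[(ln 2 + ln 2) *+ n]mulr_natr !mulr2n.
by field.
Qed.

Lemma stirling : exists2 C : R, 0 < C & forall n, (0 < n)%N ->
  exists2 s : R, `|s - 1| <= C / n%:R &
    n`!%:R / n%:R ^+ n.+1 = expR (- n%:R) * Num.sqrt (2 * pi / n%:R) * s.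
Proof.
have [L [aL aLn]] := a_lim.
have piL : expR (2 * L) / 2 = pi.
  have dbl : n.*2 @[n --> \oo] --> \oo.
    apply/cvgnyPge => A; near=> n; rewrite -addnn; apply: leq_trans (leq_addr _ _).
    by near: n; exact: nbhs_infty_ge.
  have c1 : expR (2 * (2 * a n - a n.*2)) / 2 @[n --> \oo] --> expR (2 * L) / 2.
    apply: cvgM; last exact: cvg_cst.
    apply: (@cvg_comp _ _ _ (fun n => 2 * (2 * a n - a n.*2)) expR _ _ _ _ (@continuous_expR R _)).
    apply: cvgM; first exact: cvg_cst.
    have -> : L = 2 * L - L by ring.
    apply: cvgB; first by apply: cvgM; [exact: cvg_cst|exact: aL].
    exact: (cvg_comp _ _ dbl aL).
  have c2 : expR (2 * (2 * a n - a n.*2)) / 2 @[n --> \oo] --> (pi : R).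
    apply: (@squeeze_cvgr _ _ _ _ (cst pi) (fun n => pi * (1 + (2 * n%:R)^-1))).
    - near=> n; have n0 : (0 < n)%N by near: n; exact: nbhs_infty_gt.
      by rewrite a_wallis//; exact: wallis_bounds.
    - exact: cvg_cst.
    - rewrite -[X in _ --> X]mulr1; apply: cvgM; first exact: cvg_cst.
      rewrite -[X in _ --> X]addr0; apply: cvgD; first exact: cvg_cst.
      apply/gtr0_cvgV0; first by near=> n; rewrite mulr_gt0// ltr0n; near: n; exact: nbhs_infty_gt.
      apply/cvgryPge => A; near=> n; apply: (@le_trans _ _ n%:R); last by rewrite ler_peMl// ler1n.
      by near: n; exact: nbhs_infty_ger.
  exact: (cvg_unique _ c1 c2).
have eL : expR L = Num.sqrt (2 * pi).
  rewrite -piL mulrCA divff ?mulr1// mulr_natl mulr2n expRD -expr2 sqrtr_sqr ger0_norm// expR_ge0.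
(* By the mean value theorem exp(a n - L) - 1 = e^c (a n - L), with c <= 1/(2n) <= 1/2. *)
exists (expR 2^-1) => [|n n0]; first exact: expR_gt0.
have nR : 0 < n%:R :> R by rewrite ltr0n.
have f1 : 0 < n`!%:R :> R by rewrite ltr0n fact_gt0.
exists (expR (a n - L)).
  have /andP[l1 l2] := aLn _ n0.
  have e1 : 1 <= expR (a n - L) by rewrite -expR0 ler_expR; lra.
  rewrite ger0_norm ?subr_ge0//.
  have [c c0 E] : exists2 c, 0 <= c <= a n - L & expR (a n - L) - 1 = expR c * (a n - L).
    have d x : 0 <= x <= a n - L -> has_derive expR x (expR x) by move=> _; exact: is_derive_expR.
    have aL0 : 0 <= a n - L by lra.
    have [c c0] := has_derive_MVT aL0 d.
    by rewrite expR0 subr0 => E; exists c.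
  rewrite E; apply: ler_pM; rewrite ?expR_ge0//; first by lra.
    rewrite ler_expR; move: c0 => /andP[_ c0]; apply: (le_trans c0).
    have : (2 * n%:R)^-1 <= 2^-1 :> R by rewrite lef_pV2 ?posrE// ?mulr_gt0// ler_peMr// ler1n.
    lra.
  have : (2 * n%:R)^-1 <= n%:R^-1 :> R by rewrite lef_pV2 ?posrE// ?mulr_gt0// ler_peMl// ler1n.
  lra.
rewrite sqrtrM ?mulr_ge0 ?pi_ge0// -eL.
have -> : Num.sqrt (n%:R^-1) = expR (- 2^-1 * ln n%:R) :> R.
  have -> : n%:R^-1 = expR (- 2^-1 * ln n%:R) ^+ 2 :> R.
    rewrite -expRM_natl -[LHS]lnK ?posrE ?invr_gt0// lnV ?posrE//; congr expR; by field.
  by rewrite sqrtr_sqr ger0_norm ?expR_ge0.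
rewrite -!expRD -[LHS]lnK ?posrE ?divr_gt0 ?exprn_gt0//.
rewrite ln_div ?posrE ?exprn_gt0// lnXn// /a -[ln n%:R *+ _]mulr_natr -[n.+1%:R]natr1.
by congr expR; field.
Unshelve. all: by end_near. Qed.

End stirling.

(** * Pollard's integral for the stable density *)

Section powers.
Context {R : realType}.
Notation mu := (@lebesgue_measure R).
Implicit Types (x y u p e a : R).

(** The threshold K = e^(1/(a-1)) solves K^(a-1) = e: below it u^a <= K^a, above it u^(a-1) <= e. *)
Lemma powR_le_linear a e : 0 < a -> a < 1 -> 0 < e ->
  exists2 C : R, 0 <= C & forall u, 0 <= u -> u `^ a <= C + e * u.
Proof.
move=> a0 a1 e0; pose K := e `^ (a - 1)^-1.
have K0 : 0 < K by rewrite powR_gt0.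
exists (K `^ a) => [|u u0]; first exact: powR_ge0.
have [uK|Ku] := leP u K.
  by rewrite -[leLHS]addr0 lerD ?mulr_ge0 ?(ltW e0)// ge0_ler_powR ?(ltW a0)// nnegrE ltW.
rewrite -[leLHS]add0r lerD ?powR_ge0// -[X in _ * X](powRr1 u0).
have u1 : 0 < u by rewrite (lt_trans K0).
have -> : u `^ a = u `^ (a - 1) * u `^ 1.
  by rewrite -powRD ?subrK// gt_eqF ?implybT.
rewrite ler_wpM2r ?powR_ge0//.
have -> : e = K `^ (a - 1).
  by rewrite -powRrM mulVf ?powRr1 ?ltW// subr_eq0 lt_eqF.
have E x : x `^ (a - 1) = (x `^ (1 - a))^-1 by rewrite -powRN opprB.
rewrite !E lef_pV2 ?posrE ?powR_gt0//.
by rewrite ge0_ler_powR ?nnegrE ?ltW// subr_gt0.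
Qed.

Lemma powR_le_expR p e : 0 <= p -> 0 < e ->
  exists2 C : R, 0 < C & forall u, 0 <= u -> u `^ p <= C * expR (e * u).
Proof.
move=> p0 e0; have [->|pn0] := eqVneq p 0.
  exists 1 => // u u0; rewrite powRr0 mul1r -expR0 ler_expR; exact: mulr_ge0 (ltW e0) u0.
have {p0 pn0}p0 : 0 < p by rewrite lt0r pn0.
(* This is (p/e)^p; the claim becomes p ln(e u / p) <= e u, an instance of ln x <= x. *)
exists (expR (p * ln (p / e))) => [|u]; first exact: expR_gt0.
rewrite le_eqVlt => /predU1P[<-|u0].
  by rewrite powR0 ?gt_eqF// mulr_ge0 ?expR_ge0.
rewrite /powR gt_eqF// -expRD ler_expR -lerBlDl -mulrBr.
rewrite -ln_div ?posrE ?divr_gt0// (@le_trans _ _ (p * (e * u / p)))//.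
  rewrite ler_pM2l// (_ : u / (p / e) = e * u / p); last by field; rewrite !gt_eqF.
  have q0 : 0 < e * u / p by rewrite divr_gt0// mulr_gt0.
  exact: ltW (ln_sublinear q0).
by rewrite mulrCA divff ?mulr1// gt_eqF.
Qed.

Lemma powR_continuous_ge0 p : 0 < p -> {within `[0, +oo[, continuous (fun x => x `^ p)}.
Proof.
move=> p0; apply/continuous_within_itvcyP; split.
  move=> x; rewrite in_itv/= andbT => x0.
  by apply: has_derive_continuous; repeat derive_step.
by rewrite powR0 ?gt_eqF//; exact: powR_cvg0.
Qed.

(** Each of the two growing factors is allowed a quarter of the rate e, which suffices for the
    stretched exponential because a < 1; the rate e/2 remains. *)
Lemma powR_exp_integrable p a e : 0 <= p -> 0 < a -> a < 1 -> 0 < e ->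
  mu.-integrable `](0 : R), +oo[ (EFin \o (fun u => u `^ p * expR (u `^ a) * expR (- e * u))).
Proof.
move=> p0 a0 a1 e0.
have e4 : 0 < e / 4 by rewrite divr_gt0.
have [C C0 HC] := powR_le_expR p0 e4.
have [D D0 HD] := powR_le_linear a0 a1 e4.
apply: (@le_integrable_EFin _ _ _ mu _ _ (fun u => C * expR D * (u ^+ 0 * expR (- (e / 2) * u)))) => //.
- apply: continuous_measurable_fun0y => x x0.
  by apply: has_derive_continuous; repeat derive_step.
- move=> u /=; rewrite in_itv/= andbT => u0.
  rewrite ger0_norm ?mulr_ge0 ?powR_ge0 ?expR_ge0// expr0 mul1r.
  have := HC u (ltW u0); have := HD u (ltW u0) => h1 h2.
  apply: (@le_trans _ _ (C * expR (e / 4 * u) * expR (D + e / 4 * u) * expR (- e * u))).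
    by rewrite ler_wpM2r ?expR_ge0// ler_pM ?powR_ge0 ?expR_ge0// ler_expR.
  rewrite -!mulrA ler_pM2l// -!expRD ler_expR le_eqVlt; apply/orP; left; apply/eqP.
  by field.
- have e2 : 0 < e / 2 by rewrite divr_gt0.
  have [H _] := Rintegral_exprn_expR 0 e2.
  exact: integrableZl_itv.
Qed.

Lemma powR_exp_integrable0 p e : 0 <= p -> 0 < e ->
  mu.-integrable `](0 : R), +oo[ (EFin \o (fun u => u `^ p * expR (- e * u))).
Proof.
move=> p0 e0; have h2 : 0 < 2^-1 :> R by [].
have h1 : 2^-1 < 1 :> R by lra.
apply: le_integrable_EFin (powR_exp_integrable p0 h2 h1 e0) => //.
- apply: continuous_measurable_fun0y => x x0.
  by apply: has_derive_continuous; repeat derive_step.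
- move=> u _; rewrite ger0_norm ?mulr_ge0 ?powR_ge0 ?expR_ge0// ler_wpM2r ?expR_ge0//.
  by rewrite ler_peMr ?powR_ge0// -expR0 ler_expR powR_ge0.
Qed.

Lemma Gamma_scale p y : 0 < p -> 0 < y ->
  \int[mu]_(u in `]0, +oo[) (u `^ p * expR (- y * u)) = Gamma (p + 1) / y `^ (p + 1).
Proof.
move=> p0 y0; have y1 : 0 < y `^ p by rewrite powR_gt0.
have cg : {within `[0, +oo[, continuous (fun x => x `^ p * expR (- x))}.
  move=> x; apply: cvgM; first exact: powR_continuous_ge0.
  apply: continuous_within => {}x; by apply: has_derive_continuous; repeat derive_step.
have g0 x : 0 <= x -> 0 <= x `^ p * expR (- x) by move=> _; rewrite mulr_ge0 ?powR_ge0 ?expR_ge0.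
have gi : mu.-integrable `](0 : R), +oo[ (EFin \o (fun x => x `^ p * expR (- x))).
  apply: eq_integrable (powR_exp_integrable0 (ltW p0) ltr01) => //.
  by move=> x _; rewrite /= mulN1r.
have [si sE] := Rintegral0y_scale y0 cg g0 gi.
transitivity (y `^ (- p) * \int[mu]_(u in `]0, +oo[) ((y * u) `^ p * expR (- (y * u)))).
  rewrite -RintegralZl//; apply: eq_Rintegral => u; rewrite inE/= in_itv/= andbT => u0.
  rewrite powRM ?ltW// -mulNr powRN mulrA mulrA mulVf ?mul1r// gt_eqF//.
rewrite sE /Gamma mulrA mulrC addrK; congr (_ * _).
by rewrite powRN -invfM powRD ?powRr1 ?(ltW y0)// (gt_eqF y0) implybT.
Qed.

End powers.

(** * Taylor bounds for a rotated exponential *)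

Section phase_taylor.
Context {R : realType} (th : R).
Implicit Types (x y psi : R).

(** The imaginary part of exp(i psi - x e^(i th)), and below it that of e^(i psi) times the Taylor
    polynomial of degree less than N. Differentiation in x multiplies by -e^(i th), which shifts psi
    by th up to sign, so the complex exponential can be treated through real functions. *)
Definition phase psi x := expR (- x * cos th) * sin (psi - x * sin th).

Definition phase_poly N psi x :=
  \sum_(j < N) ((-1) ^+ j / j`!%:R * x ^+ j * sin (psi + j%:R * th)).

Lemma phase_derive psi x : has_derive (phase psi) x (- phase (psi + th) x).
Proof.
rewrite /phase; derive.
have -> : psi + th - x * sin th = (psi - x * sin th) + th by ring.
by rewrite [sin (_ + th)]sinD; ring.
Qed.

Lemma phase_poly_derive N psi x :
  has_derive (phase_poly N.+1 psi) x (- phase_poly N (psi + th) x).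
Proof.
have E (M : nat) phi : phase_poly M.+1 phi =
    fun x => phase_poly M phi x + (-1) ^+ M / M`!%:R * x ^+ M * sin (phi + M%:R * th).
  by apply/funext => y; rewrite /phase_poly big_ord_recr.
elim: N => [|N IH].
  have -> : phase_poly 1 psi = fun=> sin psi.
    apply/funext => y; rewrite /phase_poly big_ord1.
    by rewrite !expr0 fact0 invr1 !mul1r mul0r addr0.
  by rewrite /phase_poly big_ord0 oppr0; exact: has_derive_const.
rewrite (E N.+1).
apply: has_derive_eq; first by apply: has_derive_add; [exact: IH|repeat derive_step].
rewrite /= (E N) opprD; congr (_ + _).
have -> : psi + th + N%:R * th = psi + N.+1%:R * th by rewrite -[N.+1%:R]natr1; ring.
rewrite factS natrM [(-1) ^+ N.+1]exprS; set s := sin _.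
have f0 : N`!%:R != 0 :> R by rewrite pnatr_eq0 -lt0n fact_gt0.
have N0 : N.+1%:R != 0 :> R by rewrite pnatr_eq0.
move: (N.+1%:R : R) (N`!%:R : R) N0 f0 => b c b0 c0.
by field; rewrite b0 c0.
Qed.

(** Induction on N for all psi at once, since differentiation lowers N and shifts psi. The factor
    e^x lets the bound reproduce itself: the derivative of x^(N+1)/(N+1)! e^x is at least x^N/N!
    e^x. *)
Lemma phase_taylor N psi x : 0 <= x ->
  `|phase psi x - phase_poly N psi x| <= x ^+ N / N`!%:R * expR x.
Proof.
elim: N psi x => [|N IH] psi x x0.
  rewrite /phase_poly big_ord0 subr0 expr0 fact0 invr1 !mul1r normrM.
  rewrite ger0_norm ?expR_ge0// -[leRHS]mulr1 ler_pM ?expR_ge0//.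
    rewrite ler_expR mulNr -mulrN ler_piMr// lerNl cos_geN1//.
  by rewrite ler_norml sin_geN1 sin_le1.
have dP y := phase_poly_derive N psi y.
have dph y := phase_derive psi y.
have f0 : N`!%:R != 0 :> R by rewrite pnatr_eq0 -lt0n fact_gt0.
have N0 : N.+1%:R != 0 :> R by rewrite pnatr_eq0.
have dE y : has_derive (fun y => y ^+ N.+1 / N.+1`!%:R * expR y) y
    (y ^+ N / N`!%:R * expR y + y ^+ N.+1 / N.+1`!%:R * expR y).
  derive; rewrite factS natrM.
  move: (N.+1%:R : R) (N`!%:R : R) N0 f0 => b c b0 c0.
  by field; rewrite b0 c0.
have p0 : phase psi 0 - phase_poly N.+1 psi 0 = 0.
  rewrite /phase /phase_poly big_ord_recl big1 => [|i _].
    by rewrite /= oppr0 !mul0r expR0 subr0 !expr0 fact0 invr1 !mul1r !addr0 subrr.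
  by rewrite /= /bump/= add1n [0 ^+ _]exprS mul0r mulr0 mul0r.
have E0 y : 0 <= y -> 0 <= y ^+ N.+1 / N.+1`!%:R * expR y.
  by move=> y0; rewrite mulr_ge0 ?expR_ge0// divr_ge0 ?exprn_ge0.
have z0 : (0 : R) ^+ N.+1 / N.+1`!%:R * expR 0 = 0 by rewrite exprS !mul0r.
rewrite ler_norml; apply/andP; split.
- rewrite -subr_ge0 opprK.
  have := @has_derive_ge0_le _ (fun y => phase psi y - phase_poly N.+1 psi y
    + y ^+ N.+1 / N.+1`!%:R * expR y) (fun y => - phase (psi + th) y - - phase_poly N (psi + th) y
    + (y ^+ N / N`!%:R * expR y + y ^+ N.+1 / N.+1`!%:R * expR y)) _ _ x0.
  rewrite p0 z0 addr0; apply => y /andP[y0 _].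
    have := dP y; have := dph y; have := dE y => d1 d2 d3.
    exact: has_derive_add (has_derive_add d2 (has_derive_opp d3)) d1.
  have := IH (psi + th) _ y0; have := E0 _ y0; rewrite ler_norml.
  move: (phase _ _) (phase_poly _ _ _) (_ ^+ N / _ * _) (_ ^+ N.+1 / _ * _) => a b c d d0 /andP[h1 h2].
  lra.
- rewrite -subr_ge0.
  have := @has_derive_ge0_le _ (fun y => y ^+ N.+1 / N.+1`!%:R * expR y -
    (phase psi y - phase_poly N.+1 psi y)) (fun y =>
    (y ^+ N / N`!%:R * expR y + y ^+ N.+1 / N.+1`!%:R * expR y) -
     (- phase (psi + th) y - - phase_poly N (psi + th) y)) _ _ x0.
  rewrite p0 z0 subr0; apply => y /andP[y0 _].
    have := dP y; have := dph y; have := dE y => d1 d2 d3.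
    exact: has_derive_add d1 (has_derive_opp (has_derive_add d2 (has_derive_opp d3))).
  have := IH (psi + th) _ y0; have := E0 _ y0; rewrite ler_norml.
  move: (phase _ _) (phase_poly _ _ _) (_ ^+ N / _ * _) (_ ^+ N.+1 / _ * _) => a b c d d0 /andP[h1 h2].
  lra.
Qed.

End phase_taylor.

(** * Summation of the series to an integral, and the tail of the density *)

Section pollard.
Context {R : realType} (alpha : R).
Context (alpha_gt0 : 0 < alpha) (alpha_lt1 : alpha < 1).
Notation mu := (@lebesgue_measure R).
Implicit Types (x y u : R).
Local Notation f := (stable_density alpha).

(** The imaginary part of -exp(-e^(i pi alpha) u^alpha); with this sign its expansion starts with +
    sin(pi alpha) u^alpha. *)
Definition pollard_kernel u := - phase (pi * alpha) 0 (u `^ alpha).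

Let S N u := - phase_poly (pi * alpha) N 0 (u `^ alpha).
Let c j : R := (-1) ^+ j.+1 / j`!%:R * sin (pi * alpha * j%:R).

Let SE N u : S N u = \sum_(1 <= j < N) (c j * u `^ (alpha * j%:R)).
Proof.
have tE j : - ((-1) ^+ j / j`!%:R * (u `^ alpha) ^+ j * sin (0 + j%:R * (pi * alpha))) =
    c j * u `^ (alpha * j%:R).
  rewrite /c powRrM powR_mulrn ?powR_ge0// add0r exprS [j%:R * _]mulrC.
  by rewrite !mulN1r; ring.
rewrite /S /phase_poly -sumrN.
under eq_bigr => j _ do rewrite tE.
rewrite -(big_mkord xpredT (fun j => c j * u `^ (alpha * j%:R))).
(* The term j = 0 contains sin 0, so the Taylor polynomial has the same index range as the
   series. *)
case: N => [|N]; first by rewrite !big_geq.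
by rewrite big_ltn// /c mulr0 sin0 mulr0 mul0r add0r.
Qed.

Let pollard_kernel_approx N u :
  `|pollard_kernel u - S N u| <= (u `^ alpha) ^+ N / N`!%:R * expR (u `^ alpha).
Proof.
rewrite /pollard_kernel /S opprK addrC -normrN opprD opprK addrC.
by rewrite phase_taylor ?powR_ge0.
Qed.

Lemma pollard_kernel_le u : `|pollard_kernel u| <= expR (u `^ alpha).
Proof.
have := pollard_kernel_approx 0 u.
by rewrite SE big_geq// subr0 expr0 fact0 invr1 !mul1r.
Qed.

Lemma pollard_kernel_sub_le u :
  `|pollard_kernel u - sin (pi * alpha) * u `^ alpha| <= u `^ (alpha * 2) * expR (u `^ alpha).
Proof.
have := pollard_kernel_approx 2 u.
rewrite SE big_nat1 /c !mulr1 [(-1) ^+ 2]expr2 mulN1r opprK (_ : 1`! = 1%N)// (_ : 2`! = 2%N)//.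
rewrite invr1 !mul1r => /le_trans; apply.
rewrite ler_wpM2r ?expR_ge0// powRrM powR_mulrn ?powR_ge0// -[leRHS]mulr1 ler_wpM2l ?exprn_ge0 ?powR_ge0//.
by rewrite invf_le1//; lra.
Qed.

Lemma pollard_integrable y : 0 < y ->
  mu.-integrable `](0 : R), +oo[ (EFin \o (fun u => expR (- y * u) * pollard_kernel u)).
Proof.
move=> y0; have H := powR_exp_integrable (lexx 0) alpha_gt0 alpha_lt1 y0.
apply: le_integrable_EFin H => //.
  apply: continuous_measurable_fun0y => x x0; apply: has_derive_continuous.
  by rewrite /pollard_kernel /phase; repeat derive_step.
move=> u _; rewrite powRr0 mul1r normrM ger0_norm ?expR_ge0// mulrC.
by rewrite ler_wpM2r ?expR_ge0// pollard_kernel_le.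
Qed.

Let S_integrable y N : 0 < y ->
  mu.-integrable `](0 : R), +oo[ (EFin \o (fun u => expR (- y * u) * S N u)) /\
  \int[mu]_(u in `]0, +oo[) (expR (- y * u) * S N u) =
  \sum_(1 <= j < N) (c j * (Gamma (alpha * j%:R + 1) / y `^ (alpha * j%:R + 1))).
Proof.
move=> y0; elim: N => [|N [IH1 IH2]].
  have E : (fun u => expR (- y * u) * S 0 u) = cst 0.
    by apply/funext => u; rewrite SE big_geq// mulr0.
  by rewrite E; split; [exact: integrable0|rewrite Rintegral_cst// mul0r big_geq].
have [->|N0] := posnP N.
  have E : (fun u => expR (- y * u) * S 1 u) = cst 0.
    by apply/funext => u; rewrite SE big_geq// mulr0.
  by rewrite E; split; [exact: integrable0|rewrite Rintegral_cst// mul0r big_geq].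
have E : (fun u => expR (- y * u) * S N.+1 u) = (fun u => expR (- y * u) * S N u +
    c N * (u `^ (alpha * N%:R) * expR (- y * u))).
  by apply/funext => u; rewrite !SE big_nat_recr//=; ring.
have aN : 0 < alpha * N%:R by rewrite mulr_gt0// ltr0n.
have i1 := powR_exp_integrable0 (ltW aN) y0.
have i2 := integrableZl_itv (c N) i1.
split; first by rewrite E; exact: integrableD_itv.
rewrite E RintegralD// RintegralZl// IH2 Gamma_scale// big_nat_recr//=.
Qed.

(** Dominated convergence: a partial sum is the kernel minus a Taylor error, hence at most 2 exp(2
    u^alpha) uniformly in N. Convergence of the defining series is obtained along the way. *)
Lemma pollard y : 0 < y ->
  pi * f y = \int[mu]_(u in `]0, +oo[) (expR (- y * u) * pollard_kernel u).
Proof.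
move=> y0; rewrite /stable_density mulrA divff ?mul1r ?gt_eqF ?pi_gt0//.
apply/cvg_lim => //.
under eq_cvg => N do rewrite -(S_integrable N y0).2.
have y2 : 0 < y / 2 by rewrite divr_gt0.
(* With the rate y/4 the bound exp(2 u^alpha) consumes half of exp(-y u). *)
have [C C0 HC] := powR_le_linear alpha_gt0 alpha_lt1 (divr_gt0 y0 (ltr0n R 4)).
pose g u := 2 * expR (2 * C) * (u ^+ 0 * expR (- (y / 2) * u)).
have gi : mu.-integrable `](0 : R), +oo[ (EFin \o g).
  by apply: integrableZl_itv => //; have [] := Rintegral_exprn_expR 0 y2.
have Sle N u : 0 < u -> `|expR (- y * u) * S N u| <= g u.
  move=> u0; rewrite normrM ger0_norm ?expR_ge0//.
  have xu : 0 <= u `^ alpha by exact: powR_ge0.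
  have SN : `|S N u| <= 2 * expR (2 * u `^ alpha).
    have -> : S N u = pollard_kernel u - (pollard_kernel u - S N u) by ring.
    rewrite (le_trans (ler_normB _ _))// mulr_natl mulr2n lerD//.
      rewrite (le_trans (pollard_kernel_le _))// ler_expR ler_peMl// ler1n//.
    rewrite (le_trans (pollard_kernel_approx _ _))// mulr_natl mulr2n expRD.
    rewrite ler_wpM2r ?expR_ge0//; case: N => [|N].
      by rewrite expr0 fact0 divr1 -expR0 ler_expR.
    by apply: le_trans (expR_ge1Dxn N xu); rewrite lerDr.
  apply: (le_trans (ler_wpM2l (expR_ge0 _) SN)).
  rewrite /g expr0 mul1r mulrCA -[leRHS]mulrA ler_pM2l// -!expRD ler_expR.
  have := HC u (ltW u0); lra.
suff : (\int[mu]_(u in `]0%R, +oo[) (expR (- y * u) * S n u)%:E @[n --> \oo] -->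
    \int[mu]_(u in `]0%R, +oo[) (expR (- y * u) * pollard_kernel u)%:E)%E.
  rewrite integrable_EFin_Rintegral//; last exact: pollard_integrable.
  under eq_cvg => N do rewrite (integrable_EFin_Rintegral _ (S_integrable N y0).1)//.
  by move/fine_cvgP => [].
apply: (@dominated_cvg _ _ _ mu _ _ _ _ (EFin \o g)) => //.
- by move=> N; have [/integrableP[]] := S_integrable N y0.
- move=> u _; apply: cvg_EFin; first exact: nearW.
  apply: cvgM; first exact: cvg_cst.
  apply/cvgrPdist_le => e e0.
  have := cvg_exp_coeff (u `^ alpha); move/cvgrPdist_le.
  move=> /(_ (e / expR (u `^ alpha))) /=.
  rewrite divr_gt0 ?expR_gt0// => /(_ isT) [N _ HN]; exists N => // n /HN/=.
  rewrite sub0r normrN ger0_norm ?exp_coeff_ge0 ?powR_ge0// ler_pdivlMr ?expR_gt0//.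
  by apply: le_trans; rewrite pollard_kernel_approx.
- by move=> N u; rewrite /= in_itv/= andbT => u0; rewrite lee_fin Sle.
Qed.

(** The Taylor error of second order is integrated against exp(-y u) by rescaling u. For y >= 1 the
    factor exp(u^alpha) is at most exp((y u)^alpha), so the rescaled integral no longer depends on
    y. *)
Lemma stable_density_tail : exists2 C : R, 0 < C & forall y, 1 <= y ->
  `|pi * f y - sin (pi * alpha) * Gamma (alpha + 1) / y `^ (alpha + 1)| <=
    C / y `^ (alpha * 2 + 1).
Proof.
have a20 : 0 < alpha * 2 by rewrite mulr_gt0.
have gi := powR_exp_integrable (ltW a20) alpha_gt0 alpha_lt1 ltr01.
pose g u := u `^ (alpha * 2) * expR (u `^ alpha) * expR (- 1 * u).
have g0 u : 0 <= g u by rewrite !mulr_ge0 ?powR_ge0 ?expR_ge0.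
have cg : {within `[0, +oo[, continuous g}.
  move=> x; apply: cvgM; last first.
    by apply: continuous_within => {}x; apply: has_derive_continuous; repeat derive_step.
  apply: cvgM; first exact: powR_continuous_ge0.
  apply: (@cvg_comp _ _ _ (fun u => u `^ alpha) expR); first exact: powR_continuous_ge0.
  exact: continuous_expR.
exists (1 + \int[mu]_(u in `]0, +oo[) g u) => [|y y1].
  by rewrite ltr_wpDr// Rintegral_ge0.
have y0 : 0 < y by rewrite (lt_le_trans _ y1).
have [si sE] := Rintegral0y_scale y0 cg (fun x _ => g0 x) gi.
have yp : 0 < y `^ (alpha * 2 + 1) by rewrite powR_gt0.
rewrite pollard// -mulrA -Gamma_scale// -RintegralZl//; last exact: powR_exp_integrable0 (ltW _) _.
have i1 := pollard_integrable y0.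
have i2 := integrableZl_itv (sin (pi * alpha)) (powR_exp_integrable0 (ltW alpha_gt0) y0).
rewrite -RintegralB//.
have i3 := integrableB_itv i1 i2.
pose h u := y `^ (- (alpha * 2)) * g (y * u).
apply: (@le_trans _ _ (\int[mu]_(u in `]0, +oo[) h u)).
  apply: le_normr_Rintegral_itv => //; first exact: integrableZl_itv.
  move=> u; rewrite in_itv/= andbT => u0.
  have -> : expR (- y * u) * pollard_kernel u - sin (pi * alpha) * (u `^ alpha * expR (- y * u))
      = (pollard_kernel u - sin (pi * alpha) * u `^ alpha) * expR (- y * u) by ring.
  rewrite normrM [`|expR _|]ger0_norm ?expR_ge0//.
  apply: (le_trans (ler_wpM2r (expR_ge0 _) (pollard_kernel_sub_le _))).
  rewrite /h /g [(y * u) `^ (alpha * 2)]powRM ?(ltW y0) ?(ltW u0)// powRN -!mulrA mulKf ?gt_eqF ?powR_gt0//.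
  rewrite ler_wpM2l ?powR_ge0// mulN1r mulNr ler_wpM2r ?expR_ge0// ler_expR.
  by rewrite ge0_ler_powR ?nnegrE ?mulr_ge0 ?(ltW y0) ?(ltW u0) ?(ltW alpha_gt0)// ler_peMl// ltW.
rewrite RintegralZl// sE mulrA -powR_inv1 ?(ltW y0)// -powRD ?(gt_eqF y0) ?implybT//.
rewrite -opprD powRN mulrC ler_wpM2r ?invr_ge0 ?powR_ge0//.
by rewrite lerDr.
Qed.

End pollard.

(** * Zolotarev's representation *)

Section exhaustion.
Context {R : realType}.
Notation mu := (@lebesgue_measure R).
Implicit Types (f F : R -> R) (a b l x : R).

(* The compact intervals [a + e_n, b - e_n] exhaust ]a, b[. *)
Lemma Rintegral_oo_FTC f F a b l l' (e : nat -> R) :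
  (forall n, 0 < e n) -> (forall n, a + e n < b - e n) ->
  {homo e : n m / (n <= m)%N >-> m <= n} -> e n @[n --> \oo] --> 0 ->
  (forall x, a < x < b -> 0 <= f x) ->
  (forall x, a < x < b -> {for x, continuous f}) ->
  (forall x, a < x < b -> has_derive F x (f x)) ->
  F (a + e n) @[n --> \oo] --> l -> F (b - e n) @[n --> \oo] --> l' ->
  mu.-integrable `]a, b[ (EFin \o f) /\ \int[mu]_(x in `]a, b[) f x = l' - l.
Proof.
move=> e0 eab emono ecvg f0 cf dF Fl Fl'.
have mf : measurable_fun `]a, b[ f.
  apply: open_continuous_measurable_fun => // x; rewrite inE/= in_itv/=; exact: cf.
apply: integral_EFin_integrable => //.
pose E n := `[a + e n, b - e n]%classic : set R.
have EU : `]a, b[%classic = \bigcup_n E n.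
  apply/seteqP; split => x /=.
    rewrite in_itv/= => /andP[ax xb].
    have ex0 : 0 < Num.min (x - a) (b - x) by rewrite lt_min !subr_gt0 ax.
    move/cvgr0_norm_le : ecvg => /(_ _ ex0)[n _ /(_ n (leqnn n))].
    rewrite ger0_norm ?(ltW (e0 n))// le_min => /andP[h1 h2].
    by exists n => //; rewrite /E/= in_itv/=; apply/andP; split; lra.
  move=> [n _]; rewrite /E/= !in_itv/= => /andP[h1 h2].
  by have := e0 n => h3; apply/andP; split; lra.
have Esub n x : E n x -> a < x < b.
  by rewrite /E/= in_itv/= => /andP[h1 h2]; have := e0 n => h3; apply/andP; split; lra.
rewrite EU.
have HE n : (\int[mu]_(x in E n) (f x)%:E)%E = (F (b - e n) - F (a + e n))%:E.
  have cEf : {within E n, continuous f}.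
    by apply: continuous_in_subspaceT => x /set_mem/Esub; exact: cf.
  rewrite integrable_EFin_Rintegral; last 2 first.
  - exact: measurable_itv.
  - exact: segment_integrable.
  congr EFin; apply: Rintegral_segment_FTC => //.
    apply: continuous_in_subspaceT => x /set_mem/Esub/dF; exact: has_derive_continuous.
  move=> x /andP[h1 h2]; apply: dF; apply: (Esub n); rewrite /E/= in_itv/=.
  by rewrite (ltW h1) (ltW h2).
have H2 : (\int[mu]_(x in E n) (f x)%:E)%E @[n --> \oo] --> (l' - l)%:E.
  under eq_cvg do rewrite HE.
  by apply: cvg_EFin; [exact: nearW|exact: cvgB].
apply: (cvg_unique _ _ H2) => //.
apply: ge0_nondecreasing_set_cvg_integral.
- move=> n m nm; rewrite subsetEset => x; rewrite /E/= !in_itv/= => /andP[h1 h2].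
  by have h3 := emono _ _ nm; apply/andP; split; lra.
- by move=> n; exact: measurable_itv.
- move=> n; apply/measurable_EFinP; apply: measurable_funS mf => //.
  by move=> x /Esub; rewrite /= in_itv.
- by move=> n x /Esub/f0; rewrite lee_fin.
Qed.

End exhaustion.

Lemma norm_sub_le1 {R : realType} (a b : R) :
  0 <= a -> a <= 1 -> 0 <= b -> b <= 1 -> `|a - b| <= 1.
Proof. by move=> *; rewrite ler_norml; apply/andP; split; lra. Qed.

(** * Turning the contour to the curve where the exponent is real *)

Section contour.
Context {R : realType} (alpha : R).
Context (alpha_gt0 : 0 < alpha) (alpha_lt1 : alpha < 1).
Notation mu := (@lebesgue_measure R).
Implicit Types (x y u t rho : R).

Lemma Rintegral_segment_scale (g : R -> R) c : 0 < c -> {within `[0, c], continuous g} ->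
  \int[mu]_(x in `[0, c]) g x = \int[mu]_(x in `[0, 1]) (c * g (c * x)).
Proof.
move=> c0 cg.
have d x : has_derive (fun t => c * t) x c by derive; ring.
have dE : (fun t => c * t)^`()%classic = cst c.
  by apply/funext => x; rewrite derive1E; have [_ ->] := d x.
rewrite /Rintegral; congr fine.
have -> : `[(0 : R), c]%classic = `[c * 0, c * 1]%classic by rewrite mulr0 mulr1.
rewrite (@integration_by_substitution_increasing _ (fun t => c * t) g 0 1)//.
- by apply: eq_integral => x _; rewrite dE fctE mulrC.
- by move=> x z _ _ xz; rewrite ltr_pM2l.
- by rewrite dE => x _; exact: cvg_cst.
- by rewrite dE; exact: is_cvg_cst.
- by rewrite dE; exact: is_cvg_cst.
- split; first by move=> x _; have [] := d x.
    by apply: cvg_at_right_filter; exact: has_derive_continuous (d 0).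
  by apply: cvg_at_left_filter; exact: has_derive_continuous (d 1).
- by rewrite mulr0 mulr1.
Qed.

Definition dual_index := alpha / (1 - alpha).
Local Notation beta := dual_index.

(** After regrouping powers this is (sin(alpha t)^alpha sin((1-alpha) t)^(1-alpha) / sin
    t)^(1/(1-alpha)), the classical form of Zolotarev's function. *)
Definition zolotarev t := (sin (alpha * t) / sin t) `^ beta * (sin ((1 - alpha) * t) / sin t).

Let sin_pos t : 0 < t < pi -> 0 < sin t.
Proof. exact: sin_gt0_pi. Qed.

Let sin_pos_mul (c t : R) : 0 < c -> c < 1 -> 0 < t < pi -> 0 < sin (c * t).
Proof.
move=> c0 c1 /andP[t0 tpi]; apply: sin_gt0_pi; rewrite mulr_gt0//=.
by apply: lt_trans tpi; rewrite gtr_pMl.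
Qed.

(** Concavity of sine on [0, pi], in the form cos(c x) >= cos x. *)
Lemma sin_mul_ge (c t : R) : 0 < c -> c < 1 -> 0 < t < pi -> c * sin t <= sin (c * t).
Proof.
move=> c0 c1 /andP[t0 tpi].
have d x : 0 <= x <= t -> has_derive (fun x => sin (c * x) - c * sin x) x (c * (cos (c * x) - cos x)).
  by move=> _; derive; ring.
have := has_derive_ge0_le (ltW t0) d; rewrite !mulr0 !sin0 mulr0 subr0 subr_ge0; apply.
move=> x /andP[x0 xt]; rewrite mulr_ge0 ?(ltW c0)// subr_ge0.
rewrite leNgt ltr_cos ?in_itv/= -?leNgt.
- by rewrite ler_piMl// ltW.
- by rewrite x0 (le_trans xt)// ltW.
- by rewrite mulr_ge0 ?(ltW c0)//= (le_trans _ (le_trans xt (ltW tpi)))// ler_piMl// ltW.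
Qed.

(** Both factors are bounded below by their limits at t = 0. That the bound is positive is what
    produces the factor exp(-c y^(-beta)) in H. *)
Lemma zolotarev_ge : exists2 a0 : R, 0 < a0 & forall t, 0 < t < pi -> a0 <= zolotarev t.
Proof.
have b0 : 0 < beta by rewrite divr_gt0// subr_gt0.
exists (alpha `^ beta * (1 - alpha)) => [|t t0pi].
  by rewrite mulr_gt0 ?powR_gt0// subr_gt0.
have st := sin_pos t0pi.
rewrite /zolotarev ler_pM ?powR_ge0 ?subr_ge0 ?(ltW alpha_lt1)//.
  rewrite ge0_ler_powR ?nnegrE ?(ltW b0) ?(ltW alpha_gt0)//.
    by rewrite divr_ge0 ?ltW// sin_pos_mul.
  by rewrite ler_pdivlMr// sin_mul_ge.
by rewrite ler_pdivlMr// sin_mul_ge ?subr_gt0// gtrBl.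
Qed.

Section fixed_y.
Context (y : R).
Context (y0 : 0 < y).

(* In polar coordinates [s = r e^{i phi}], the imaginary part of
   [e^{y s - s^alpha} ds] is [ray u phi du + ... dphi], and [rad] is the curve
   on which [y s - s^alpha] is real. *)
Definition ray u t := expR (y * u * cos t - u `^ alpha * cos (alpha * t)) *
  sin (t + (y * u * sin t - u `^ alpha * sin (alpha * t))).

Definition rad t := (sin (alpha * t) / (y * sin t)) `^ (1 - alpha)^-1.

(** The logarithmic derivative of [rad]. *)
Let L t := (alpha * (cos (alpha * t) / sin (alpha * t)) - cos t / sin t) / (1 - alpha).

Let q_gt0 t : 0 < t < pi -> 0 < sin (alpha * t) / (y * sin t).
Proof. by move=> tpi; apply: divr_gt0; [exact: sin_pos_mul|rewrite mulr_gt0// sin_pos]. Qed.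

Lemma rad_gt0 t : 0 < t < pi -> 0 < rad t.
Proof. by move=> tpi; rewrite powR_gt0// q_gt0. Qed.

Let rad_derive t : 0 < t < pi -> has_derive rad t (L t * rad t).
Proof.
move=> tpi; have st := sin_pos tpi; have sat := sin_pos_mul alpha_gt0 alpha_lt1 tpi.
have q0 := q_gt0 tpi; have a1 : 1 - alpha != 0 by rewrite subr_eq0 gt_eqF.
have ys : y * sin t != 0 by rewrite mulf_neq0 ?gt_eqF.
rewrite /rad; derive.
rewrite powRB ?(gt_eqF q0) ?implybT// powRr1 ?ltW//.
set w := powR _ _; rewrite /L; field.
by rewrite !gt_eqF//= subr_gt0.
Qed.

(** This equation of the curve expresses that the imaginary part of y s - s^alpha vanishes at s =
    rad(t) e^(i t). *)
Lemma rad_powR t : 0 < t < pi -> y * rad t * sin t = rad t `^ alpha * sin (alpha * t).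
Proof.
move=> tpi; have st := sin_pos tpi; have q0 := q_gt0 tpi; have r0 := rad_gt0 tpi.
have a1 : 1 - alpha != 0 by rewrite subr_eq0 gt_eqF.
have rE : rad t = rad t `^ alpha * (sin (alpha * t) / (y * sin t)).
  have <- : rad t `^ (1 - alpha) = sin (alpha * t) / (y * sin t).
    by rewrite -powRrM mulVf// powRr1// ltW.
  by rewrite -powRD ?(gt_eqF r0) ?implybT// addrC subrK powRr1// ltW.
by rewrite {1}rE; field; rewrite !gt_eqF.
Qed.

(* [Q] is the [dphi] component of the form pulled back along
   [(rho, phi) |-> rho * rad phi]. *)
Let Ph rho t := t + (y * (rho * rad t) * sin t - rho `^ alpha * rad t `^ alpha * sin (alpha * t)).
Let Am rho t := y * (rho * rad t) * cos t - rho `^ alpha * rad t `^ alpha * cos (alpha * t).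
(** [a1] and [b1] are rho times the radial derivatives of the exponent [Am] and of the phase
    [Ph]. *)
Let a1 rho t := y * (rho * rad t) * cos t - alpha * rho `^ alpha * rad t `^ alpha * cos (alpha * t).
Let b1 rho t := y * (rho * rad t) * sin t - alpha * rho `^ alpha * rad t `^ alpha * sin (alpha * t).
Let Q rho t := rho * rad t * expR (Am rho t) * (L t * sin (Ph rho t) + cos (Ph rho t)).
Let P rho t := rad t * (expR (Am rho t) * sin (Ph rho t)).
(** The common value of the derivative of [P] in t and of [Q] in rho. That they agree means that the
    form is closed, and this is how holomorphy enters. *)
Let D rho t := rad t * expR (Am rho t) * (L t * sin (Ph rho t) + cos (Ph rho t) +
  (L t * a1 rho t - b1 rho t) * sin (Ph rho t) + (L t * b1 rho t + a1 rho t) * cos (Ph rho t)).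

Let PE rho t : 0 <= rho -> 0 < t < pi -> P rho t = rad t * ray (rad t * rho) t.
Proof.
move=> rho0 tpi; rewrite /P /ray /Am /Ph powRM ?(ltW (rad_gt0 tpi))//.
by rewrite [rad t * rho]mulrC [rad t `^ alpha * _]mulrC.
Qed.

Let radp_derive t : 0 < t < pi ->
  has_derive (fun t => rad t `^ alpha) t (alpha * L t * rad t `^ alpha).
Proof.
move=> tpi; have r0 := rad_gt0 tpi; have dr := rad_derive tpi.
derive; rewrite powRB ?(gt_eqF r0) ?implybT// powRr1 ?ltW//.
by field; rewrite gt_eqF.
Qed.

Let P_derive_t rho t : 0 < t < pi -> has_derive (P rho) t (D rho t).
Proof.
move=> tpi; have dr := rad_derive tpi; have dp := radp_derive tpi.
rewrite /P /Am /Ph; derive.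
by rewrite /D /Am /Ph /a1 /b1; ring.
Qed.

Let Q_derive_rho rho t : 0 < rho -> 0 < t < pi -> has_derive (Q ^~ t) rho (D rho t).
Proof.
move=> rho0 tpi; rewrite /Q /Am /Ph; derive.
rewrite powRB ?(gt_eqF rho0) ?implybT// powRr1 ?ltW//.
rewrite /D /Am /Ph /a1 /b1; move: (expR _) (sin (t + _)) (cos (t + _)) => e s c.
by field; rewrite gt_eqF.
Qed.

Let powR_cont (A : set R) : A `<=` `[0, +oo[ -> {within A, continuous (fun x => x `^ alpha)}.
Proof. by move=> sub; apply: continuous_subspaceW sub (powR_continuous_ge0 alpha_gt0). Qed.

Let sub01 : `[(0 : R), 1] `<=` `[0, +oo[.
Proof. by move=> x /=; rewrite !in_itv/= andbT => /andP[]. Qed.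

Let P_cont t : {within `[0, 1], continuous (P ^~ t)}.
Proof. by have cp := powR_cont sub01; rewrite /P /Am /Ph; repeat wcont_step. Qed.

Let Q_cont t : {within `[0, 1], continuous (Q ^~ t)}.
Proof. by have cp := powR_cont sub01; rewrite /Q /Am /Ph; repeat wcont_step. Qed.

Let D_cont t : {within `[0, 1], continuous (D ^~ t)}.
Proof. by have cp := powR_cont sub01; rewrite /D /Am /Ph /a1 /b1; repeat wcont_step. Qed.

(** A bound of [D] that is uniform in rho and continuous in t, for differentiation under the
    integral near a fixed angle. *)
Let M t := rad t * expR (y * rad t + rad t `^ alpha) *
  ((`|L t| + 1) * (1 + 2 * (y * rad t + rad t `^ alpha))).

Let D_le rho t : 0 <= rho <= 1 -> 0 < t < pi -> `|D rho t| <= M t.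
Proof.
move=> /andP[rho0 rho1] tpi; have r0 := rad_gt0 tpi.
have rp0 : 0 <= rho `^ alpha <= 1.
  have : rho `^ alpha <= 1 `^ alpha by rewrite ge0_ler_powR ?nnegrE ?(ltW alpha_gt0).
  by rewrite powR1 powR_ge0.
have ra0 : 0 <= rad t `^ alpha by exact: powR_ge0.
have yr0 : 0 <= y * rad t by rewrite mulr_ge0 ?ltW.
have sc (u v k c1 c2 : R) : 0 <= u -> 0 <= v -> 0 <= k <= 1 -> `|c1| <= 1 -> `|c2| <= 1 ->
    `|rho * u * c1 - k * v * c2| <= u + v.
  move=> u0 v0 /andP[k0 k1] h1 h2; apply: (le_trans (ler_normB _ _)).
  rewrite !normrM (ger0_norm rho0) (ger0_norm u0) (ger0_norm k0) (ger0_norm v0).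
  apply: lerD; rewrite -[leRHS]mulr1 ler_pM ?mulr_ge0//.
    by rewrite ler_piMl.
  by rewrite ler_piMl.
have nc x : `|cos x| <= 1 by rewrite ler_norml cos_geN1 cos_le1.
have ns x : `|sin x| <= 1 by rewrite ler_norml sin_geN1 sin_le1.
have ak : 0 <= alpha * rho `^ alpha <= 1.
  move: rp0 => /andP[h1 h2]; rewrite mulr_ge0 ?(ltW alpha_gt0)//=.
  by rewrite mulr_ile1 ?(ltW alpha_gt0)// ltW.
have ha : `|a1 rho t| <= y * rad t + rad t `^ alpha.
  by rewrite /a1 mulrCA sc.
have hb : `|b1 rho t| <= y * rad t + rad t `^ alpha.
  by rewrite /b1 mulrCA sc.
have hA : expR (Am rho t) <= expR (y * rad t + rad t `^ alpha).
  rewrite ler_expR (le_trans (ler_norm _))// /Am mulrCA sc//.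
rewrite /D /M; move: (L t) => l; rewrite !normrM (ger0_norm (ltW r0)) ger0_norm ?expR_ge0//.
rewrite ler_pM ?mulr_ge0 ?expR_ge0 ?(ltW r0)//; first by rewrite ler_pM2l.
set s := sin _; set c := cos _; set B := y * rad t + _ in ha hb *.
have B0 : 0 <= B by rewrite addr_ge0.
have l0 : 0 <= `|l| by [].
have hs : `|s| <= 1 by exact: ns.
have hc : `|c| <= 1 by exact: nc.
have -> : (`|l| + 1) * (1 + 2 * B) =
   (`|l| * 1 + 1) + (`|l| * B + B) * 1 + (`|l| * B + B) * 1 by ring.
have mulle (u v U V : R) : `|u| <= U -> `|v| <= V -> `|u * v| <= U * V.
  by move=> hu hv; rewrite normrM ler_pM.
have addle (u v U V : R) : `|u| <= U -> `|v| <= V -> `|u + v| <= U + V.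
  by move=> hu hv; rewrite (le_trans (ler_normD _ _))// lerD.
have suble (u v U V : R) : `|u| <= U -> `|v| <= V -> `|u - v| <= U + V.
  by move=> hu hv; rewrite (le_trans (ler_normB _ _))// lerD.
apply: (addle); first apply: (addle); first apply: (addle) => //; first exact: mulle.
  by apply: (mulle) => //; apply: suble => //; exact: mulle.
by apply: (mulle) => //; apply: addle => //; exact: mulle.
Qed.

Let L_cont t : 0 < t < pi -> {for t, continuous L}.
Proof.
move=> tpi; have st := sin_pos tpi; have sat := sin_pos_mul alpha_gt0 alpha_lt1 tpi.
by apply: has_derive_continuous; rewrite /L; repeat derive_step.
Qed.

Let M_cont t : 0 < t < pi -> {for t, continuous M}.
Proof.
move=> tpi; have dr := rad_derive tpi; have dp := radp_derive tpi.
have cL := L_cont tpi.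
have cB : {for t, continuous (fun t => y * rad t + rad t `^ alpha)}.
  by apply: has_derive_continuous; repeat derive_step.
have cE : {for t, continuous (fun t => rad t * expR (y * rad t + rad t `^ alpha))}.
  by apply: has_derive_continuous; repeat derive_step.
rewrite /M; apply: cvgM; first exact: cE.
apply: cvgM; first by apply: cvgD; [exact: cvg_norm|exact: cvg_cst].
apply: cvgD; first exact: cvg_cst.
by apply: cvgM; [exact: cvg_cst|exact: cB].
Qed.

(** The form integrated over the segment from 0 to the point of the curve at angle t, parametrised
    by [0, 1] so that the domain does not move with t. *)
Let J t := \int[mu]_(rho in `[0, 1]) P rho t.

(** This takes the place of Cauchy's theorem: by closedness the integral of [D] over rho is
    [Q 1 t - Q 0 t], and [Q] vanishes at rho = 0, so only the endpoint on the curve contributes. *)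
Let J_derive t : 0 < t < pi -> has_derive J t (Q 1 t).
Proof.
move=> /andP[t0 tpi].
pose u := t / 2; pose v := (t + pi) / 2.
have ut : u < t by rewrite /u ltr_pdivrMr// ltr_pMr// ltr1n.
have tv : t < v by rewrite /v; lra.
have u0 : 0 < u by rewrite divr_gt0.
have vpi : v < pi by rewrite /v; lra.
have uvpi x : u <= x <= v -> 0 < x < pi.
  by move=> /andP[h1 h2]; rewrite (lt_le_trans u0 h1) (le_lt_trans h2 vpi).
have cM : {within `[u, v], continuous M}.
  apply: continuous_in_subspaceT => x; rewrite inE/= in_itv/= => /uvpi; exact: M_cont.
have [m _ Mle] := EVT_max (ltW (lt_trans ut tv)) cM.
have tuv : u < t < v by rewrite ut.
have xuv x : u < x < v -> u <= x <= v by move=> /andP[h1 h2]; rewrite !ltW.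
have -> : Q 1 t = \int[mu]_(rho in `[0, 1]) D rho t; last first.
  apply: (@has_derive_Rintegral_itv _ _ (fun t rho => P rho t) (fun t rho => D rho t)
    (fun=> `|M m|) _ _ _ tuv) => //.
  - by move=> x _; apply: segment_integrable; exact: P_cont.
  - by move=> x rho /xuv/uvpi h _; exact: P_derive_t.
  - by apply: segment_integrable; exact: within_continuous_const.
  - move=> x rho /xuv h; rewrite in_itv/= => rho01.
    apply: (le_trans (D_le rho01 (uvpi _ h))); apply: le_trans (ler_norm _).
    by apply: Mle; rewrite in_itv.
have dQ rho : 0 < rho < 1 -> has_derive (Q ^~ t) rho (D rho t).
  by move=> /andP[rho0 _]; apply: Q_derive_rho => //; rewrite t0.
rewrite (Rintegral_segment_FTC ltr01 (@D_cont t) (@Q_cont t) dQ).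
by rewrite [Q 0 t]/Q !mul0r subr0.
Qed.

Definition scaled_zolotarev t := zolotarev t * y `^ (- beta).
Local Notation v := scaled_zolotarev.

(** On the curve the phase [Ph] reduces to t and y s - s^alpha takes the real value -v; the rest is
    the addition formula for sin((1-alpha) t). *)
Let Q1E t : 0 < t < pi -> Q 1 t = beta / y * (v t * expR (- v t)).
Proof.
move=> tpi; have st := sin_pos tpi; have sat := sin_pos_mul alpha_gt0 alpha_lt1 tpi.
have r0 := rad_gt0 tpi; have rE := rad_powR tpi.
have a0 : 1 - alpha != 0 by rewrite subr_eq0 gt_eqF.
have vE : v t = rad t `^ alpha * sin ((1 - alpha) * t) / sin t.
  rewrite /scaled_zolotarev /zolotarev -[rad t `^ alpha]powRrM.
  have -> : sin (alpha * t) / (y * sin t) = sin (alpha * t) / sin t * y^-1.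
    by field; rewrite !gt_eqF.
  rewrite [(1 - alpha)^-1 * alpha]mulrC -/dual_index [(_ / y) `^ beta]powRM ?invr_ge0 ?(ltW y0)//; last first.
    by rewrite divr_ge0 ?ltW.
  by rewrite -[y^-1]powR_inv1 ?(ltW y0)// -powRrM mulN1r; ring.
have sE : sin ((1 - alpha) * t) = sin t * cos (alpha * t) - cos t * sin (alpha * t).
  by rewrite mulrBl mul1r sinB.
have PhE : Ph 1 t = t by rewrite /Ph powR1 !mul1r rE subrr addr0.
have AmE : Am 1 t = - v t.
  rewrite /Am powR1 !mul1r vE sE.
  have -> : y * rad t = rad t `^ alpha * sin (alpha * t) / sin t by rewrite -rE mulfK ?gt_eqF.
  by field; rewrite gt_eqF.
suff E : rad t * (L t * sin t + cos t) = beta / y * v t.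
  transitivity (expR (- v t) * (rad t * (L t * sin t + cos t))).
    by rewrite /Q AmE PhE; move: (L t) (expR _) => l w; ring.
  by rewrite E; move: (expR _) => w; ring.
rewrite vE sE /L /dual_index.
have {1}-> : rad t = rad t `^ alpha * sin (alpha * t) / (y * sin t).
  by rewrite -rE; field; rewrite !gt_eqF.
move: (rad t `^ alpha) => w.
by field; rewrite !gt_eqF//= subr_gt0.
Qed.

(** Starting from 1/2 keeps e n < pi - e n for every n, as pi >= 2. *)
Let e n : R := n.+2%:R^-1.

Let e_gt0 n : 0 < e n. Proof. by rewrite invr_gt0. Qed.

Let e_le n : e n <= 2^-1.
Proof. by rewrite lef_pV2 ?posrE// ler_nat. Qed.

Let pi_ge2 : 2 <= @pi R.
Proof. by have := @pihalf_ge1 R; rewrite ler_pdivlMr// mul1r. Qed.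

Let e_cvg : e n @[n --> \oo] --> 0.
Proof.
apply: (@squeeze_cvgr _ _ _ _ (cst 0) (@harmonic R)); last exact: cvg_harmonic.
  by near=> n; rewrite /= ltW ?e_gt0//= lef_pV2 ?posrE// ler_nat.
exact: cvg_cst.
Unshelve. all: by end_near.
Qed.

Let e_in n : 0 < e n < pi.
Proof. by rewrite e_gt0/=; have := e_le n; have := pi_ge2; lra. Qed.

Let pie_in n : 0 < pi - e n < pi.
Proof. by have := e_gt0 n; have := e_le n; have := pi_ge2 => *; apply/andP; split; lra. Qed.

Let abs_sin_le x : `|sin x| <= `|x|.
Proof.
have H (z : R) : 0 <= z -> `|sin z| <= z.
  move=> z0; have d w : 0 <= w <= z -> has_derive sin w (cos w) by move=> _; exact: is_derive_sin.
  have [c _] := has_derive_MVT z0 d; rewrite sin0 !subr0 => ->.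
  by rewrite normrM (ger0_norm z0) ler_piMl// ler_norml cos_geN1 cos_le1.
have [x0|/ltW x0] := leP 0 x; first by rewrite [`|x|]ger0_norm// H.
by rewrite -normrN -sinN [`|x|]ler0_norm// H// oppr_ge0.
Qed.

(** Since sin(alpha t) <= sin t for small t, the radii stay below y^(-1/(1-alpha)). By the equation
    of the curve the phase differs from t by O(sin t), so the integrand is O(sin t) uniformly in
    rho. *)
Let J_cvg0 : J (0 + e n) @[n --> \oo] --> 0.
Proof.
pose r1 := (y^-1) `^ (1 - alpha)^-1.
have r10 : 0 <= r1 by exact: powR_ge0.
pose K := r1 * (expR (y * r1 + r1 `^ alpha) * (1 + y * r1)).
have JK n : `|J (0 + e n)| <= K * sin (e n).
  rewrite add0r; have ein := e_in n; set t := e n in ein *.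
  have st := sin_pos ein; have sat := sin_pos_mul alpha_gt0 alpha_lt1 ein.
  have r0 := rad_gt0 ein.
  have p2 := @pihalf_ge1 R.
  have t1 : t <= 1 by rewrite (le_trans (e_le n))//; lra.
  have t0 : 0 < t by case/andP: ein.
  have sas : sin (alpha * t) <= sin t.
    rewrite leNgt ltr_sin ?in_itv/= -?leNgt.
    - by rewrite ler_piMl ?ltW.
    - by apply/andP; split; lra.
    - have h1 : 0 < alpha * t by rewrite mulr_gt0.
      have h2 : alpha * t <= t by rewrite ler_piMl ?ltW.
      by apply/andP; split; lra.
  have rr1 : rad t <= r1.
    rewrite /rad /r1 ge0_ler_powR ?nnegrE ?invr_ge0 ?subr_ge0 ?(ltW alpha_lt1) ?(ltW y0) ?(ltW (q_gt0 _))//.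
    by rewrite ler_pdivrMr ?mulr_gt0// mulKf ?gt_eqF.
  have rar1 : rad t `^ alpha <= r1 `^ alpha.
    by rewrite ge0_ler_powR ?nnegrE ?(ltW alpha_gt0) ?(ltW r0).
  have -> : K * sin t = \int[mu]_(rho in `[0, 1]) (K * sin t).
    rewrite Rintegral_cst//= lebesgue_measure_itv/= lte_fin ltr01.
    by rewrite oppr0 addr0 mulr1.
  apply: le_normr_Rintegral_itv.
  - by apply: segment_integrable; exact: P_cont.
  - by apply: segment_integrable; exact: within_continuous_const.
  - move=> rho; rewrite in_itv/= => /andP[rho0 rho1].
    have rp0 : 0 <= rho `^ alpha by exact: powR_ge0.
    have rp1 : rho `^ alpha <= 1.
      have : rho `^ alpha <= 1 `^ alpha by rewrite ge0_ler_powR ?nnegrE ?(ltW alpha_gt0).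
      by rewrite powR1.
    rewrite /P !normrM (ger0_norm (ltW r0)) (ger0_norm (expR_ge0 _)) /K -!mulrA.
    rewrite ler_pM ?mulr_ge0 ?expR_ge0 ?(ltW r0)// ler_pM ?expR_ge0//.
      rewrite ler_expR /Am.
      have h1 : y * (rho * rad t) * cos t <= y * r1.
        rewrite -[leRHS]mulr1 (le_trans (ler_norm _))// normrM ger0_norm ?mulr_ge0 ?(ltW y0) ?(ltW r0)//.
        rewrite ler_pM ?mulr_ge0 ?(ltW y0) ?(ltW r0)//.
          by rewrite ler_pM2l// (le_trans _ rr1)// ler_piMl ?(ltW r0).
        by rewrite ler_norml cos_geN1 cos_le1.
      have h2 : `|rho `^ alpha * rad t `^ alpha * cos (alpha * t)| <= r1 `^ alpha.
        rewrite normrM ger0_norm ?mulr_ge0 ?powR_ge0// -[leRHS]mulr1 ler_pM ?mulr_ge0 ?powR_ge0//.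
          by apply: le_trans rar1; apply: (ler_piMl (powR_ge0 _ _) rp1).
        by rewrite ler_norml cos_geN1 cos_le1.
      move: h1 h2; move: (_ * cos t) (_ * cos (alpha * t)) (r1 `^ alpha) (y * r1) => a b c d h1.
      by rewrite ler_norml => /andP[h2 h3]; lra.
    have B_E : y * (rho * rad t) * sin t - rho `^ alpha * rad t `^ alpha * sin (alpha * t)
        = (rho - rho `^ alpha) * (y * rad t * sin t).
      by rewrite -[rho `^ alpha * _ * _]mulrA -(rad_powR ein); ring.
    rewrite /Ph B_E sinD; set B := _ * (_ * sin t).
    have hB : `|B| <= y * r1 * sin t.
      rewrite /B !normrM (ger0_norm (ltW st)) (ger0_norm (ltW y0)) (ger0_norm (ltW r0)).
      rewrite -[leRHS]mul1r ler_pM ?mulr_ge0 ?(ltW y0) ?(ltW r0) ?(ltW st)//.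
        exact: norm_sub_le1.
      by rewrite ler_wpM2r ?(ltW st)// ler_pM2l.
    rewrite (le_trans (ler_normD _ _))// mulrDl mul1r lerD//.
      rewrite normrM (ger0_norm (ltW st)) ler_piMr ?(ltW st)//.
      by rewrite ler_norml cos_geN1 cos_le1.
    rewrite normrM (le_trans _ hB)// (le_trans _ (abs_sin_le B))// ler_piMl//.
    by rewrite ler_norml cos_geN1 cos_le1.
have K0 : K * sin (e n) @[n --> \oo] --> 0.
  rewrite -(mulr0 K); apply: cvgM; first exact: cvg_cst.
  rewrite -(@sin0 R); apply: (@cvg_comp _ _ _ e sin _ _ _ e_cvg); exact: continuous_sin.
apply: norm_cvg0; apply: (@squeeze_cvgr _ _ _ _ (cst 0) _ _ _ _ _ K0).
  by near=> n; rewrite normr_ge0/= JK.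
exact: cvg_cst.
Unshelve. all: by end_near. Qed.

Let ray_cont_u t (A : set R) : A `<=` `[0, +oo[ -> {within A, continuous (ray ^~ t)}.
Proof. by move=> sub; have cp := powR_cont sub; rewrite /ray; repeat wcont_step. Qed.

Let JE t : 0 < t < pi -> mu.-integrable `[0, rad t] (EFin \o (ray ^~ t)) /\
  J t = \int[mu]_(u in `[0, rad t]) ray u t.
Proof.
move=> tpi; have r0 := rad_gt0 tpi.
have sub : `[0, rad t] `<=` `[0, +oo[.
  by move=> x /=; rewrite !in_itv/= andbT => /andP[].
split; first by apply: segment_integrable; exact: ray_cont_u.
rewrite (Rintegral_segment_scale r0); last exact: ray_cont_u.
apply: eq_Rintegral => rho; rewrite inE/= in_itv/= => /andP[rho0 _].
exact: PE.
Qed.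

(** The angles pi - e n lie within 1 of pi, so their cosines are at most -cos 1 < 0, which gives a
    decay rate common to all n. *)
Let kap : R := cos 1.

Let cos_pie n : cos (pi - e n) <= - kap.
Proof.
have he := e_gt0 n; have hle := e_le n; have hpi := pi_ge2.
have h1 : e n \in `[0, pi] by rewrite in_itv/=; apply/andP; split; lra.
have h2 : 1 \in `[0, @pi R] by rewrite in_itv/=; apply/andP; split; lra.
by rewrite addrC cosDpi cosN lerN2 leNgt ltr_cos// -leNgt; lra.
Qed.

Let g u := u `^ 0 * expR (u `^ alpha) * expR (- (kap * y) * u).

Let ray_le n u : 0 <= u -> `|ray u (pi - e n)| <= g u.
Proof.
move=> u0; have up : 0 <= u `^ alpha by exact: powR_ge0.
rewrite /ray normrM ger0_norm ?expR_ge0// -[leRHS]mulr1 ler_pM ?expR_ge0//; last first.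
  by rewrite ler_norml sin_geN1 sin_le1.
rewrite /g powRr0 mul1r -expRD ler_expR.
have h1 : y * u * cos (pi - e n) <= - (kap * y) * u.
  have -> : - (kap * y) * u = y * u * - kap by ring.
  by rewrite ler_wpM2l ?cos_pie// mulr_ge0 ?(ltW y0).
have h2 : - (u `^ alpha * cos (alpha * (pi - e n))) <= u `^ alpha.
  by rewrite -mulrN ler_piMr// lerNl cos_geN1.
by rewrite [leRHS]addrC lerD.
Qed.

Let g_int : mu.-integrable `](0 : R), +oo[ (EFin \o g).
Proof. by apply: powR_exp_integrable => //; rewrite mulr_gt0// cos1_gt0. Qed.

(** Without denominators the claim is y u^(1-alpha) sin t <= sin(alpha t); at t = pi it reads 0 <=
    sin(alpha pi), which is strict and persists nearby by continuity. *)
Let rad_cvg u : 0 <= u -> \forall n \near \oo, u <= rad (pi - e n).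
Proof.
move=> u0.
have H : sin (alpha * (pi - e n)) - y * u `^ (1 - alpha) * sin (pi - e n) @[n --> \oo] -->
    sin (alpha * pi) - y * u `^ (1 - alpha) * sin pi.
  have pe : pi - e n @[n --> \oo] --> (pi : R).
    by rewrite -[X in _ --> X]subr0; apply: cvgB; [exact: cvg_cst|exact: e_cvg].
  apply: cvgB.
    apply: (@cvg_comp _ _ _ (fun n => alpha * (pi - e n)) sin); last exact: continuous_sin.
    by apply: cvgM; [exact: cvg_cst|exact: pe].
  apply: cvgM; first exact: cvg_cst.
  by apply: (@cvg_comp _ _ _ (fun n => pi - e n) sin _ _ _ pe); exact: continuous_sin.
rewrite sinpi mulr0 subr0 in H.
have sp : 0 < sin (alpha * pi).
  by apply: sin_gt0_pi; rewrite mulr_gt0 ?pi_gt0//= gtr_pMl ?pi_gt0.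
near=> n.
have tn := pie_in n; have st := sin_pos tn.
have h : 0 < sin (alpha * (pi - e n)) - y * u `^ (1 - alpha) * sin (pi - e n).
  by near: n; exact: (cvgr_gt _ H).
have a0 : 0 < 1 - alpha by rewrite subr_gt0.
rewrite /rad.
have -> : u = (u `^ (1 - alpha)) `^ (1 - alpha)^-1.
  by rewrite -powRrM mulfV ?gt_eqF// powRr1.
rewrite ge0_ler_powR ?nnegrE ?powR_ge0 ?invr_ge0 ?(ltW a0) ?(ltW (q_gt0 tn))//.
rewrite ler_pdivlMr ?mulr_gt0// mulrA [_ * y]mulrC.
by rewrite -subr_ge0 ltW.
Unshelve. all: by end_near. Qed.

Let ray_pi u : ray u pi = expR (- y * u) * pollard_kernel alpha u.
Proof.
rewrite /ray /pollard_kernel /phase [alpha * pi]mulrC.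
set w := u `^ alpha; set sa := sin (pi * alpha); set ca := cos (pi * alpha).
have -> : pi + (y * u * sin pi - w * sa) = - (w * sa) + pi by rewrite sinpi; ring.
rewrite sinDpi sinN opprK cospi sub0r sinN.
have -> : y * u * -1 - w * ca = - y * u + - w * ca by ring.
by rewrite expRD; ring.
Qed.

(** The segments at the angles pi - e n grow without bound. Extended by 0, their integrands live on
    one domain, have the common majorant [g] and converge to Pollard's integrand. *)
Let J_cvg_pi : J (pi - e n) @[n --> \oo] --> pi * stable_density alpha y.
Proof.
rewrite pollard//.
under eq_Rintegral do rewrite -ray_pi.
pose f n u := (ray ^~ (pi - e n) \_ `[0, rad (pi - e n)]) u.
have fle n u : 0 < u -> `|f n u| <= g u.
  move=> u0; rewrite /f patchE; case: ifPn => _; first exact/ray_le/ltW.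
  by rewrite normr0 /g !mulr_ge0 ?powR_ge0 ?expR_ge0.
have sub n : `[0, rad (pi - e n)] `<=` `[(0 : R), +oo[.
  by move=> x /=; rewrite !in_itv/= andbT => /andP[].
have mf n : measurable_fun `](0 : R), +oo[ (f n).
  apply/measurable_restrict => //.
  apply: (@measurable_funS _ _ _ _ `[0, rad (pi - e n)]) => //.
  by apply: subspace_continuous_measurable_fun => //; exact: ray_cont_u.
have fi n : mu.-integrable `](0 : R), +oo[ (EFin \o f n).
  apply: le_integrable_EFin g_int => //; first exact: mf.
  by move=> x; rewrite /= in_itv/= andbT => /fle.
have JfE n : J (pi - e n) = \int[mu]_(u in `]0, +oo[) f n u.
  have [i1 ->] := JE (pie_in n).
  rewrite -(Rintegral_mkcondr mu `](0 : R), +oo[%classic `[0, rad (pi - e n)]%classic).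
  have -> : `](0 : R), +oo[ `&` `[0, rad (pi - e n)] = `]0, rad (pi - e n)]%classic.
    apply/seteqP; split => x /=; rewrite !in_itv/= ?andbT.
      by move=> [-> /andP[]].
    by move=> /andP[x0 ->]; rewrite x0 (ltW x0).
  rewrite Rintegral_itv_obnd_cbnd//.
  apply: integrableS i1 => //.
  by apply: subset_itvr; rewrite bnd_simp.
suff : (\int[mu]_(u in `]0%R, +oo[) (f n u)%:E @[n --> \oo] -->
    \int[mu]_(u in `]0%R, +oo[) (ray u pi)%:E)%E.
  have iray : mu.-integrable `](0 : R), +oo[ (EFin \o (ray ^~ pi)).
    have -> : ray ^~ pi = fun u => expR (- y * u) * pollard_kernel alpha u.
      by apply/funext => u; exact: ray_pi.
    exact: pollard_integrable.
  rewrite integrable_EFin_Rintegral//.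
  under eq_cvg => n do rewrite integrable_EFin_Rintegral// -JfE.
  by move/fine_cvgP => [].
apply: (@dominated_cvg _ _ _ mu _ _ _ _ (EFin \o g)) => //.
- by move=> n; have /integrableP[] := fi n.
- move=> u; rewrite /= in_itv/= andbT => u0; apply: cvg_EFin; first exact: nearW.
  have pe : pi - e n @[n --> \oo] --> (pi : R).
    by rewrite -[X in _ --> X]subr0; apply: cvgB; [exact: cvg_cst|exact: e_cvg].
  have rc : {for pi, continuous (ray u)}.
    by apply: has_derive_continuous; rewrite /ray; repeat derive_step.
  have H : ray u (pi - e n) @[n --> \oo] --> ray u pi by exact: (cvg_comp _ _ pe rc).
  apply: cvg_trans H; apply: near_eq_cvg; near=> n.
  rewrite /comp /f patchE ifT// inE/= in_itv/= (ltW u0)/=.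
  by near: n; exact: rad_cvg (ltW u0).
- by move=> n u; rewrite /= in_itv/= andbT => u0; rewrite lee_fin fle.
Unshelve. all: by end_near. Qed.

Lemma scaled_zolotarev_continuous t : 0 < t < pi -> {for t, continuous v}.
Proof.
move=> tpi; have st := sin_pos tpi; have sat := sin_pos_mul alpha_gt0 alpha_lt1 tpi.
have q0 : 0 < sin (alpha * t) / sin t by rewrite divr_gt0.
by apply: has_derive_continuous; rewrite /scaled_zolotarev /zolotarev; repeat derive_step.
Qed.

(** [J] runs from 0 at the angle 0 to pi f(y) at the angle pi, with derivative (beta/y) v e^(-v);
    the sign of this derivative gives integrability. *)
Lemma zolotarev_representation :
  mu.-integrable `](0 : R), pi[ (EFin \o (fun t => v t * expR (- v t))) /\
  stable_density alpha y = beta / (pi * y) * \int[mu]_(t in `]0, pi[) (v t * expR (- v t)).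
Proof.
pose k t := beta / y * (v t * expR (- v t)).
have b0 : 0 < beta by rewrite divr_gt0// subr_gt0.
have by0 : beta / y != 0 by rewrite gt_eqF// divr_gt0.
have [||||||||| ki kE] := @Rintegral_oo_FTC _ k J 0 pi 0 (pi * stable_density alpha y) e.
- exact: e_gt0.
- by move=> n; rewrite add0r; have := e_le n; have := pi_ge2; lra.
- by move=> n m nm; rewrite lef_pV2 ?posrE// ler_nat.
- exact: e_cvg.
- move=> t tpi; apply: mulr_ge0; first by rewrite ltW// divr_gt0.
  apply: mulr_ge0; last exact: expR_ge0.
  apply: mulr_ge0; last exact: powR_ge0.
  by have [a0 a00 /(_ _ tpi)] := zolotarev_ge; apply: le_trans; exact: ltW.
- move=> t tpi; rewrite /k; apply: cvgM; first exact: cvg_cst.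
  apply: cvgM; first exact: scaled_zolotarev_continuous.
  apply: (@cvg_comp _ _ _ (fun t => - v t) expR); last exact: continuous_expR.
  by apply: cvgN; exact: scaled_zolotarev_continuous.
- by move=> t tpi; rewrite /k -Q1E//; exact: J_derive.
- exact: J_cvg0.
- exact: J_cvg_pi.
have vi : mu.-integrable `](0 : R), pi[ (EFin \o (fun t => v t * expR (- v t))).
  have := integrableZl_itv (beta / y)^-1 ki; rewrite /k.
  by congr (_.-integrable _ _); apply/funext => t; rewrite /= mulKf.
split => //.
move: kE; rewrite /k RintegralZl// subr0 => E.
rewrite invfM mulrCA -mulrA E mulrA mulVf ?mul1r// gt_eqF ?pi_gt0//.
Qed.

End fixed_y.
End contour.

(** * Pointwise estimates of the stable density *)

Section kernel.
Context {R : realType} (b : R).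
Context (b0 : 0 < b).
Implicit Types (Z x y m : R).

Let vv Z y := Z * y `^ (- b).

(* The integrand of the Zolotarev representation, with [Z] standing for
   [zolotarev t]. *)
Definition zkernel Z y := vv Z y * expR (- vv Z y) / y.

Definition zkernel1 Z y := - (vv Z y * expR (- vv Z y) / y ^+ 2) * (1 + b * (1 - vv Z y)).

Let k2 Z y := vv Z y * expR (- vv Z y) / y ^+ 3 *
  (b * ((1 + b * (1 - vv Z y)) * (1 - vv Z y) - b * vv Z y) + 2 * (1 + b * (1 - vv Z y))).

Let vv_derive Z y : 0 < y -> has_derive (vv Z) y (- b * vv Z y / y).
Proof.
move=> y0; rewrite /vv; derive.
rewrite powRB ?(gt_eqF y0) ?implybT// powRr1 ?ltW//.
by field; rewrite gt_eqF.
Qed.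

Let k_derive Z y : 0 < y -> has_derive (zkernel Z) y (zkernel1 Z y).
Proof.
move=> y0; have dv := vv_derive Z y0.
rewrite /zkernel; derive.
by rewrite /zkernel1; move: (vv Z y) (expR _) => v e; field; rewrite gt_eqF.
Qed.

Let k1_derive Z y : 0 < y -> has_derive (zkernel1 Z) y (k2 Z y).
Proof.
move=> y0; have dv := vv_derive Z y0; have y2 : 0 < y ^+ 2 by rewrite exprn_gt0.
rewrite /zkernel1; derive.
by rewrite /k2; move: (vv Z y) (expR _) => v e; field; rewrite gt_eqF.
Qed.

(** By 1 + x <= 4 e^(x/4), half of the exponent pays for the polynomial factors that differentiation
    produces. *)
Let sqr_exp x : 0 <= x -> (1 + x) ^+ 2 * expR (- x) <= 16 * expR (- x / 2).
Proof.
move=> x0.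
have h : 1 + x <= 4 * expR (x / 4).
  have := expR_ge1Dx (x / 4); lra.
have -> : 16 * expR (- x / 2) = (4 * expR (x / 4)) ^+ 2 * expR (- x).
  rewrite exprMn -expRM_natl -[RHS]mulrA -expRD; congr (_ * expR _); first by ring.
  by field.
by rewrite ler_wpM2r ?expR_ge0// lerXn2r ?nnegrE ?mulr_ge0 ?addr_ge0 ?expR_ge0.
Qed.

Let vv_ge0 Z y : 0 <= Z -> 0 <= vv Z y.
Proof. by move=> Z0; rewrite mulr_ge0 ?powR_ge0. Qed.

Lemma zkernel1_le Z y : 0 <= Z -> 0 < y ->
  `|zkernel1 Z y| <= 16 * (1 + b) * (vv Z y * expR (- vv Z y / 2)) / y ^+ 2.
Proof.
move=> Z0 y0; have := vv_ge0 y Z0; rewrite /zkernel1; move: (vv Z y) => v v0.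
have y2 : 0 < y ^+ 2 by rewrite exprn_gt0.
have h0 : 0 <= v * expR (- v) / y ^+ 2 by rewrite divr_ge0 ?(ltW y2)// mulr_ge0 ?expR_ge0.
rewrite normrM normrN (ger0_norm h0).
have h1 : `|1 + b * (1 - v)| <= (1 + b) * (1 + v) ^+ 2.
  have hb : 0 < b by exact: b0.
  have v2 : 0 <= v ^+ 2 by exact: sqr_ge0.
  have bv : 0 <= b * v by rewrite mulr_ge0 ?(ltW b0).
  have bvv : 0 <= b * v ^+ 2 by rewrite mulr_ge0 ?(ltW b0).
  rewrite (_ : 1 + b * (1 - v) = 1 + b - b * v); last by ring.
  rewrite (_ : _ * _ ^+ 2 = 1 + 2 * v + v ^+ 2 + b + 2 * (b * v) + b * v ^+ 2); last by ring.
  rewrite ler_norml; move: (v ^+ 2) (b * v) (b * v ^+ 2) bv bvv v2 => *.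
  by apply/andP; split; lra.
apply: (le_trans (ler_wpM2l h0 h1)).
have h2 := sqr_exp v0.
have -> : v * expR (- v) / y ^+ 2 * ((1 + b) * (1 + v) ^+ 2) =
  (1 + b) * v / y ^+ 2 * ((1 + v) ^+ 2 * expR (- v)) by move: (expR _) => e; ring.
have -> : 16 * (1 + b) * (v * expR (- v / 2)) / y ^+ 2 =
  (1 + b) * v / y ^+ 2 * (16 * expR (- v / 2)) by move: (expR _) => e; ring.
rewrite ler_wpM2l// mulr_ge0 ?invr_ge0 ?(ltW y2)// mulr_ge0// addr_ge0//; exact: ltW b0.
Qed.

Let k2_le Z y : 0 <= Z -> 0 < y ->
  `|k2 Z y| <= 80 * (1 + b) ^+ 2 * (vv Z y * expR (- vv Z y / 2)) / y ^+ 3.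
Proof.
move=> Z0 y0; have := vv_ge0 y Z0; rewrite /k2; move: (vv Z y) => v v0.
have y3 : 0 < y ^+ 3 by rewrite exprn_gt0.
have h0 : 0 <= v * expR (- v) / y ^+ 3 by rewrite divr_ge0 ?(ltW y3)// mulr_ge0 ?expR_ge0.
rewrite normrM (ger0_norm h0).
(* Comparison of coefficients gives 5; with the 16 of [sqr_exp] this makes 80. *)
have h1 : `|b * ((1 + b * (1 - v)) * (1 - v) - b * v) + 2 * (1 + b * (1 - v))|
    <= 5 * (1 + b) ^+ 2 * (1 + v) ^+ 2.
  have e : b * ((1 + b * (1 - v)) * (1 - v) - b * v) + 2 * (1 + b * (1 - v)) =
    (2 + 3 * b + b ^+ 2) - (3 * b + 3 * b ^+ 2) * v + b ^+ 2 * v ^+ 2 by ring.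
  have bb : 0 <= b ^+ 2 by exact: sqr_ge0.
  have hb : 0 < b by exact: b0.
  have v2 : 0 <= v ^+ 2 by exact: sqr_ge0.
  have bv : 0 <= b * v by rewrite mulr_ge0 ?(ltW b0).
  have bbv : 0 <= b ^+ 2 * v by rewrite mulr_ge0.
  have bvv : 0 <= b * v ^+ 2 by rewrite mulr_ge0 ?(ltW b0).
  have bbvv : 0 <= b ^+ 2 * v ^+ 2 by rewrite mulr_ge0.
  have e2 : 5 * (1 + b) ^+ 2 * (1 + v) ^+ 2 = 5 * (1 + 2 * b + b ^+ 2 + 2 * v + 4 * (b * v) +
    2 * (b ^+ 2 * v) + v ^+ 2 + 2 * (b * v ^+ 2) + b ^+ 2 * v ^+ 2) by ring.
  rewrite e e2 (_ : (3 * b + 3 * b ^+ 2) * v = 3 * (b * v) + 3 * (b ^+ 2 * v)); last by ring.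
  rewrite ler_norml; move: (b * v) (b ^+ 2 * v) (b * v ^+ 2) (b ^+ 2 * v ^+ 2) bv bbv bvv bbvv.
  by move: (b ^+ 2) (v ^+ 2) bb v2 => *; apply/andP; split; lra.
apply: (le_trans (ler_wpM2l h0 h1)).
have h2 := sqr_exp v0.
have -> : v * expR (- v) / y ^+ 3 * (5 * (1 + b) ^+ 2 * (1 + v) ^+ 2) =
  5 * (1 + b) ^+ 2 * v / y ^+ 3 * ((1 + v) ^+ 2 * expR (- v)) by move: (expR _) => e; ring.
have -> : 80 * (1 + b) ^+ 2 * (v * expR (- v / 2)) / y ^+ 3 =
  5 * (1 + b) ^+ 2 * v / y ^+ 3 * (16 * expR (- v / 2)) by move: (expR _) => e; ring.
by rewrite ler_wpM2l// mulr_ge0 ?invr_ge0 ?(ltW y3)// mulr_ge0// mulr_ge0// sqr_ge0.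
Qed.

(** For x in [m/2, 2m] the values [vv Z x] and [vv Z m] agree up to factors 2^(-b) and 2^b, and
    1/x^3 <= 8/m^3. Hence 640 = 8 . 80, the factor 2^b, and the rate 2^(-b)/2, whose 1/2 comes from
    [k2_le]. *)
Let zkernel_taylor_cst Z m y : 0 <= Z -> 0 < m -> m / 2 <= y <= 2 * m ->
  `|zkernel Z y - zkernel Z m - (y - m) * zkernel1 Z m| <=
  640 * (1 + b) ^+ 2 * 2 `^ b * (vv Z m * expR (- (2 `^ (- b) / 2) * vv Z m)) / m ^+ 3 * (y - m) ^+ 2.
Proof.
move=> Z0 m0 yI.
apply: (taylor2 (a := m / 2) (b := 2 * m) (f2 := k2 Z)); last by rewrite in_itv.
- by move=> x; rewrite in_itv/= => /andP[x1 _]; apply: k_derive; lra.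
- by move=> x; rewrite in_itv/= => /andP[x1 _]; apply: k1_derive; lra.
- move=> x; rewrite in_itv/= => /andP[x1 x2]; have x0 : 0 < x by lra.
  apply: (le_trans (k2_le Z0 x0)).
  have xb : x `^ (- b) <= 2 `^ b * m `^ (- b).
    have -> : 2 `^ b * m `^ (- b) = (m / 2) `^ (- b).
      rewrite !powRN powRM ?invr_ge0 ?ltW// invfM mulrC; congr (_ * _).
      by rewrite -[2^-1]powR_inv1// -powRrM mulN1r powRN invrK.
    rewrite !powRN lef_pV2 ?posrE ?powR_gt0//; last by lra.
    by rewrite ge0_ler_powR ?nnegrE ?(ltW b0)//; lra.
  have xb' : 2 `^ (- b) * m `^ (- b) <= x `^ (- b).
    rewrite -powRM ?(ltW m0)// !powRN lef_pV2 ?posrE ?powR_gt0//; last by lra.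
    by rewrite ge0_ler_powR ?nnegrE ?(ltW b0)//; lra.
  have v1 : vv Z x <= 2 `^ b * vv Z m by rewrite /vv mulrCA ler_wpM2l.
  have v2 : 2 `^ (- b) * vv Z m <= vv Z x by rewrite /vv mulrCA ler_wpM2l.
  have vx := vv_ge0 x Z0; have vm := vv_ge0 m Z0.
  have e1 : expR (- vv Z x / 2) <= expR (- (2 `^ (- b) / 2) * vv Z m).
    by rewrite ler_expR; move: v2; move: (2 `^ (- b)) => w h; lra.
  have m3 : 0 < (m / 2) ^+ 3 by rewrite exprn_gt0// divr_gt0.
  have x3 : (x ^+ 3)^-1 <= 8 / m ^+ 3.
    have -> : 8 / m ^+ 3 = ((m / 2) ^+ 3)^-1 by field; rewrite gt_eqF.
    have h : (m / 2) ^+ 3 <= x ^+ 3.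
      by rewrite lerXn2r ?nnegrE ?(ltW x0)//; lra.
    by rewrite lef_pV2 ?posrE//; exact: exprn_gt0.
  have -> : 640 * (1 + b) ^+ 2 * 2 `^ b * (vv Z m * expR (- (2 `^ (- b) / 2) * vv Z m)) / m ^+ 3 =
    80 * (1 + b) ^+ 2 * ((2 `^ b * vv Z m) * expR (- (2 `^ (- b) / 2) * vv Z m)) * (8 / m ^+ 3).
    by move: (expR _) => e; field; rewrite gt_eqF.
  rewrite ler_pM ?invr_ge0 ?exprn_ge0 ?(ltW x0)//.
    by apply: mulr_ge0; apply: mulr_ge0 => //; exact: sqr_ge0.
  apply: ler_wpM2l; first by apply: mulr_ge0 => //; exact: sqr_ge0.
  by apply: ler_pM => //; exact: expR_ge0.
- by rewrite in_itv/=; apply/andP; split; lra.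
Qed.

Lemma zkernel_taylor : exists2 K : R, 0 < K & forall Z m y,
  0 <= Z -> 0 < m -> m / 2 <= y <= 2 * m ->
  `|zkernel Z y - zkernel Z m - (y - m) * zkernel1 Z m| <=
  K * (Z * m `^ (- b) * expR (- (2 `^ (- b) / 2) * (Z * m `^ (- b)))) / m ^+ 3 * (y - m) ^+ 2.
Proof.
exists (640 * (1 + b) ^+ 2 * 2 `^ b) => [|Z m y Z0 m0 yI]; last exact: zkernel_taylor_cst.
apply: mulr_gt0; last exact: powR_gt0.
by apply: mulr_gt0; [rewrite ltr0n|rewrite exprn_gt0// addr_gt0].
Qed.

End kernel.

(** * Bounds for the density and for its affine approximation *)

Section density_estimates.
Context {R : realType} (alpha : R).
Context (alpha_gt0 : 0 < alpha) (alpha_lt1 : alpha < 1).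
Notation mu := (@lebesgue_measure R).
Implicit Types (t y m th : R).
Local Notation f := (stable_density alpha).
Local Notation beta := (dual_index alpha).
Local Notation v := (scaled_zolotarev alpha).

Let beta_gt0 : 0 < beta.
Proof. by rewrite divr_gt0// subr_gt0. Qed.

Let zol_gt0 t : 0 < t < pi -> 0 < zolotarev alpha t.
Proof. by have [a0 a00 H] := zolotarev_ge alpha_gt0 alpha_lt1; move=> /H; exact: lt_le_trans. Qed.

Let v_gt0 y t : 0 < y -> 0 < t < pi -> 0 < v y t.
Proof. by move=> y0 tpi; rewrite mulr_gt0 ?zol_gt0 ?powR_gt0. Qed.

Let S th y := \int[mu]_(t in `]0, pi[) (v y t * expR (- th * v y t)).

(** As v is homogeneous of degree -beta in y, replacing y by th^(-1/beta) y multiplies it by th.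
    These integrals are therefore values of f at rescaled points, and a bound on f bounds them
    all. *)
Let S_E th y : 0 < th -> 0 < y ->
  mu.-integrable `](0 : R), pi[ (EFin \o (fun t => v y t * expR (- th * v y t))) /\
  S th y = th^-1 * (pi * (th `^ (- beta^-1) * y) / beta * f (th `^ (- beta^-1) * y)).
Proof.
move=> th0 y0; set c := th `^ (- beta^-1).
have c0 : 0 < c by rewrite powR_gt0.
have cy0 : 0 < c * y by rewrite mulr_gt0.
have vE t : v (c * y) t = th * v y t.
  rewrite /scaled_zolotarev powRM ?ltW// -powRrM.
  have -> : - beta^-1 * - beta = 1 by field; rewrite gt_eqF.
  by rewrite powRr1 ?ltW//; ring.
have [i1 E] := zolotarev_representation alpha_gt0 alpha_lt1 cy0.
have i2 := integrableZl_itv th^-1 i1.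
have fE : (fun t => v y t * expR (- th * v y t)) =
    (fun t => th^-1 * (v (c * y) t * expR (- v (c * y) t))).
  by apply/funext => t; rewrite vE -mulrA mulKf ?gt_eqF// mulNr.
rewrite /S fE; split; first exact: i2.
rewrite RintegralZl// E; congr (_ * _).
move: (\int[_]_(_ in _) _) => I; move: (@pi R) (@pi_gt0 R) => P P0; field.
by rewrite (gt_eqF beta_gt0) (gt_eqF c0) (gt_eqF y0) (gt_eqF P0).
Qed.

Let S_ge0 th y : 0 < y -> 0 <= S th y.
Proof.
move=> y0; apply: Rintegral_ge0 => t; rewrite /= in_itv/= => tpi.
by rewrite mulr_ge0 ?expR_ge0// ltW// v_gt0.
Qed.

Let f_S y : 0 < y -> f y = beta / (pi * y) * S 1 y.
Proof.
move=> y0; have [_ ->] := zolotarev_representation alpha_gt0 alpha_lt1 y0.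
by congr (_ * _); apply: eq_Rintegral => t _; rewrite mulN1r.
Qed.

Let f_ge0 y : 0 < y -> 0 <= f y.
Proof.
move=> y0; rewrite f_S// mulr_ge0 ?S_ge0// divr_ge0 ?(ltW beta_gt0)//.
by rewrite mulr_ge0 ?pi_ge0 ?(ltW y0).
Qed.

Let S_le_pi y : 0 < y -> S 1 y <= pi.
Proof.
move=> y0; have [i1 _] := S_E ltr01 y0.
have -> : pi = \int[mu]_(t in `]0, (pi : R)[) 1.
  by rewrite Rintegral_cst//= lebesgue_measure_itv/= lte_fin pi_gt0 mul1r oppr0 addr0.
apply: le_Rintegral => //.
  apply: (@integrableS _ _ _ mu `[0, pi]) => //; first exact: subset_itv_oo_cc.
  by apply: segment_integrable; exact: within_continuous_const.
move=> t _; rewrite mulN1r expRN ler_pdivrMr ?expR_gt0// mul1r.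
by apply: le_trans (expR_ge1Dx _); rewrite lerDr.
Qed.

Let Gamma_gt0 : 0 < Gamma (alpha + 1).
Proof.
have -> : Gamma (alpha + 1) = \int[mu]_(t in `]0, +oo[) (t `^ alpha * expR (- 1 * t)).
  by rewrite /Gamma addrK; apply: eq_Rintegral => t _; rewrite mulN1r.
have i := powR_exp_integrable0 (ltW alpha_gt0) (@ltr01 R).
have e2 : 0 < expR (- 2) :> R by exact: expR_gt0.
have i2 : mu.-integrable `[(1 : R), 2] (EFin \o (fun t => t `^ alpha * expR (- 1 * t))).
  apply: integrableS i => //; move=> t /=; rewrite !in_itv/= andbT => /andP[t1 _].
  exact: lt_le_trans t1.
apply: (@lt_le_trans _ _ (\int[mu]_(t in `[(1 : R), 2]) expR (- 2))).
  rewrite Rintegral_cst//= lebesgue_measure_itv/= lte_fin ltr1n -EFinD/= mulr_gt0//.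
apply: (@le_trans _ _ (\int[mu]_(t in `[(1 : R), 2]) (t `^ alpha * expR (- 1 * t)))).
  apply: le_Rintegral => //.
    by apply: segment_integrable; exact: within_continuous_const.
  move=> t /=; rewrite in_itv/= => /andP[t1 t2].
  rewrite -[leLHS]mul1r ler_pM ?expR_ge0//; last by rewrite ler_expR; lra.
  have : 1 `^ alpha <= t `^ alpha by rewrite ge0_ler_powR ?nnegrE ?(ltW alpha_gt0)//; lra.
  by rewrite powR1.
rewrite -lee_fin -!integrable_EFin_Rintegral//.
apply: ge0_subset_integral => //.
- exact: measurable_int i.
- by move=> t _; rewrite lee_fin mulr_ge0 ?powR_ge0 ?expR_ge0.
- move=> t /=; rewrite !in_itv/= andbT => /andP[t1 _]; exact: lt_le_trans t1.
Qed.

Let sin_gt0 : 0 < sin (pi * alpha).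
Proof. by apply: sin_gt0_pi; rewrite mulr_gt0 ?pi_gt0//= gtr_pMr ?pi_gt0. Qed.

Let v_cont y (A : set R) : 0 < y -> A `<=` `]0, pi[ -> {within A, continuous (v y)}.
Proof.
move=> y0 sub; apply: continuous_in_subspaceT => t /set_mem/sub; rewrite /= in_itv/=.
exact: scaled_zolotarev_continuous.
Qed.

Let S_gt0 y : 0 < y -> 0 < S 1 y.
Proof.
move=> y0; have [i1 _] := S_E ltr01 y0.
have pi2 := @pihalf_ge1 R.
have sub : `[(2^-1 : R), 1] `<=` `]0, pi[.
  move=> t; rewrite /= !in_itv/= => /andP[h1 h2].
  by apply/andP; split; [exact: lt_le_trans h1|lra].
have cv := v_cont y0 sub.
have cg : {within `[2^-1, 1], continuous (fun t => v y t * expR (- 1 * v y t))}.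
  by repeat wcont_step.
have h21 : 2^-1 <= 1 :> R by lra.
have [x xI xmin] := EVT_min h21 cg.
have x0pi : 0 < x < pi by have := sub x xI; rewrite /= in_itv.
set g0 := v y x * _ in xmin; have g00 : 0 < g0 by rewrite mulr_gt0 ?expR_gt0 ?v_gt0.
apply: (@lt_le_trans _ _ (\int[mu]_(t in `[(2^-1 : R), 1]) g0)).
  rewrite Rintegral_cst//= lebesgue_measure_itv/= lte_fin ifT; last by lra.
  by rewrite -EFinD/= mulr_gt0// subr_gt0; lra.
apply: (@le_trans _ _ (\int[mu]_(t in `[(2^-1 : R), 1]) (v y t * expR (- 1 * v y t)))).
  apply: le_Rintegral => //; apply: segment_integrable => //.
  exact: within_continuous_const.
have i2 := segment_integrable cg.
rewrite -lee_fin /S -!integrable_EFin_Rintegral//.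
apply: ge0_subset_integral => //.
- exact: measurable_int i1.
- by move=> t; rewrite /= in_itv/= => tpi; rewrite lee_fin mulr_ge0 ?expR_ge0// ltW// v_gt0.
Qed.

Lemma stable_density_lower : exists k Y : R, [/\ 0 < k, 0 < Y &
  forall y, Y <= y -> k * y `^ (- (1 + alpha)) <= f y].
Proof.
have [C C0 HC] := stable_density_tail alpha_gt0 alpha_lt1.
pose s := sin (pi * alpha) * Gamma (alpha + 1).
have s0 : 0 < s by rewrite mulr_gt0.
(* Beyond Y the error of the tail expansion is at most half of its leading term. *)
pose Y := Num.max 1 ((2 * C / s) `^ alpha^-1).
exists (s / (2 * pi)), Y; split.
- by rewrite divr_gt0// mulr_gt0 ?pi_gt0.
- by rewrite lt_max ltr01.
move=> y; rewrite ge_max => /andP[y1 yY].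
have y0 : 0 < y by rewrite (lt_le_trans _ y1).
have ya : 2 * C / s <= y `^ alpha.
  have -> : 2 * C / s = ((2 * C / s) `^ alpha^-1) `^ alpha.
    rewrite -powRrM mulVf ?gt_eqF// powRr1// divr_ge0 ?(ltW s0)// mulr_ge0 ?(ltW C0)//.
  by rewrite ge0_ler_powR ?nnegrE ?powR_ge0 ?(ltW alpha_gt0) ?(ltW y0).
have p0 : 0 < y `^ (alpha + 1) by rewrite powR_gt0.
have q0 : 0 < y `^ alpha by rewrite powR_gt0.
have E : y `^ (alpha * 2 + 1) = y `^ alpha * y `^ (alpha + 1).
  rewrite -powRD ?(gt_eqF y0) ?implybT//; congr (_ `^ _); ring.
have := HC y y1; rewrite -/s E ler_norml => /andP[h _].
have h2 : C / (y `^ alpha * y `^ (alpha + 1)) <= s / 2 / y `^ (alpha + 1).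
  rewrite invfM mulrA ler_wpM2r ?invr_ge0 ?(ltW p0)// ler_pdivrMr//.
  move: ya; rewrite ler_pdivrMr// => ya; lra.
rewrite -(@ler_pM2l _ pi) ?pi_gt0// powRN [1 + alpha]addrC.
have -> : pi * (s / (2 * pi) / y `^ (alpha + 1)) = s / 2 / y `^ (alpha + 1).
  by move: (@pi R) (@pi_gt0 R) => P P0; field; rewrite (gt_eqF p0) (gt_eqF P0).
rewrite (_ : s / y `^ (alpha + 1) = s / 2 / y `^ (alpha + 1) + s / 2 / y `^ (alpha + 1)) in h; last by field; rewrite gt_eqF.
move: (pi * f y) (s / 2 / _) (C / _) h h2 => *; lra.
Qed.

(** For y >= 1 this is the tail expansion. For y <= 1 the inequality v e^(-v) <= 1 gives f(y) <=
    beta / y, and 1/y <= y^(-(1+alpha)). *)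
Let f_upper : exists2 C : R, 0 < C & forall y, 0 < y -> f y <= C * y `^ (- (1 + alpha)).
Proof.
have [C C0 HC] := stable_density_tail alpha_gt0 alpha_lt1.
pose s := sin (pi * alpha) * Gamma (alpha + 1).
have s0 : 0 < s by rewrite mulr_gt0.
exists ((s + C) / pi + beta) => [|y y0].
  by rewrite addr_gt0// divr_gt0 ?pi_gt0// addr_gt0.
have p0 : 0 < y `^ (alpha + 1) by rewrite powR_gt0.
rewrite powRN [1 + alpha]addrC mulrDl.
have pq0 : 0 < (s + C) / pi by rewrite divr_gt0 ?pi_gt0// addr_gt0.
have [y1|/ltW y1] := leP 1 y; last first.
  apply: (@le_trans _ _ (beta * (y `^ (alpha + 1))^-1)); last first.
    by rewrite lerDr divr_ge0 ?(ltW p0)// ltW.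
  apply: (@le_trans _ _ (beta * y^-1)).
    have -> : beta * y^-1 = beta / (pi * y) * pi.
      by move: (@pi R) (@pi_gt0 R) => P P0; field; rewrite (gt_eqF y0) (gt_eqF P0).
    rewrite f_S// ler_wpM2l ?S_le_pi// divr_ge0 ?(ltW beta_gt0)//.
    by rewrite mulr_ge0 ?pi_ge0 ?(ltW y0).
  rewrite ler_pM2l// lef_pV2 ?posrE//.
  by rewrite -[leRHS](powRr1 (ltW y0)) ger_powR ?y0// lerDr ltW.
apply: (@le_trans _ _ ((s + C) / pi * (y `^ (alpha + 1))^-1)); last first.
  by rewrite lerDl divr_ge0 ?(ltW p0)// ltW.
have := HC y y1; rewrite -/s ler_norml => /andP[_ h].
have h2 : C / y `^ (alpha * 2 + 1) <= C / y `^ (alpha + 1).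
  rewrite ler_pM2l// lef_pV2 ?posrE ?powR_gt0// ler_powR// lerD2r.
  by rewrite ler_peMr ?(ltW alpha_gt0)// ler1n.
rewrite -(@ler_pM2l _ pi) ?pi_gt0//.
have -> : pi * ((s + C) / pi / y `^ (alpha + 1)) = s / y `^ (alpha + 1) + C / y `^ (alpha + 1).
  by move: (@pi R) (@pi_gt0 R) => P P0; field; rewrite (gt_eqF p0) (gt_eqF P0).
move: (pi * f y) (s / _) (C / y `^ (alpha * 2 + 1)) (C / y `^ (alpha + 1)) h h2 => *; lra.
Qed.

(** The H of the overview, whose rate c is fixed in [stable_density_estimates]. *)
Definition majorant c y := y `^ (- (1 + alpha)) * expR (- c * y `^ (- beta)).

Let S_upper th : 0 < th -> exists2 C : R, 0 < C & forall y, 0 < y -> S th y <= C * y `^ (- alpha).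
Proof.
move=> th0; have [C C0 HC] := f_upper; pose c := th `^ (- beta^-1).
have c0 : 0 < c by rewrite powR_gt0.
have bpi : 0 < pi / beta by rewrite divr_gt0 ?pi_gt0.
exists (th^-1 * (pi / beta) * C * c `^ (- alpha)) => [|y y0].
  by rewrite !mulr_gt0 ?invr_gt0 ?powR_gt0 ?pi_gt0.
have [_ ->] := S_E th0 y0; rewrite -/c.
have cy0 : 0 < c * y by rewrite mulr_gt0.
have -> : th^-1 * (pi / beta) * C * c `^ (- alpha) * y `^ (- alpha) =
    th^-1 * (pi * (c * y) / beta * (C * (c * y) `^ (- (1 + alpha)))).
  have -> : - alpha = - (1 + alpha) + 1 by ring.
  rewrite !powRD ?(gt_eqF c0) ?(gt_eqF y0) ?implybT// !powRr1 ?(ltW c0) ?(ltW y0)//.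
  rewrite powRM ?(ltW c0) ?(ltW y0)//.
  move: (_ `^ _) (_ `^ _) => w w'; rewrite mulrACA.
  by ring.
rewrite ler_wpM2l ?invr_ge0 ?(ltW th0)// ler_wpM2l ?HC//.
by rewrite mulrAC mulr_ge0 ?(ltW bpi) ?(ltW cy0).
Qed.

(** The exponential rate in the remainder bound of [zkernel_taylor]. It is the smallest of the rates
    1, 1/2 and th0 that occur, and so determines H. *)
Let th0 : R := 2 `^ (- beta) / 2.

Let th0_gt0 : 0 < th0. Proof. by rewrite divr_gt0// powR_gt0. Qed.

Let th0_le : th0 <= 2^-1.
Proof.
rewrite ler_piMl// powRN invf_le1 ?powR_gt0//.
have : (2 : R) `^ 0 <= 2 `^ beta by rewrite ler_powR ?ler1n// ltW.
by rewrite powRr0.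
Qed.

Lemma stable_density_estimates : exists c K : R, [/\ 0 < c, 0 < K,
  forall y, 0 < y -> 0 < f y <= K * majorant c y &
  forall m, 0 < m -> exists2 d : R, `|d| <= K * majorant c m / m &
    forall y, 0 < y -> `|f y - f m - (y - m) * d| <=
      K * (y - m) ^+ 2 / m ^+ 2 * (f y + majorant c m)].
Proof.
have [a0 a00 Ha0] := zolotarev_ge alpha_gt0 alpha_lt1.
have th2 : 0 < th0 / 2 by rewrite divr_gt0.
have [C C0 HC] := S_upper th2.
(* The rate th0 is halved: with v >= a0 y^(-beta) one half produces the exponential factor of H, and
   the other keeps an integral that [S_upper] bounds by a power of y. *)
pose c := th0 / 2 * a0; have c0 : 0 < c by rewrite mulr_gt0.
pose H := majorant c.
have H0 y : 0 < y -> 0 < H y by move=> y0; rewrite mulr_gt0 ?powR_gt0 ?expR_gt0.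
have SH th y : th0 <= th -> 0 < y -> S th y <= C * y * H y.
  move=> thth y0.
  have [i1 _] := S_E (lt_le_trans th0_gt0 thth) y0.
  have [i2 _] := S_E th2 y0.
  have -> : C * y * H y = expR (- c * y `^ (- beta)) * (C * y `^ (- alpha)).
    rewrite /H /majorant (_ : - alpha = - (1 + alpha) + 1); last by ring.
    by rewrite powRD ?(gt_eqF y0) ?implybT// powRr1 ?(ltW y0)//; move: (expR _) => e; ring.
  apply: le_trans (ler_wpM2l (expR_ge0 _) (HC y y0)).
  rewrite -RintegralZl//; apply: le_Rintegral => //; first exact: integrableZl_itv.
  move=> t; rewrite /= in_itv/= => tpi.
  rewrite [leRHS]mulrCA -expRD ler_wpM2l ?(ltW (v_gt0 y0 tpi))// ler_expR.
  have h1 : a0 * y `^ (- beta) <= v y t by rewrite ler_wpM2r ?powR_ge0 ?Ha0.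
  have h2 : th0 * v y t <= th * v y t by rewrite ler_wpM2r// ltW// v_gt0.
  have h3 : th0 / 2 * (a0 * y `^ (- beta)) <= th0 / 2 * v y t by rewrite ler_wpM2l// ltW.
  have -> : - c * y `^ (- beta) = - (th0 / 2 * (a0 * y `^ (- beta))) by rewrite /c; ring.
  rewrite (_ : th0 * v y t = th0 / 2 * v y t + th0 / 2 * v y t) in h2; last by field.
  rewrite !mulNr; move: h2 h3; move: (th0 / 2 * (_ * _)) (th0 / 2 * v y t) (th * v y t) => *; lra.
have [Kz Kz0 HKz] := zkernel_taylor beta_gt0.
have pi0 := @pi_gt0 R; have bpi : 0 < beta / pi by rewrite divr_gt0.
have fE y : 0 < y -> f y = beta / pi * \int[mu]_(t in `]0, pi[) zkernel beta (zolotarev alpha t) y.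
  move=> y0; rewrite f_S// invfM mulrA -mulrA; congr (_ * _).
  have [i1 _] := S_E ltr01 y0.
  rewrite -RintegralZl//; apply: eq_Rintegral => t _.
  by rewrite /zkernel mulN1r mulrC.
have ki y : 0 < y -> mu.-integrable `](0 : R), pi[ (EFin \o (fun t => zkernel beta (zolotarev alpha t) y)).
  move=> y0; have [i1 _] := S_E ltr01 y0.
  have := integrableZl_itv y^-1 i1; congr (_.-integrable _ _); apply/funext => t /=.
  by rewrite /zkernel mulN1r mulrC.
have half0 : 0 < 2^-1 :> R by [].
have k1le t m : 0 < t < pi -> 0 < m -> `|zkernel1 beta (zolotarev alpha t) m| <=
    16 * (1 + beta) / m ^+ 2 * (v m t * expR (- 2^-1 * v m t)).
  move=> tpi m0; have := zkernel1_le beta_gt0 (ltW (zol_gt0 tpi)) m0.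
  by move/le_trans; apply; rewrite mulrAC [- _ / 2]mulrC mulrN -mulNr.
have k1i m : 0 < m -> mu.-integrable `](0 : R), pi[ (EFin \o (fun t => zkernel1 beta (zolotarev alpha t) m)).
  move=> m0; have [i1 _] := S_E half0 m0.
  apply: le_integrable_EFin (integrableZl_itv (16 * (1 + beta) / m ^+ 2) i1) => //.
    apply: subspace_continuous_measurable_fun => //.
    have cv := v_cont m0 (@subset_refl _ `](0 : R), pi[%classic).
    have cz : {within `]0, pi[, continuous (fun t =>
        - (v m t * expR (- v m t) / m ^+ 2) * (1 + beta * (1 - v m t)))}.
      by repeat wcont_step.
    exact: cz.
  by move=> t; rewrite /= in_itv/= => tpi; exact: k1le.
pose K0 := beta / pi * C.
pose K1 := beta / pi * (16 * (1 + beta)) * C.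
pose K2 := beta / pi * Kz * C.
have b1 : 0 < 1 + beta by rewrite addr_gt0.
have K00 : 0 < K0 by rewrite mulr_gt0.
have K10 : 0 < K1 by apply: mulr_gt0 => //; apply: mulr_gt0 => //; exact: mulr_gt0.
have K20 : 0 < K2 by apply: mulr_gt0 => //; exact: mulr_gt0.
have fK0 y : 0 < y -> f y <= K0 * H y.
  move=> y0; rewrite f_S//.
  have th1 : th0 <= 1 by apply: (le_trans th0_le); rewrite invf_le1// ler1n.
  have -> : K0 * H y = beta / (pi * y) * (C * y * H y).
    by rewrite /K0; move: (@pi R) pi0 => P P0; field; rewrite (gt_eqF P0) (gt_eqF y0).
  by rewrite ler_wpM2l ?SH// divr_ge0 ?(ltW beta_gt0)// mulr_ge0 ?(ltW pi0) ?(ltW y0).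
(* One constant for all bounds: K0 serves for f, K1 for the slope d, K2 for the remainder near m,
   and 4, 4 K0 and 2 K1 for its three terms far from m. *)
exists c, (4 + 5 * K0 + 3 * K1 + K2); split => //.
- lra.
- move=> y y0; apply/andP; split.
    by rewrite f_S// mulr_gt0 ?S_gt0// divr_gt0 ?beta_gt0// mulr_gt0.
  apply: (le_trans (fK0 y y0)); rewrite -/H ler_wpM2r ?(ltW (H0 y y0))//.
  lra.
move=> m m0; rewrite -/H; have Hm := H0 m m0.
(* The value that differentiation under the integral assigns to the derivative of f at m. *)
pose d := beta / pi * \int[mu]_(t in `]0, pi[) zkernel1 beta (zolotarev alpha t) m.
have dle : `|d| <= K1 * H m / m.
  rewrite /d normrM (ger0_norm (ltW bpi)).
  have -> : K1 * H m / m = beta / pi * (16 * (1 + beta) / m ^+ 2 * (C * m * H m)).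
    by rewrite /K1; move: (@pi R) pi0 => P P0; field; rewrite (gt_eqF P0) (gt_eqF m0).
  rewrite ler_pM2l//.
  have [i1 _] := S_E half0 m0.
  apply: (@le_trans _ _ (16 * (1 + beta) / m ^+ 2 * S 2^-1 m)); last first.
    by rewrite ler_wpM2l ?SH// divr_ge0 ?exprn_ge0 ?(ltW m0)// mulr_ge0// ltW.
  rewrite /S -RintegralZl//; apply: le_normr_Rintegral_itv.
  - exact: k1i.
  - exact: integrableZl_itv.
  - by move=> t; rewrite in_itv/= => tpi; exact: k1le.
have near y : 0 < y -> m / 2 <= y <= 2 * m ->
    `|f y - f m - (y - m) * d| <= K2 * (y - m) ^+ 2 / m ^+ 2 * H m.
  move=> y0 yI; rewrite (fE y y0) (fE m m0).
  have -> : beta / pi * \int[mu]_(t in `]0, pi[) zkernel beta (zolotarev alpha t) y -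
      beta / pi * \int[mu]_(t in `]0, pi[) zkernel beta (zolotarev alpha t) m - (y - m) * d =
    beta / pi * \int[mu]_(t in `]0, pi[) (zkernel beta (zolotarev alpha t) y -
      zkernel beta (zolotarev alpha t) m - (y - m) * zkernel1 beta (zolotarev alpha t) m).
    rewrite RintegralB//; last 2 first.
    - by apply: integrableB_itv; exact: ki.
    - by apply: integrableZl_itv; exact: k1i.
    rewrite RintegralB ?RintegralZl//; [|exact: k1i|exact: ki|exact: ki].
    by rewrite /d; ring.
  rewrite normrM (ger0_norm (ltW bpi)).
  pose q := Kz / m ^+ 3 * (y - m) ^+ 2.
  have q0 : 0 <= q.
    by rewrite mulr_ge0 ?sqr_ge0// divr_ge0 ?exprn_ge0 ?(ltW m0) ?(ltW Kz0).
  have -> : K2 * (y - m) ^+ 2 / m ^+ 2 * H m = beta / pi * (q * (C * m * H m)).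
    rewrite /K2 /q; move: (@pi R) pi0 => P P0.
    by field; rewrite (gt_eqF P0) (gt_eqF m0).
  rewrite ler_pM2l//.
  have [i1 _] := S_E th0_gt0 m0.
  apply: (@le_trans _ _ (q * S th0 m)); last by rewrite ler_wpM2l ?SH.
  rewrite /S -RintegralZl//; apply: le_normr_Rintegral_itv.
  - apply: integrableB_itv; first by apply: integrableB_itv; exact: ki.
    by apply: integrableZl_itv; exact: k1i.
  - exact: integrableZl_itv.
  - move=> t; rewrite in_itv/= => tpi.
    apply: (le_trans (HKz _ _ _ (ltW (zol_gt0 tpi)) m0 yI)).
    rewrite /q /th0 le_eqVlt; apply/orP; left; apply/eqP.
    by rewrite /scaled_zolotarev; move: (expR _) => e; ring.
exists d.
  apply: (le_trans dle); rewrite -[K1 * _ / _]mulrA -[leRHS]mulrA ler_wpM2r//.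
    by rewrite divr_ge0 ?(ltW Hm) ?(ltW m0).
  lra.
move=> y y0; have fy := f_ge0 y0.
have m20 : 0 < m ^+ 2 by rewrite exprn_gt0.
have near' := near y y0.
have -> : (4 + 5 * K0 + 3 * K1 + K2) * (y - m) ^+ 2 / m ^+ 2 * (f y + H m) =
  (4 + 5 * K0 + 3 * K1 + K2) * ((y - m) ^+ 2 / m ^+ 2 * (f y + H m)).
  by move: (4 + _) (f y + _) => k w; ring.
rewrite (_ : K2 * _ / _ * _ = K2 * ((y - m) ^+ 2 / m ^+ 2 * H m)) in near'; last first.
  by move: (H m) => w; ring.
move qE : ((y - m) ^+ 2 / m ^+ 2) near' => q near'.
have q0 : 0 <= q by rewrite -qE divr_ge0 ?sqr_ge0 ?(ltW m20).
have qH : 0 <= q * H m by rewrite mulr_ge0 ?(ltW Hm).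
have qf : 0 <= q * f y by rewrite mulr_ge0.
rewrite mulrDr.
have [yI|yI] := boolP (m / 2 <= y <= 2 * m).
  apply: (le_trans (near' yI)); rewrite mulrDr -[leLHS]add0r lerD//.
    by rewrite mulr_ge0//; lra.
  by rewrite ler_wpM2r//; lra.
(* Far from m one has 4 q >= 1 and |y - m| <= 2 q m, so each term on the left is absorbed separately
   by q f(y) or q H(m). *)
have ym : m / 2 <= `|y - m|.
  move: yI; rewrite negb_and -!ltNge => /orP[h|h].
    by rewrite ler0_norm; lra.
  by rewrite ger0_norm; lra.
have q1 : 1 <= 4 * q.
  rewrite -qE mulrA ler_pdivlMr// mul1r -(real_normK (num_real (y - m))).
  have : (m / 2) ^+ 2 <= `|y - m| ^+ 2.
    by rewrite lerXn2r ?nnegrE ?divr_ge0 ?(ltW m0).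
  rewrite (_ : (m / 2) ^+ 2 = m ^+ 2 / 4); last by field.
  by move=> h; lra.
have q2 : `|y - m| <= 2 * q * m.
  have -> : 2 * q * m = 2 * `|y - m| ^+ 2 / m.
    by rewrite -qE real_normK ?num_real//; field; rewrite (gt_eqF m0).
  rewrite ler_pdivlMr// expr2 mulrA mulrC ler_wpM2r//; lra.
have t1 : `|f y - f m - (y - m) * d| <= f y + f m + `|y - m| * `|d|.
  rewrite (le_trans (ler_normB _ _))// normrM lerD2r (le_trans (ler_normB _ _))//.
  by rewrite !ger0_norm ?f_ge0.
apply: (le_trans t1).
have t2 : f y <= 4 * q * f y by rewrite ler_peMl.
have t3 : f m <= 4 * q * (K0 * H m).
  apply: (le_trans (fK0 m m0)); rewrite ler_peMl// mulr_ge0 ?(ltW K00) ?(ltW Hm)//.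
have t4 : `|y - m| * `|d| <= 2 * q * (K1 * H m).
  have -> : 2 * q * (K1 * H m) = 2 * q * m * (K1 * H m / m) by field; rewrite (gt_eqF m0).
  by rewrite ler_pM.
have -> : (4 + 5 * K0 + 3 * K1 + K2) * (q * f y + q * H m) =
   4 * (q * f y) + 4 * (K0 * (q * H m)) + 2 * (K1 * (q * H m)) +
   ((5 * K0 + 3 * K1 + K2) * (q * f y) + (4 + K0 + K1 + K2) * (q * H m)) by ring.
have r1 : 0 <= (5 * K0 + 3 * K1 + K2) * (q * f y) + (4 + K0 + K1 + K2) * (q * H m).
  have k1 : 0 <= 5 * K0 + 3 * K1 + K2 by lra.
  have k2 : 0 <= 4 + K0 + K1 + K2 by lra.
  by apply: addr_ge0; [apply: (mulr_ge0 k1)|apply: (mulr_ge0 k2)].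
apply: (@le_trans _ _ (4 * (q * f y) + 4 * (K0 * (q * H m)) + 2 * (K1 * (q * H m)))); last first.
  by rewrite lerDl.
apply: lerD; first apply: lerD.
- by rewrite mulrA.
- by apply: (le_trans t3); rewrite le_eqVlt; apply/orP; left; apply/eqP; ring.
- by apply: (le_trans t4); rewrite le_eqVlt; apply/orP; left; apply/eqP; ring.
Qed.

End density_estimates.

(** * Laplace's method *)

Section laplace.
Context {R : realType}.
Notation mu := (@lebesgue_measure R).
Implicit Types (x y z t s a : R).

(** The exact value is (1/2)^(1-a) / ((1-a) z). It controls what is left of the singularity (z
    y)^(-(1+a)) after one power of z y has been spent on it. *)
Lemma powR_singular_integral a z : 0 < a -> a < 1 -> 0 < z ->
  mu.-integrable `](0 : R), (2 * z)^-1[ (EFin \o (fun y => (z * y) `^ (- a))) /\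
  \int[mu]_(y in `]0, (2 * z)^-1[) ((z * y) `^ (- a)) <= (1 - a)^-1 / z.
Proof.
move=> a0 a1 z0; pose b := (2 * z)^-1; have b0 : 0 < b by rewrite invr_gt0 mulr_gt0.
have a10 : 0 < 1 - a by rewrite subr_gt0.
pose F y := (z * y) `^ (1 - a) / ((1 - a) * z).
(* The denominators start at 3 so that e n < b - e n for every n. *)
pose e n : R := b * n.+3%:R^-1.
have e_cvg : e n @[n --> \oo] --> 0.
  rewrite -(mulr0 b); apply: cvgM; first exact: cvg_cst.
  apply: (@squeeze_cvgr _ _ _ _ (cst 0) (@harmonic R)); last exact: cvg_harmonic.
    by near=> n; rewrite /= /harmonic/= invr_ge0 ler0n lef_pV2 ?posrE ?ltr0n// ler_nat ltnW.
  exact: cvg_cst.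
have e3 n : e n <= b / 3 by rewrite ler_pM2l// lef_pV2 ?posrE// ler_nat.
have e0 n : 0 < e n by rewrite mulr_gt0// invr_gt0.
have Fcont y : 0 < y -> {for y, continuous F}.
  by move=> y0; apply: has_derive_continuous; have zy := mulr_gt0 z0 y0; rewrite /F; repeat derive_step.
have F0 : F (0 + e n) @[n --> \oo] --> 0.
  have p0 : e n `^ (1 - a) @[n --> \oo] --> 0.
    have /cvg_at_rightP := @powR_cvg0 R _ a10; apply; split => //.
  have -> : (fun n => F (0 + e n)) = (fun n => z `^ (1 - a) * e n `^ (1 - a) * ((1 - a) * z)^-1).
    by apply/funext => n; rewrite add0r /F powRM ?(ltW z0) ?(ltW (e0 n)).
  rewrite -[X in _ --> X](mul0r ((1 - a) * z)^-1) -[in X in _ --> X](mulr0 (z `^ (1 - a))).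
  by apply: cvgM; [apply: cvgM; [exact: cvg_cst|exact: p0]|exact: cvg_cst].
have Fb : F (b - e n) @[n --> \oo] --> F b.
  have be : b - e n @[n --> \oo] --> b.
    by rewrite -[X in _ --> X]subr0; apply: cvgB; [exact: cvg_cst|exact: e_cvg].
  exact: (cvg_comp _ _ be (Fcont b b0)).
have [||||||||| i E] := @Rintegral_oo_FTC _ (fun y => (z * y) `^ (- a)) F 0 b 0 (F b) e.
- exact: e0.
- by move=> n; have := e3 n; rewrite add0r; lra.
- by move=> n m nm; rewrite ler_pM2l// lef_pV2 ?posrE// ler_nat.
- exact: e_cvg.
- by move=> *; exact: powR_ge0.
- move=> y /andP[y0 _]; have zy := mulr_gt0 z0 y0.
  by apply: has_derive_continuous; repeat derive_step.
- move=> y /andP[y0 _]; have zy := mulr_gt0 z0 y0; rewrite /F; derive.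
  rewrite (_ : 1 - a - 1 = - a); last by ring.
  by field; rewrite (gt_eqF a10) (gt_eqF z0).
- exact: F0.
- exact: Fb.
split => //; rewrite E subr0 /F invfM mulrA ler_wpM2r ?invr_ge0 ?(ltW z0)//.
rewrite -[leRHS]mul1r ler_wpM2r ?invr_ge0 ?(ltW a10)//.
have -> : z * b = 2^-1 by rewrite /b; field; rewrite gt_eqF.
have : 2^-1 `^ (1 - a) <= 1 `^ (1 - a) by rewrite ge0_ler_powR ?nnegrE ?(ltW a10)// invf_le1// ler1n.
by rewrite powR1.
Unshelve. all: by end_near. Qed.

Lemma Gamma_second_moment n s z : 0 < s ->
  mu.-integrable `](0 : R), +oo[ (EFin \o (fun y => y ^+ n * expR (- s * y) * (z * y - 1) ^+ 2)) /\
  \int[mu]_(y in `]0, +oo[) (y ^+ n * expR (- s * y) * (z * y - 1) ^+ 2) =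
  n`!%:R / s ^+ n.+1 * (n.+2%:R * n.+1%:R * z ^+ 2 / s ^+ 2 - 2 * n.+1%:R * z / s + 1).
Proof.
move=> s0.
have [i0 E0] := Rintegral_exprn_expR n s0.
have [i1 E1] := Rintegral_exprn_expR n.+1 s0.
have [i2 E2] := Rintegral_exprn_expR n.+2 s0.
have fE : (fun y => y ^+ n * expR (- s * y) * (z * y - 1) ^+ 2) = (fun y =>
  z ^+ 2 * (y ^+ n.+2 * expR (- s * y)) - 2 * z * (y ^+ n.+1 * expR (- s * y)) +
  y ^+ n * expR (- s * y)).
  by apply/funext => y; rewrite !exprS; move: (expR _) (y ^+ n) => e w; ring.
have j2 := integrableZl_itv (z ^+ 2) i2.
have j1 := integrableZl_itv (2 * z) i1.
have j21 := integrableB_itv j2 j1.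
rewrite fE; split; first exact: integrableD_itv.
rewrite RintegralD// RintegralB// !RintegralZl// E0 E1 E2 !factS !natrM !exprS.
have w0 : s ^+ n != 0 by rewrite gt_eqF// exprn_gt0.
move: (n.+2%:R : R) (n.+1%:R : R) (n`!%:R : R) (s ^+ n) w0 => k k' c w w0.
by field; rewrite (gt_eqF s0) w0.
Qed.

Lemma Gamma_first_moment n s m : 0 < s ->
  mu.-integrable `](0 : R), +oo[ (EFin \o (fun y => y ^+ n * expR (- s * y) * (y - m))) /\
  \int[mu]_(y in `]0, +oo[) (y ^+ n * expR (- s * y) * (y - m)) =
  n`!%:R / s ^+ n.+1 * (n.+1%:R / s - m).
Proof.
move=> s0.
have [i0 E0] := Rintegral_exprn_expR n s0.
have [i1 E1] := Rintegral_exprn_expR n.+1 s0.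
have fE : (fun y => y ^+ n * expR (- s * y) * (y - m)) = (fun y =>
  y ^+ n.+1 * expR (- s * y) - m * (y ^+ n * expR (- s * y))).
  by apply/funext => y; rewrite !exprS; move: (expR _) (y ^+ n) => e w; ring.
have j0 := integrableZl_itv m i0.
rewrite fE; split; first exact: integrableB_itv.
rewrite RintegralB// !RintegralZl// E0 E1 !factS !natrM !exprS.
have w0 : s ^+ n != 0 by rewrite gt_eqF// exprn_gt0.
move: (n.+1%:R : R) (n`!%:R : R) (s ^+ n) w0 => k c w w0.
by field; rewrite (gt_eqF s0) w0.
Qed.

Lemma ln2_ge : 2 / 3 <= ln 2 :> R.
Proof.
have /ln1p_bounds/andP[h _] : 0 <= 1 :> R by [].
by rewrite (_ : 2 / 3 = 2 * 1 / (2 + 1) :> R)//; field.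
Qed.

(** For t <= 1/2 the weight is far from its peak at 1: ln t - t <= -1 - 1/6, by ln 2 >= 2/3. One
    factor t is set aside against the singularity, so the bound is used n - 1 times only; e^2
    compensates for that, and the gain e^(-n/6) is turned into 72 / n^2. *)
Lemma expR_sub_half_le n t : 0 < t -> t <= 2^-1 -> (0 < n)%N ->
  t ^+ n * expR (- n%:R * t) <= t * (expR 2 * 72) * expR (- n%:R) / n%:R ^+ 2.
Proof.
move=> t0 t2 n0; case: n n0 => // n _.
have h : ln t - t <= - 1 - 6^-1.
  have h1 : ln (2 * t) <= 2 * t - 1.
    have t1 : -1 < 2 * t - 1 by lra.
    by have := le_ln1Dx t1; rewrite (_ : 1 + (2 * t - 1) = 2 * t)//; ring.
  have := ln2_ge; rewrite lnM ?posrE// in h1 *.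
  by move=> h2; lra.
have e1 : t ^+ n * expR (- n%:R * t) = expR (n%:R * (ln t - t)).
  rewrite mulrBr expRD mulNr expRM_natl lnK// ?posrE//.
have N0 : 0 < n.+1%:R :> R by rewrite ltr0n.
have e2 : expR (- (n.+1%:R / 6 : R)) <= 72 / n.+1%:R ^+ 2.
  rewrite expRN -[leRHS]invrK lef_pV2 ?posrE ?invr_gt0 ?divr_gt0 ?exprn_gt0 ?expR_gt0//.
  have q0 : 0 <= n.+1%:R / 6 :> R by rewrite divr_ge0.
  apply: le_trans (expR_ge1Dxn 1 q0).
  rewrite (_ : 2`! = 2%N)// invfM invrK mulrC.
  rewrite (_ : 1 + _ = 1 + n.+1%:R ^+ 2 / 72); last by field.
  by rewrite lerDr.
have e3 : expR (- n.+1%:R * t) <= expR (- n%:R * t).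
  by rewrite ler_expR ler_wpM2r ?(ltW t0)// lerN2 ler_nat.
rewrite exprS -mulrA.
have -> : t * (expR 2 * 72) * expR (- n.+1%:R) / n.+1%:R ^+ 2 =
  t * (expR 2 * expR (- n.+1%:R) * (72 / n.+1%:R ^+ 2)).
  by move: (expR _) (expR _) => w w'; field; rewrite gt_eqF.
rewrite ler_pM2l//.
apply: le_trans (ler_wpM2l _ e2); last by rewrite mulr_ge0 ?expR_ge0.
apply: (le_trans (ler_wpM2l (exprn_ge0 n (ltW t0)) e3)).
rewrite e1 -!expRD ler_expR.
have h' := ler_wpM2l (ler0n R n) h.
by rewrite -[n.+1%:R]natr1; lra.
Qed.

End laplace.

(** * Second moment of the Gamma weight with a singular factor *)

Section laplace_weight.
Context {R : realType}.
Notation mu := (@lebesgue_measure R).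
Implicit Types (x y z t s a : R).

(** The quotient n^n / n! is a term of the series of e^n. *)
Lemma exprn_fact_le n : n%:R ^+ n * expR (- n%:R) <= n`!%:R :> R.
Proof.
case: n => [|n]; first by rewrite expr0 oppr0 expR0 mul1r.
rewrite expRN ler_pdivrMr ?expR_gt0// mulrC -ler_pdivrMr ?ltr0n ?fact_gt0//.
by apply: le_trans (expR_ge1Dxn n (ler0n R n.+1)); rewrite lerDr.
Qed.

(** The rate s is what remains of n z once exp(z y/2) has been absorbed. The shift changes the
    normalisation by (n / (n - 1/2))^(n+1) <= e^2, and the second moment (n + 13/4) / (n - 1/2)^2 is
    at most 17/n, with equality at n = 1. *)
Lemma half_shift_moment_le n z s : (0 < n)%N -> 0 < z -> s = (n%:R - 2^-1) * z ->
  n`!%:R / s ^+ n.+1 * (n.+2%:R * n.+1%:R * z ^+ 2 / s ^+ 2 - 2 * n.+1%:R * z / s + 1) <=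
  17 * expR 2 / n%:R * (n`!%:R / (n%:R * z) ^+ n.+1).
Proof.
move=> n0 z0 sE'; have n1 : 1 <= n%:R :> R by rewrite ler1n.
pose r : R := n%:R - 2^-1; have r0 : 0 < r by rewrite /r; lra.
have N0 : 0 < n%:R :> R by lra.
have sE : s = r * z by exact: sE'.
have -> : n.+2%:R * n.+1%:R * z ^+ 2 / s ^+ 2 - 2 * n.+1%:R * z / s + 1 =
    (n%:R + 13 / 4) / r ^+ 2.
  rewrite sE -[n.+2%:R]natr1 -[n.+1%:R]natr1 /r; move: r0; rewrite /r.
  move: (n%:R : R) => N r0; field; rewrite (gt_eqF z0)/=.
  by rewrite andbT gt_eqF//; lra.
have h1 : (n%:R + 13 / 4) / r ^+ 2 <= 17 / n%:R.
  rewrite ler_pdivrMr ?exprn_gt0// mulrAC ler_pdivlMr// /r.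
  by move: n1; move: (n%:R : R) => N N1; nra.
have h2 : n`!%:R / s ^+ n.+1 <= expR 2 * (n`!%:R / (n%:R * z) ^+ n.+1).
  have nr : n%:R / r <= expR (2^-1 / r).
    apply: le_trans (expR_ge1Dx _); rewrite le_eqVlt; apply/orP; left; apply/eqP.
    have {1}-> : n%:R = r + 2^-1 by rewrite subrK.
    by rewrite mulrDl divff// gt_eqF.
  have h : (n%:R / r) ^+ n.+1 <= expR 2.
    apply: (le_trans (lerXn2r n.+1 _ _ nr)); rewrite ?nnegrE ?expR_ge0//.
      by rewrite divr_ge0 ?(ltW r0).
    rewrite -expRM_natl ler_expR mulrA ler_pdivrMr// -natr1 /r.
    by move: n1; move: (n%:R : R) => N N1; lra.
  have p0 : 0 <= n`!%:R / (n%:R * z) ^+ n.+1 by rewrite divr_ge0// exprn_ge0 ?mulr_ge0 ?(ltW N0) ?(ltW z0).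
  apply: le_trans (ler_wpM2r p0 h); rewrite le_eqVlt; apply/orP; left; apply/eqP.
  have rk : r ^+ n.+1 != 0 by rewrite gt_eqF// exprn_gt0.
  have nk : (n%:R : R) ^+ n.+1 != 0 by rewrite gt_eqF// exprn_gt0.
  have zk : z ^+ n.+1 != 0 by rewrite gt_eqF// exprn_gt0.
  rewrite sE expr_div_n !exprMn; move: (_ ^+ n.+1) rk (_ ^+ n.+1) nk (_ ^+ n.+1) zk => u u0 v v0 w w0.
  by field; rewrite u0 v0 w0.
have p0 : 0 <= n`!%:R / s ^+ n.+1 by rewrite divr_ge0// exprn_ge0// sE mulr_ge0 ?(ltW r0) ?(ltW z0).
have q0 : 0 <= (n%:R + 13 / 4) / r ^+ 2 by rewrite divr_ge0 ?exprn_ge0 ?(ltW r0)//; lra.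
by apply: (le_trans (ler_pM p0 q0 h2 h1)); rewrite le_eqVlt; apply/orP; left; apply/eqP; ring.
Qed.

(** The domain is cut at z y = 1/2. Above, the singular factor is at most 2^(1+a) <= 4 and the
    shifted second moment gives 1/n; below, the weight is exponentially small in n relative to its
    peak, and only the integrable singularity (z y)^(-a) remains. *)
Lemma laplace_weight a : 0 < a -> a < 1 -> exists2 C : R, 0 < C &
  forall n z, (0 < n)%N -> 0 < z ->
  let g y := y ^+ n * expR (- (n%:R * z) * y) *
    ((z * y) `^ (- (1 + a)) * expR (z * y / 2) * (z * y - 1) ^+ 2) in
  mu.-integrable `](0 : R), +oo[ (EFin \o g) /\
  \int[mu]_(y in `]0, +oo[) g y <= C / n%:R * (n`!%:R / (n%:R * z) ^+ n.+1).
Proof.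
move=> a0 a1; have a10 : 0 < 1 - a by rewrite subr_gt0.
(* The factors e^2 and 72 come from [expR_sub_half_le]; the last one bounds exp(z y/2) for z y <=
   1/2. *)
pose C2 : R := expR 2 * 72 * expR 1.
have C20 : 0 < C2 by rewrite !mulr_gt0 ?expR_gt0.
exists (4 * (17 * expR 2) + C2 / (1 - a)).
  by rewrite addr_gt0 ?divr_gt0 ?mulr_gt0 ?expR_gt0.
move=> n z n0 z0 g.
have n1 : 1 <= n%:R :> R by rewrite ler1n.
have N0 : 0 < n%:R :> R by lra.
pose s := (n%:R - 2^-1) * z; have s0 : 0 < s by rewrite mulr_gt0//; lra.
pose g1 y := y ^+ n * expR (- s * y) * (z * y - 1) ^+ 2.
pose T := C2 * (expR (- n%:R) / n%:R ^+ 2 / z ^+ n).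
have T0 : 0 < T by rewrite mulr_gt0 ?divr_gt0 ?expR_gt0 ?exprn_gt0.
pose b := (2 * z)^-1; have b0 : 0 < b by rewrite invr_gt0 mulr_gt0.
pose g2 := (fun y => (z * y) `^ (- a)) \_ (`]0, b[ : set R).
have [i1 E1] := Gamma_second_moment n z s0.
have [i2' E2] := powR_singular_integral a0 a1 z0.
have i2 : mu.-integrable `](0 : R), +oo[ (EFin \o g2).
  exact: integrable_patch_EFin.
have E2' : \int[mu]_(y in `]0, +oo[) g2 y <= (1 - a)^-1 / z.
  rewrite -Rintegral_mkcondr; apply: le_trans E2; rewrite (_ : _ `&` _ = `]0, b[%classic)//.
  by apply/seteqP; split => [y []//|y /= yb]; split => //; move: yb; rewrite !in_itv/= andbT => /andP[].
have gle y : 0 < y -> 0 <= g y <= 4 * g1 y + T * g2 y.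
  move=> y0; have t0 := mulr_gt0 z0 y0; apply/andP; split.
    repeat first [exact: sqr_ge0|exact: expR_ge0|exact: powR_ge0|exact: exprn_ge0 (ltW y0)|apply: mulr_ge0].
  have g10 : 0 <= g1 y by repeat first [exact: sqr_ge0|exact: expR_ge0|exact: powR_ge0|exact: exprn_ge0 (ltW y0)|apply: mulr_ge0].
  have g20 : 0 <= g2 y by rewrite /g2 /patch; case: ifP => // _; exact: powR_ge0.
  have [t2|t2] := leP 2^-1 (z * y).
    have h1 : (z * y) `^ (- (1 + a)) <= 4.
      rewrite powRN -[leRHS]invrK lef_pV2 ?posrE ?powR_gt0//.
      apply: (@le_trans _ _ (2^-1 `^ (1 + a))); last by rewrite ge0_ler_powR ?nnegrE//; lra.
      apply: (@le_trans _ _ (2^-1 `^ 2%:R)); last by rewrite ger_powR//; lra.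
      by rewrite powR_mulrn// expr2; lra.
    have h2 : g y <= 4 * g1 y.
      rewrite /g /g1 (_ : - s * y = - (n%:R * z) * y + z * y / 2); last by rewrite /s; field.
      rewrite expRD; have q0 : 0 <= y ^+ n * (expR (- (n%:R * z) * y) * expR (z * y / 2)) * (z * y - 1) ^+ 2.
        by repeat first [exact: sqr_ge0|exact: expR_ge0|exact: powR_ge0|exact: exprn_ge0 (ltW y0)|apply: mulr_ge0].
      have := ler_wpM2r q0 h1; congr (_ <= _).
      by move: (expR _) (expR _) (_ `^ _) (y ^+ n) => e1 e2 p w; ring.
    by apply: (le_trans h2); rewrite lerDl mulr_ge0 ?(ltW T0).
  have -> : g2 y = (z * y) `^ (- a).
    rewrite /g2 /patch; case: ifPn => //; rewrite notin_setE/= => -[]; rewrite in_itv/= y0/=.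
    by rewrite /b -[X in _ < X]mul1r ltr_pdivlMr ?mulr_gt0//; lra.
  apply: (@le_trans _ _ (T * (z * y) `^ (- a))); last first.
    by rewrite lerDr mulr_ge0.
  have h1 := expR_sub_half_le t0 (ltW t2) n0.
  have h2 : expR (z * y / 2) <= expR 1 by rewrite ler_expR; lra.
  have h3 : (z * y - 1) ^+ 2 <= 1 by rewrite expr2; nra.
  have h4 : (z * y) `^ (- (1 + a)) = (z * y)^-1 * (z * y) `^ (- a).
    by rewrite opprD powRD ?(gt_eqF t0) ?implybT// powR_inv1 ?(ltW t0).
  have h23 : expR (z * y / 2) * (z * y - 1) ^+ 2 <= expR 1.
    by rewrite -[leRHS]mulr1 ler_pM ?expR_ge0 ?sqr_ge0.
  have A0 : 0 <= (z * y) ^+ n * expR (- n%:R * (z * y)) by rewrite mulr_ge0 ?exprn_ge0 ?expR_ge0 ?(ltW t0).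
  have B0 : 0 <= expR (z * y / 2) * (z * y - 1) ^+ 2 by rewrite mulr_ge0 ?expR_ge0 ?sqr_ge0.
  have h5 := ler_pM A0 B0 h1 h23.
  have P0 : 0 <= (z * y)^-1 * (z * y) `^ (- a) / z ^+ n.
    by rewrite !mulr_ge0 ?invr_ge0 ?exprn_ge0 ?powR_ge0 ?(ltW t0) ?(ltW z0).
  have := ler_wpM2r P0 h5; congr (_ <= _).
    rewrite /g h4 exprMn (_ : - (n%:R * z) * y = - n%:R * (z * y)); last by ring.
    have zn : z ^+ n != 0 by rewrite gt_eqF// exprn_gt0.
    move: (expR _) (expR _) (_ `^ _) (y ^+ n) (z ^+ n) zn ((_ - _) ^+ 2) => e1 e2 p w u zn q.
    by move: (z * y)^-1 => ?; field.
  rewrite /T /C2; have zn : z ^+ n != 0 by rewrite gt_eqF// exprn_gt0.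
  move: (z ^+ n) zn (z * y) t0 (expR 1) (expR 2) (expR (- n%:R)) ((z * y) `^ _) => u u0 t t0 e1 e2 e3 p.
  by field; rewrite u0 (gt_eqF t0) (gt_eqF N0).
have i12 := integrableD_itv (integrableZl_itv 4 i1) (integrableZl_itv T i2).
have gi : mu.-integrable `](0 : R), +oo[ (EFin \o g).
  apply: le_integrable_EFin i12 => //.
    apply: continuous_measurable_fun0y => y y0; apply: has_derive_continuous.
    have t0 := mulr_gt0 z0 y0; rewrite /g.
    by repeat derive_step.
  by move=> y; rewrite /= in_itv/= andbT => /gle/andP[h0 h]; rewrite ger0_norm.
split => //.
apply: (@le_trans _ _ (\int[mu]_(y in `]0, +oo[) (4 * g1 y + T * g2 y))).
  by apply: le_Rintegral => // y; rewrite /= in_itv/= andbT => /gle/andP[].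
rewrite RintegralD//; [|exact: integrableZl_itv i1|exact: integrableZl_itv i2].
rewrite !RintegralZl// E1 [leRHS](_ : _ = 4 * (17 * expR 2 / n%:R * (n`!%:R / (n%:R * z) ^+ n.+1)) +
  C2 / (1 - a) / n%:R * (n`!%:R / (n%:R * z) ^+ n.+1)); last first.
  by move: (expR 2) (n`!%:R / _) (C2 / (1 - a)) => *; ring.
rewrite lerD//.
  have h := half_shift_moment_le n0 z0 (erefl s).
  by rewrite ler_pM2l.
apply: (le_trans (ler_wpM2l (ltW T0) E2')).
have P0 : 0 <= C2 / (1 - a) / n%:R / (n%:R * z) ^+ n.+1.
  by rewrite !mulr_ge0 ?invr_ge0 ?exprn_ge0 ?mulr_ge0 ?(ltW N0) ?(ltW z0) ?(ltW a10) ?(ltW C20).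
have := ler_wpM2l P0 (exprn_fact_le n); congr (_ <= _).
  rewrite /T exprMn !exprS; have zn : z ^+ n != 0 by rewrite gt_eqF// exprn_gt0.
  have nn : (n%:R : R) ^+ n != 0 by rewrite gt_eqF// exprn_gt0.
  move: (expR _) (_ ^+ n) (_ ^+ n) zn nn => e u v u0 v0.
  by field; rewrite u0 v0 !gt_eqF.
by ring.
Qed.

End laplace_weight.

(** * The Laplace approximation for the stable density *)

Section stable_laplace.
Context {R : realType} (alpha : R).
Context (alpha_gt0 : 0 < alpha) (alpha_lt1 : alpha < 1).
Notation mu := (@lebesgue_measure R).
Local Notation f := (stable_density alpha).
Implicit Types (c y z m : R).

(** The M of the overview, with c' = min(c, 1/2); the 1/2 matches the factor exp(z y/2) conceded in
    [majorant_le]. *)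
Definition decay c z := z `^ (1 + alpha) * expR (- Num.min c 2^-1 * z `^ alpha).

Lemma decay_gt0 c z : 0 < z -> 0 < decay c z.
Proof. by move=> z0; rewrite mulr_gt0 ?powR_gt0 ?expR_gt0. Qed.

(* Either [z ^ alpha <= z * y], and the factor [expR (z * y / 2)] pays for the
   decay, or [y < z ^ (alpha - 1)], and then [z ^ alpha <= y ^ - dual_index]. *)
Lemma majorant_le c y z : 0 < c -> 0 < y -> 0 < z ->
  majorant alpha c y <= (z * y) `^ (- (1 + alpha)) * expR (z * y / 2) * decay c z.
Proof.
move=> c0 y0 z0; have a0 : 0 < alpha by exact: alpha_gt0.
have a1 : 0 < 1 - alpha by rewrite subr_gt0; exact: alpha_lt1.
have t0 := mulr_gt0 z0 y0.
have -> : (z * y) `^ (- (1 + alpha)) * expR (z * y / 2) * decay c z =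
    y `^ (- (1 + alpha)) * expR (z * y / 2 - Num.min c 2^-1 * z `^ alpha).
  rewrite /decay powRM ?(ltW y0) ?(ltW z0)// expRD mulNr.
  have h : z `^ (- (1 + alpha)) * z `^ (1 + alpha) = 1.
    by rewrite powRN mulVf// gt_eqF// powR_gt0.
  move: (z `^ (1 + alpha)) (z `^ (- _)) h => p q h.
  by rewrite -[RHS]mul1r -h; move: (y `^ _) (expR (z * y / 2)) (expR _) => *; ring.
rewrite /majorant ler_wpM2l ?powR_ge0// ler_expR.
have q0 : 0 < z `^ alpha by rewrite powR_gt0.
have [h|h] := leP (z `^ alpha) (z * y).
  have h1 : Num.min c 2^-1 * z `^ alpha <= 2^-1 * (z * y).
    by rewrite ler_pM ?(ltW q0)// ?le_min ?(ltW c0)//= ge_min lexx orbT.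
  have h2 : 0 <= c * y `^ (- dual_index alpha) by rewrite mulr_ge0 ?powR_ge0 ?(ltW c0).
  by rewrite mulNr; move: (c * _) (Num.min _ _ * _) h1 h2 => u v; lra.
have h1 : z `^ alpha <= y `^ (- dual_index alpha).
  have {}h : y <= z `^ (- (1 - alpha)).
    rewrite opprB powRD ?(gt_eqF z0) ?implybT// powR_inv1 ?(ltW z0)//.
    by rewrite ler_pdivlMr// mulrC ltW.
  have -> : z `^ alpha = (z `^ (- (1 - alpha))) `^ (- dual_index alpha).
    by rewrite -powRrM mulrNN /dual_index mulrC divfK// gt_eqF.
  rewrite 2!powRN lef_pV2 ?posrE ?powR_gt0//.
  by rewrite ge0_ler_powR ?nnegrE ?powR_ge0 ?(ltW y0)// /dual_index divr_ge0 ?(ltW a0) ?(ltW a1).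
have h2 : Num.min c 2^-1 * z `^ alpha <= c * y `^ (- dual_index alpha).
  by rewrite ler_pM ?(ltW q0)// ?le_min ?(ltW c0)//= ge_min lexx.
by rewrite mulNr; move: (c * _) (Num.min _ _ * _) h2 => u v; lra.
Qed.

Lemma majorant_inv_le c z : 0 < c -> 0 < z -> majorant alpha c z^-1 <= expR 1 * decay c z.
Proof.
move=> c0 z0; have zV : 0 < z^-1 by rewrite invr_gt0.
apply: (le_trans (majorant_le c0 zV z0)); rewrite ler_wpM2r ?(ltW (decay_gt0 _ _))//.
by rewrite divff ?gt_eqF// powR1 mul1r ler_expR; lra.
Qed.

(** The affine approximation at m has an error quadratic in y - m, with a factor f(y) + H(m) that is
    bounded on ]m/2, 2m[. This gives a Lipschitz estimate at m. *)
Lemma stable_density_continuous y : 0 < y -> {for y, continuous f}.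
Proof.
have [c [K [c0 K0 fK H]]] := stable_density_estimates alpha_gt0 alpha_lt1.
move=> m0; have [d _ Hd] := H y m0; move: y m0 d Hd => m m0 d Hd.
have H0 y : 0 < y -> 0 <= majorant alpha c y by move=> y0; rewrite mulr_ge0 ?powR_ge0 ?expR_ge0.
pose B := `|d| + K * (m / m ^+ 2) * (K * (m / 2) `^ (- (1 + alpha)) + majorant alpha c m).
have lip y : m / 2 < y -> y < 2 * m -> `|f y - f m| <= `|y - m| * B.
  move=> y1 y2; have y0 : 0 < y by lra.
  have := Hd y y0; set e := _ - (y - m) * d => he.
  have -> : f y - f m = (y - m) * d + e by rewrite /e; ring.
  apply: (le_trans (ler_normD _ _)); rewrite normrM /B mulrDr lerD2l; apply: (le_trans he).
  have ym : (y - m) ^+ 2 <= `|y - m| * m.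
    rewrite -real_normK ?num_real// expr2 ler_wpM2l// ler_norml; apply/andP; split; lra.
  have fy : f y + majorant alpha c m <= K * (m / 2) `^ (- (1 + alpha)) + majorant alpha c m.
    rewrite lerD2r; have /andP[_ h] := fK y y0; apply: (le_trans h); rewrite ler_pM2l//.
    have a0 : 0 < alpha by exact: alpha_gt0.
    rewrite /majorant -[leRHS]mulr1 ler_pM ?powR_ge0 ?expR_ge0//.
      rewrite !powRN lef_pV2 ?posrE ?powR_gt0//; last by lra.
      by rewrite ge0_ler_powR ?nnegrE//; lra.
    by rewrite -expR0 ler_expR mulNr oppr_le0 mulr_ge0 ?powR_ge0 ?(ltW c0).
  have [/andP[f0 _] h0] := (fK y y0, H0 m m0).
  rewrite -!mulrA [leRHS]mulrCA ler_pM2l//.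
  have g0 : 0 <= f y + majorant alpha c m by rewrite addr_ge0// ltW.
  have m2 : 0 <= m ^- 2 by rewrite invr_ge0 exprn_ge0 ?(ltW m0).
  have := ler_pM (mulr_ge0 (sqr_ge0 (y - m)) m2) g0 (ler_wpM2r m2 ym) fy.
  by congr (_ <= _); ring.
apply/cvgrPdist_le => eps eps0.
have B0 : 0 <= B.
  by rewrite addr_ge0// !mulr_ge0 ?invr_ge0 ?exprn_ge0 ?addr_ge0 ?mulr_ge0 ?powR_ge0 ?expR_ge0 ?(ltW K0) ?(ltW m0).
have B1 : 0 < B + 1 by lra.
near=> y.
rewrite distrC; apply: (le_trans (lip y _ _)).
- by near: y; apply: lt_nbhsr; lra.
- by near: y; apply: lt_nbhsl; lra.
have : `|y - m| < eps / (B + 1).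
  rewrite distrC; near: y; apply: (@cvgr_dist_lt _ _ _ (nbhs m) _ id m cvg_id); exact: divr_gt0.
rewrite ltr_pdivlMr// => /ltW h; apply: le_trans h; rewrite ler_wpM2l//; lra.
Unshelve. all: by end_near. Qed.

Lemma stable_laplace : exists c K : R, [/\ 0 < c, 0 < K,
  forall z, 0 < z -> 0 < f z^-1 <= K * decay c z &
  forall n z, (0 < n)%N -> 0 < z ->
    let w y := y ^+ n * expR (- (n%:R * z) * y) in
    let I0 := n`!%:R / (n%:R * z) ^+ n.+1 in
    mu.-integrable `](0 : R), +oo[ (EFin \o (fun y => w y * f y)) /\
    `|\int[mu]_(y in `]0, +oo[) (w y * f y) - I0 * f z^-1| <= K / n%:R * decay c z * I0].
Proof.
have [c [K [c0 K0 fK H]]] := stable_density_estimates alpha_gt0 alpha_lt1.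
have [C C0 HC] := laplace_weight alpha_gt0 alpha_lt1.
have E0 : 0 < expR 1 :> R by exact: expR_gt0.
(* K^2 C stems from the part f(y) of the remainder bound and 3 K e from the part H(1/z), the second
   moment being (n+2)/n^2 <= 3/n; one more K e stems from the linear term. *)
exists c, (K ^+ 2 * C + 4 * (K * expR 1)); split => //.
- by rewrite addr_gt0 ?mulr_gt0 ?exprn_gt0.
- move=> z z0; have zV : 0 < z^-1 by rewrite invr_gt0.
  have /andP[-> h] := fK _ zV; apply: (le_trans h).
  have D0 := decay_gt0 c z0.
  have := majorant_inv_le c0 z0; rewrite -(ler_pM2l K0) => /le_trans; apply.
  rewrite [leLHS]mulrA ler_pM2r//.
  have h1 : 0 < K ^+ 2 * C by rewrite mulr_gt0// exprn_gt0.
  have h2 := mulr_gt0 K0 E0.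
  by move: (K ^+ 2 * C) (K * expR 1) h1 h2 => u v; lra.
move=> n z n0 z0 w I0; have zV : 0 < z^-1 by rewrite invr_gt0.
have N0 : 0 < n%:R :> R by rewrite ltr0n.
have N1 : 1 <= n%:R :> R by rewrite ler1n.
have nz0 : 0 < n%:R * z by rewrite mulr_gt0.
have D0 := decay_gt0 c z0.
have I00 : 0 < I0 by rewrite divr_gt0 ?ltr0n ?fact_gt0// exprn_gt0.
have [d dK Hd] := H _ zV.
have [gi Hg] := HC n z n0 z0; move: gi Hg.
set g := (fun y => y ^+ n * _ * _) => gi Hg.
have [wi Ew] := Rintegral_exprn_expR n nz0.
have [w1i Ew1] := Gamma_first_moment n z^-1 nz0.
have [w2i Ew2] := Gamma_second_moment n z nz0.
pose e y := f y - f z^-1 - (y - z^-1) * d.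
pose b1 := K ^+ 2 * decay c z; pose b2 := K * expR 1 * decay c z.
have b10 : 0 < b1 by rewrite mulr_gt0// exprn_gt0.
have b20 : 0 < b2 by apply: mulr_gt0 => //; exact: mulr_gt0.
have w0 y : 0 < y -> 0 <= w y by move=> y0; rewrite mulr_ge0 ?expR_ge0// exprn_ge0// ltW.
have we y : 0 < y -> `|w y * e y| <= b1 * g y + b2 * (w y * (z * y - 1) ^+ 2).
  move=> y0; rewrite normrM ger0_norm ?w0//.
  have t0 := mulr_gt0 z0 y0.
  pose G := (z * y) `^ (- (1 + alpha)) * expR (z * y / 2).
  have -> : b1 * g y + b2 * (w y * (z * y - 1) ^+ 2) =
      w y * (K * (z * y - 1) ^+ 2 * (K * (G * decay c z) + expR 1 * decay c z)).
    rewrite /g /w /G /b1 /b2.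
    move: (decay c z) (expR 1) (expR (_ / 2)) ((z * y) `^ _) (expR _) => *; ring.
  rewrite ler_wpM2l ?w0//; apply: (le_trans (Hd y y0)).
  have -> : K * (y - z^-1) ^+ 2 / z^-1 ^+ 2 = K * (z * y - 1) ^+ 2.
    by field; rewrite gt_eqF.
  apply: ler_wpM2l; first by rewrite mulr_ge0 ?sqr_ge0 ?(ltW K0).
  apply: lerD; last exact: majorant_inv_le.
  have /andP[_ h] := fK y y0; apply: (le_trans h).
  by rewrite (ler_pM2l K0); exact: majorant_le.
have mwe : measurable_fun `](0 : R), +oo[ (fun y => w y * e y).
  apply: continuous_measurable_fun0y => y y0.
  have cw : {for y, continuous w}.
    by apply: has_derive_continuous; rewrite /w; repeat derive_step.
  have cd : {for y, continuous (fun y => (y - z^-1) * d)}.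
    by apply: has_derive_continuous; repeat derive_step.
  apply: cvgM; first exact: cw.
  by apply: cvgB cd; apply: cvgB; [exact: stable_density_continuous|exact: cvg_cst].
have bi := integrableD_itv (integrableZl_itv b1 gi) (integrableZl_itv b2 w2i).
have wei : mu.-integrable `](0 : R), +oo[ (EFin \o (fun y => w y * e y)).
  apply: le_integrable_EFin bi => // y.
  by rewrite /= in_itv/= andbT; exact: we.
(* The affine part is integrated exactly and only w e is estimated. The linear term survives because
   the weight has mean (n+1)/(n z) and not 1/z; it contributes d I0 / (n z). *)
have wfE : (fun y => w y * f y) = (fun y => f z^-1 * w y + d * (w y * (y - z^-1)) + w y * e y).
  by apply/funext => y; rewrite /e; ring.
have i1 := integrableZl_itv (f z^-1) wi.
have i2 := integrableZl_itv d w1i.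
have i12 := integrableD_itv i1 i2.
rewrite wfE; split; first exact: integrableD_itv i12 wei.
rewrite RintegralD// RintegralD// !RintegralZl// Ew Ew1 -/I0.
rewrite (_ : f z^-1 * I0 + d * (I0 * (n.+1%:R / (n%:R * z) - z^-1)) + _ - I0 * f z^-1 =
  d * z^-1 * (I0 / n%:R) + \int[mu]_(y in `]0, +oo[) (w y * e y)); last first.
  move: (\int[mu]_(y in _) _) (I0) (f _) => J I f0; rewrite -natr1; field.
  by rewrite !gt_eqF.
apply: (le_trans (ler_normD _ _)).
have h1 : `|d * z^-1 * (I0 / n%:R)| <= b2 * (I0 / n%:R).
  have In0 : 0 < I0 / n%:R by rewrite divr_gt0.
  rewrite (normrM (d * z^-1)) (normrM d) (gtr0_norm zV) (gtr0_norm In0) ler_pM2r//.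
  rewrite -(ler_pdivlMr _ _ zV); apply: (le_trans dK).
  by rewrite ler_pM2r ?invr_gt0// /b2 -mulrA ler_pM2l//; exact: majorant_inv_le.
have h2 : `|\int[mu]_(y in `]0, +oo[) (w y * e y)| <=
    b1 * (C / n%:R * I0) + b2 * (3 * (I0 / n%:R)).
  apply: (le_trans (le_normr_Rintegral_itv wei bi _)).
    by move=> y; rewrite in_itv/= andbT; exact: we.
  rewrite RintegralD//; [|exact: integrableZl_itv gi|exact: integrableZl_itv w2i].
  rewrite !RintegralZl// Ew2 -/I0 lerD// ?ler_pM2l//.
  rewrite [leRHS]mulrCA ler_pM2l// -[n.+2%:R]natr1 -[n.+1%:R]natr1.
  move: (n%:R : R) N0 N1 => N N0 N1.
  rewrite (_ : _ + 1 = (N + 2) / N / N); last by field; rewrite !gt_eqF.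
  by rewrite ler_wpM2r ?invr_ge0 ?(ltW N0)// ler_pdivrMr//; lra.
apply: (le_trans (lerD h1 h2)); rewrite le_eqVlt; apply/orP; left; apply/eqP.
by rewrite /b1 /b2; move: (expR 1) (decay c z) (I0) => *; field; rewrite gt_eqF.
Qed.
End stable_laplace.

(** * The integral as a continuous function of z, and the size of its error term *)

Section stable_integral.
Context {R : realType} (alpha : R).
Context (alpha_gt0 : 0 < alpha) (alpha_lt1 : alpha < 1).
Notation mu := (@lebesgue_measure R).
Local Notation f := (stable_density alpha).
Implicit Types (c y z : R).

Lemma decay_continuous c z : 0 < z -> {for z, continuous (decay alpha c)}.
Proof. by move=> z0; apply: has_derive_continuous; rewrite /decay; repeat derive_step. Qed.

Definition laplace_integral n z : R :=
  \int[mu]_(y in `]0, +oo[) (y ^+ n * expR (- (n%:R * z) * y) * f y).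

Lemma stable_integralE n z : (0 < n)%N -> 0 < z ->
  stable_integral alpha n z = (laplace_integral n z)%:E.
Proof.
move=> n0 z0; have [c [K [_ _ _ H]]] := stable_laplace alpha_gt0 alpha_lt1.
have [i _] := H n z n0 z0.
rewrite -(integrable_EFin_Rintegral _ i)//; apply: eq_integral => y.
rewrite inE/= in_itv/= andbT => y0; congr (_ * _)%:E.
rewrite /phi (_ : - n%:R * (z * y - ln y) = n%:R * ln y + - (n%:R * z) * y); last by ring.
by rewrite expRD expRM_natl lnK ?posrE.
Qed.

(** As f > 0, the integrand decreases in z, so on ]z/2, 2z[ its value at z/2 is a common
    majorant. *)
Lemma laplace_integral_continuous n z : (0 < n)%N -> 0 < z ->
  {for z, continuous (laplace_integral n)}.
Proof.
move=> n0 z0; have [c [K [_ _ fK H]]] := stable_laplace alpha_gt0 alpha_lt1.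
have f0 y : 0 < y -> 0 < f y.
  by move=> y0; have := fK y^-1; rewrite invrK invr_gt0 => /(_ y0)/andP[].
have z2 : 0 < z / 2 by rewrite divr_gt0.
have [i _] := H n (z / 2) n0 z2.
have zI : z \in `]z / 2, (2 * z)[%classic by rewrite inE/= in_itv/=; apply/andP; split; lra.
apply: (@continuity_under_integral _ _ _ mu
  (fun z y => y ^+ n * expR (- (n%:R * z) * y) * f y) _ _ (z / 2) (2 * z) _ _ _ i _ z zI) => //.
- move=> x /=; rewrite in_itv/= => /andP[x1 _]; have x0 : 0 < x by lra.
  by have [] := H n x n0 x0.
- apply: aeW => y _ x _; apply: has_derive_continuous; by repeat derive_step.
- move=> x /=; rewrite in_itv/= => /andP[x1 _]; apply: aeW => y.
  rewrite /= in_itv/= andbT => y0.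
  rewrite normrM (gtr0_norm (f0 y y0)) ler_pM2r ?f0// normrM.
  rewrite !ger0_norm ?expR_ge0 ?exprn_ge0 ?(ltW y0)// ler_wpM2l ?exprn_ge0 ?(ltW y0)//.
  by rewrite ler_expR !mulNr lerN2 ler_wpM2r ?(ltW y0)// ler_wpM2l// ltW.
Qed.

(** z^(1+alpha+p) is the power (1+alpha+p)/alpha of z^alpha, and exp(min(c, 1/2) z^alpha) dominates
    every power of z^alpha. *)
Lemma decay_bigO c p : 0 < c -> 0 < p -> exists2 C : R, 0 < C &
  forall z, 0 < z -> decay alpha c z <= C * z `^ (- p).
Proof.
move=> c0 p0; pose c1 := Num.min c 2^-1.
have a0 : 0 < alpha by exact: alpha_gt0.
have c10 : 0 < c1 by rewrite lt_min c0/= invr_gt0.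
have q0 : 0 <= (1 + alpha + p) / alpha by rewrite divr_ge0 ?(ltW a0)//; lra.
have [C C0 HC] := powR_le_expR q0 c10.
exists C => // z z0; have := HC _ (powR_ge0 z alpha).
rewrite -powRrM mulrC divfK ?gt_eqF// powRD ?(gt_eqF z0) ?implybT//.
have zp : 0 < z `^ p by rewrite powR_gt0.
by rewrite /decay -/c1 mulNr powRN expRN ler_pdivrMr ?expR_gt0// mulrAC ler_pdivlMr//.
Qed.

Lemma decay_le c z : 0 < c -> 0 < z -> decay alpha c z <= z `^ (1 + alpha).
Proof.
move=> c0 z0; rewrite /decay -[leRHS]mulr1 ler_wpM2l ?powR_ge0// -expR0 ler_expR.
by rewrite mulNr oppr_le0 mulr_ge0 ?powR_ge0// le_min (ltW c0)/= invr_ge0.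
Qed.

End stable_integral.

Theorem lemma3 (R : realType) (alpha : R)
    (alpha_gt0 : 0 < alpha) (alpha_lt1 : alpha < 1) :
  exists Delta : R -> R,
    [/\ {within `]0, +oo[, continuous Delta},
        (forall z : R, 0 < z -> 0 < Delta z),
        (forall n : nat, (0 < n)%N ->
           exists delta : R -> R,
             {within `]0, +oo[, continuous delta} /\
             (forall z : R, 0 < z ->
                stable_integral alpha n z =
                  (z^-1 ^+ n.+1 * stable_density alpha z^-1 * expR (- n%:R) *
                   Num.sqrt (2 * pi / n%:R) * (1 + delta z))%:E /\
                `|delta z| <= Delta z / n%:R)),
        Delta =O_ (0^'+) (fun=> 1 : R) &
        bigO_zpow_ninfty (fun z : R => Delta z * stable_density alpha z^-1)].
Proof.
have [c [K [c0 K0 fK HI]]] := stable_laplace alpha_gt0 alpha_lt1.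
have [C C0 HC] := @stirling R.
have [k [Y [k0 Y0 Hk]]] := stable_density_lower alpha_gt0 alpha_lt1.
(* Two errors are collected: that of the Laplace approximation, of size K, times the Stirling factor
   s <= 1 + C, and that of Stirling's formula, of size C, times the bound K for f(1/z) relative to
   the decay. The equation keeps B opaque. *)
have [B B0 HB] : exists2 B : R, 0 < B & B = K * (1 + C) + C * K.
  by exists (K * (1 + C) + C * K) => //; rewrite addr_gt0 ?mulr_gt0 ?addr_gt0.
have f0 (z : R) : 0 < z -> 0 < stable_density alpha z^-1 by move=> /fK/andP[].
have inv_cont (z : R) : 0 < z -> {for z, continuous (fun z : R => stable_density alpha z^-1)}.
  move=> z0; apply: (@continuous_comp _ _ _ (fun z : R => z^-1)).
    by apply: has_derive_continuous; repeat derive_step.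
  by apply: stable_density_continuous; rewrite ?invr_gt0.
have within0y (g : R -> R) : (forall z : R, 0 < z -> {for z, continuous g}) ->
    {within `]0, +oo[, continuous g}.
  move=> cg; apply: continuous_in_subspaceT => z.
  by rewrite inE/= in_itv/= andbT; exact: cg.
exists (fun z : R => B * decay alpha c z / stable_density alpha z^-1); split.
- apply: within0y => z z0; apply: cvgM.
    by apply: cvgM; [exact: cvg_cst|exact: decay_continuous z0].
  by apply: cvgV; [rewrite gt_eqF// f0|exact: inv_cont].
- by move=> z z0; rewrite divr_gt0 ?f0// mulr_gt0 ?decay_gt0.
- move=> n n0; have N0 : 0 < n%:R :> R by rewrite ltr0n.
  have N1 : 1 <= n%:R :> R by rewrite ler1n.
  have [s s1 sE] := HC n n0.
  have [q q0 qE] : exists2 q : R, 0 < q & q = expR (- n%:R) * Num.sqrt (2 * pi / n%:R).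
    exists (expR (- n%:R) * Num.sqrt (2 * pi / n%:R)) => //.
    by rewrite mulr_gt0 ?expR_gt0// sqrtr_gt0 divr_gt0 ?mulr_gt0 ?pi_gt0.
  (* delta is the solution of the required identity, so the identity and continuity only use that
     the leading factor does not vanish; the work lies in the bound. *)
  exists (fun z : R => laplace_integral alpha n z / (z^-1 ^+ n.+1 * q * stable_density alpha z^-1) - 1).
  split.
    apply: within0y => z z0; have zV : 0 < z^-1 by rewrite invr_gt0.
    have d0 : 0 < z^-1 ^+ n.+1 * q * stable_density alpha z^-1.
      by apply: mulr_gt0 (f0 z z0); apply: mulr_gt0 => //; exact: exprn_gt0.
    apply: cvgB; last exact: cvg_cst.
    apply: cvgM; first exact: laplace_integral_continuous.
    apply: cvgV; first by rewrite gt_eqF.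
    apply: cvgM; last exact: inv_cont.
    have : {for z, continuous (fun z : R => (z^-1 ^+ n.+1 * q : R))}.
      by apply: has_derive_continuous; repeat derive_step.
    exact.
  move=> z z0; have zV : 0 < z^-1 by rewrite invr_gt0.
  have [_] := HI n z n0 z0; rewrite -/(laplace_integral alpha n z).
  rewrite (stable_integralE alpha_gt0 alpha_lt1 n0 z0).
  have -> : n`!%:R / (n%:R * z) ^+ n.+1 = z^-1 ^+ n.+1 * q * s.
    rewrite exprMn invfM mulrA sE -qE exprVn.
    by rewrite mulrC mulrA.
  have /andP[] := fK z z0; have := f0 z z0; have := decay_gt0 alpha c z0.
  have : 0 < z^-1 ^+ n.+1 by rewrite exprn_gt0.
  have ACE (a g e S t : R) : a * g * e * S * t = a * (e * S) * g * t by ring.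
  rewrite ACE -qE; move: (laplace_integral alpha n z) (stable_density alpha z^-1) (decay alpha c z) (z^-1 ^+ n.+1).
  move=> I g D p p0 D0 g0 _ gD hI; split.
    congr _%:E; field; by rewrite !gt_eqF.
  have pqg : 0 < p * q * g by rewrite !mulr_gt0.
  have -> : I / (p * q * g) - 1 = (I - p * q * g) / (p * q * g).
    by field; rewrite !gt_eqF.
  rewrite normrM [X in _ * X]gtr0_norm ?invr_gt0// ler_pdivrMr//.
  (* The intermediate value p q s g is f(1/z) n!/(n z)^(n+1), against which the Laplace error is
     measured; the factor s - 1 is the error in Stirling's formula. *)
  have -> : I - p * q * g = (I - p * q * s * g) + p * q * g * (s - 1) by ring.
  apply: (le_trans (ler_normD _ _)).
  have h2 : `|p * q * g * (s - 1)| <= p * q * (K * D) * (C / n%:R).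
    rewrite normrM gtr0_norm// ler_pM ?(ltW pqg)// ler_pM2l// mulr_gt0//.
  have sC : s <= 1 + C.
    have : C / n%:R <= C by rewrite ler_pdivrMr// ler_peMr// ltW.
    by move: s1; rewrite ler_norml; move: (C / n%:R) => ? /andP[_]; lra.
  have h1 : `|I - p * q * s * g| <= K / n%:R * D * (p * q * (1 + C)).
    apply: le_trans hI _.
    rewrite !mulrA ler_wpM2l// !mulr_ge0 ?invr_ge0// ltW//.
  apply: (le_trans (lerD h1 h2)); rewrite HB le_eqVlt; apply/orP; left; apply/eqP.
  by field; rewrite !gt_eqF.
- apply/eqO_exP; exists (B / k); first by rewrite divr_gt0.
  near=> z; have z0 : 0 < z by near: z; exact: nbhs_right_gt.
  have zY : z <= Y^-1 by near: z; apply: nbhs_right_le; rewrite invr_gt0.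
  rewrite normr1 mulr1 ger0_norm; last by rewrite ltW// divr_gt0 ?f0// mulr_gt0 ?decay_gt0.
  rewrite ler_pdivrMr ?f0// -mulrA ler_pM2l//.
  apply: (le_trans (decay_le alpha c0 z0)).
  have Yz : Y <= z^-1 by rewrite -[Y]invrK lef_pV2 ?posrE ?invr_gt0.
  rewrite ler_pdivlMl//; have := Hk _ Yz.
  congr (_ * _ <= _).
  by rewrite -powR_inv1 ?(ltW z0)// -powRrM mulN1r opprK.
(* In Delta(z) f(1/z) the density cancels, which leaves B times the decay. *)
- move=> p p0; have [C' C'0 HC'] := decay_bigO alpha_gt0 c0 p0.
  apply/eqO_exP; exists (B * C'); first by rewrite mulr_gt0.
  near=> z; have z0 : 0 < z by near: z; exact: nbhs_pinfty_gt.
  rewrite divfK ?gt_eqF ?f0// !ger0_norm ?powR_ge0//; last first.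
    by rewrite ltW// mulr_gt0 ?decay_gt0.
  by rewrite -mulrA ler_pM2l// HC'.
Unshelve. all: by end_near. Qed.
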